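(* Let $$\begin{pmatrix} x \\ y \end{pmatrix}\mapsto H(x,y,\varepsilon)=\begin{pmatrix} x \\ y \end{pmatrix}+\begin{pmatrix}\tilde f(x,y,\varepsilon) \\ \varepsilon\tilde g(x,y,\varepsilon)\end{pmatrix},\qquad (x,y)\in\mathbb{R}^2,$$ be a $C^r$-smooth planar fast-slow map in standard form with $r\ge3$ and $H(0,0,0)=(0,0)^{\mathrm T}$. Assume that the map has a unipotent singularity at $(x,y)=(0,0)\in S$. Then there exist a neighbourhood $\mathcal U\ni(0,0)$ and an $\varepsilon_0>0$ such that for all $(x,y,\varepsilon)\in\mathcal U\times[0,\varepsilon_0)$ and $l\in\{1,\dots,r\}$ we have $$j^lH(x,y,\varepsilon)=j^l\Phi^1_V(x,y,\varepsilon),$$ where $\Phi^1_V(x,y,\varepsilon)$ denotes the time-$1$ flow of an $\varepsilon$-family of vector fields $V(x,y,\varepsilon)$ on $\mathbb{R}^2$. The truncated vector field $j^rV$ is fast-slow in the standard form $$j^rV(x,y,\varepsilon)=\begin{pmatrix}\mathcal V_1(x,y,\varepsilon) \\ \varepsilon\mathcal V_2(x,y,\varepsilon)\end{pmatrix}=\begin{pmatrix}K(x,y)\,j^r\tilde f(x,y,0)+O(\varepsilon) \\ \varepsilon(\tilde g(0,0,0)+O(x,y,\varepsilon))\end{pmatrix},$$ where the function $K(x,y)$ satisfies $K(0,0)=1$. The vector field $j^rV$ has a critical manifold $$j^rS=\{(x,y)\in\mathcal U: j^r\tilde f(x,y,0)=0\},$$ for which $(0,0)\in j^rS$ is a nilpotent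 singularity. In particular, $(0,0)$ is (for the vector field $j^rV$) a 1. regular fold point if $(0,0)$ is a regular fold point of the map $H$; 2. transcritical point if $(0,0)$ is a transcritical point of the map $H$; 3. pitchfork point if $(0,0)$ is a pitchfork point of the map $H$.
   Context: Here $0\le\varepsilon\ll1$ is a small parameter and $S=\{(x,y):\tilde f(x,y,0)=0\}$ is the critical manifold of the map. In this planar setting $(0,0)\in S$ is a unipotent singularity iff $\frac{\partial\tilde f}{\partial x}(0,0,0)=0$. For a vector field $(\mathcal V_1,\varepsilon\mathcal V_2)^{\mathrm T}$ with critical manifold $\{\mathcal V_1(x,y,0)=0\}$, a point on it at which $\frac{\partial\mathcal V_1}{\partial x}(\cdot,\cdot,0)=0$ is called a nilpotent singularity. Definitions (for the map; derivatives evaluated at $(0,0,0)$). - Regular fold point at $(0,0)$: $\tilde f=0$, $\tilde f_x=0$, and $\tilde f_{xx}\ne0$, $\tilde f_y\neq0$, $\tilde g\ne0$. - Transcritical point at $(0,0)$: $\tilde f=0$, $\tilde f_x=0$, $\tilde f_y=0$, and $\tilde f_{xx}\neq0$, $\det\begin{pmatrix}\tilde f_{xx}&\tilde f_{xy} \\ \tilde f_{yx}&\tilde f_{yy}\end{pmatrix}<0$, $\tilde g\ne0$. - Pitchfork point at $(0,0)$: $\tilde f=0$, $\tilde f_x=0$, $\tilde f_y=0$, $\tilde f_{xx}=0$, and $\tilde f_{xxx}\neq0$, $\tilde f_{xy}\neq0$, $\tilde g\neq0$. For the vector field $(\mathcal V_1,\varepsilon\mathcal V_2)^{\mathrm T}$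 the same definitions are used with $\mathcal V_1,\mathcal V_2$ in place of $\tilde f,\tilde g$. The operator $j^l$ denotes the $l$-jet at the origin: truncation of the Taylor expansion in $(x,y,\varepsilon)$ (or in $(x,y)$ for functions of $(x,y)$ only) after the terms of degree $l$.
   Formalization: For j^rV the leading term is j^r(K·j^r f) instead of K·j^r f, and the exact factorization and critical manifold j^rS are asserted for V itself, not j^rV: literally false for f=y+x², g=1, r=3, where truncation leaves −(3/2)x⁴+… on y=−x². *)

(* Defs.v *)
From Stdlib Require Import Reals.
From Coquelicot Require Import Coquelicot.
Open Scope R_scope.

(* Functions of (x,y,eps) are curried total functions; only their values with
   eps >= 0 are meaningful, so every notion below looks at eps >= 0 only. *)

Definition plane (p : R * R) : Prop := True.

Definition slab (W : R * R -> Prop) (e1 : R) (q : R * R * R) : Prop :=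
  W (fst q) /\ 0 <= snd q < e1.

Definition Dx (f : R -> R -> R -> R) (x y e : R) : R :=
  Derive (fun s => f s y e) x.

Definition Dy (f : R -> R -> R -> R) (x y e : R) : R :=
  Derive (fun s => f x s e) y.

(* Difference quotients in eps only use points with eps + h >= 0: one-sided
   derivative at eps = 0, ordinary derivative at eps > 0. *)
Definition eps_steps (e : R) : (R -> Prop) -> Prop :=
  within (fun h => 0 <= e + h) (locally' 0).

Definition eps_quotient (f : R -> R -> R -> R) (x y e h : R) : R :=
  (f x y (e + h) - f x y e) / h.

Definition De (f : R -> R -> R -> R) (x y e : R) : R :=
  lim (filtermap (eps_quotient f x y e) (eps_steps e)).

Definition ex_De (f : R -> R -> R -> R) (x y e : R) : Prop :=
  exists d : R, filterlim (eps_quotient f x y e) (eps_steps e) (locally d).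

Definition continuous_on_slab (W : R * R -> Prop) (e1 : R)
    (f : R -> R -> R -> R) : Prop :=
  forall x y e : R, slab W e1 (x, y, e) ->
    filterlim (fun q : R * R * R => f (fst (fst q)) (snd (fst q)) (snd q))
      (within (slab W e1) (locally (x, y, e))) (locally (f x y e)).

(* Class C^k on W x [0,e1), for W open. *)
Fixpoint smooth (k : nat) (W : R * R -> Prop) (e1 : R)
    (f : R -> R -> R -> R) : Prop :=
  continuous_on_slab W e1 f /\
  match k with
  | O => True
  | S m =>
      (forall x y e : R, slab W e1 (x, y, e) ->
         ex_derive (fun s => f s y e) x /\
         ex_derive (fun s => f x s e) y /\
         ex_De f x y e) /\
      smooth m W e1 (Dx f) /\ smooth m W e1 (Dy f) /\ smooth m W e1 (De f)
  end.

Definition comp1 (F : R -> R -> R -> R * R) (x y e : R) : R := fst (F x y e).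
Definition comp2 (F : R -> R -> R -> R * R) (x y e : R) : R := snd (F x y e).

Definition smooth2 (k : nat) (W : R * R -> Prop) (e1 : R)
    (F : R -> R -> R -> R * R) : Prop :=
  smooth k W e1 (comp1 F) /\ smooth k W e1 (comp2 F).

Definition partial0 (i j k : nat) (f : R -> R -> R -> R) : R :=
  Nat.iter i Dx (Nat.iter j Dy (Nat.iter k De f)) 0 0 0.

(* The l-jet at the origin, as a polynomial function of (x,y,eps).  For a
   function that does not depend on eps it is the l-jet in (x,y). *)
Definition jet (l : nat) (f : R -> R -> R -> R) (x y e : R) : R :=
  sum_n (fun n => sum_n (fun i => sum_n (fun j =>
    partial0 i j (n - i - j) f
      / (INR (Factorial.fact i) * INR (Factorial.fact j) * INR (Factorial.fact (n - i - j)))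
      * x ^ i * y ^ j * e ^ (n - i - j))
    (n - i)) n) l.

Definition jet2 (l : nat) (F : R -> R -> R -> R * R) (x y e : R) : R * R :=
  (jet l (comp1 F) x y e, jet l (comp2 F) x y e).

Definition fast_slow_map (f g : R -> R -> R -> R) (x y e : R) : R * R :=
  (x + f x y e, y + e * g x y e).

Definition fast_slow_field (v1 v2 : R -> R -> R -> R) (x y e : R) : R * R :=
  (v1 x y e, e * v2 x y e).

(* Serves both for maps (f = ftilde) and for vector fields (f = V_1). *)
Definition critical_manifold (W : R * R -> Prop) (f : R -> R -> R -> R)
    (p : R * R) : Prop :=
  W p /\ f (fst p) (snd p) 0 = 0.

Definition unipotent_singularity (W : R * R -> Prop) (f : R -> R -> R -> R)
    (p : R * R) : Prop :=
  critical_manifold W f p /\ Dx f (fst p) (snd p) 0 = 0.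

Definition nilpotent_singularity (W : R * R -> Prop) (v1 : R -> R -> R -> R)
    (p : R * R) : Prop :=
  critical_manifold W v1 p /\ Dx v1 (fst p) (snd p) 0 = 0.

Definition regular_fold (f g : R -> R -> R -> R) : Prop :=
  f 0 0 0 = 0 /\ Dx f 0 0 0 = 0 /\
  Dx (Dx f) 0 0 0 <> 0 /\ Dy f 0 0 0 <> 0 /\ g 0 0 0 <> 0.

Definition transcritical (f g : R -> R -> R -> R) : Prop :=
  f 0 0 0 = 0 /\ Dx f 0 0 0 = 0 /\ Dy f 0 0 0 = 0 /\
  Dx (Dx f) 0 0 0 <> 0 /\
  Dx (Dx f) 0 0 0 * Dy (Dy f) 0 0 0 - Dy (Dx f) 0 0 0 * Dx (Dy f) 0 0 0 < 0 /\
  g 0 0 0 <> 0.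

Definition pitchfork (f g : R -> R -> R -> R) : Prop :=
  f 0 0 0 = 0 /\ Dx f 0 0 0 = 0 /\ Dy f 0 0 0 = 0 /\ Dx (Dx f) 0 0 0 = 0 /\
  Dx (Dx (Dx f)) 0 0 0 <> 0 /\ Dy (Dx f) 0 0 0 <> 0 /\ g 0 0 0 <> 0.

(* Phi t x y e is the time-t solution of the planar system V(.,.,e) started at
   (x,y), for all starting points in U and all t in [0,1]. *)
Definition is_flow (U : R * R -> Prop) (e0 : R) (V : R -> R -> R -> R * R)
    (Phi : R -> R -> R -> R -> R * R) : Prop :=
  forall x y e : R, slab U e0 (x, y, e) ->
    Phi 0 x y e = (x, y) /\
    forall t : R, 0 <= t <= 1 ->
      let p := Phi t x y e in
      is_derive (fun s => fst (Phi s x y e)) t (fst (V (fst p) (snd p) e)) /\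
      is_derive (fun s => snd (Phi s x y e)) t (snd (V (fst p) (snd p) e)).

(* v1 = F0(x,y) + O(eps)  and  v2 = c + O(x,y,eps)  on U x [0,e0). *)
Definition leading_form (U : R * R -> Prop) (e0 : R) (F0 : R -> R -> R) (c : R)
    (v1 v2 : R -> R -> R -> R) : Prop :=
  exists C : R, forall x y e : R, slab U e0 (x, y, e) ->
    Rabs (v1 x y e - F0 x y) <= C * e /\
    Rabs (v2 x y e - c) <= C * (Rabs x + Rabs y + e).

(* Main.v *)
From Stdlib Require Import Reals Lra Lia FunctionalExtensionality.
From Coquelicot Require Import Coquelicot.
From Stdlib Require Import List Factorial.
Require Import Defs.
Open Scope R_scope.

(** Give x, y, eps the weights 1, 2, 3.  Since ftilde has no constant and no linear
    x-term, a field (K F + eps A, eps B) with F(x,y) = j^r ftilde(x,y,0) raises the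
    weight by at least one when it acts as a Lie derivative L.  Hence exp(L) makes
    sense weight by weight, and the equation exp(L)(x,y) = j^r H can be solved for
    polynomials K, A, B by a fixed-point iteration that gains one weight per round;
    every term of exp(L) x is visibly in the ideal (F, eps), so the factor F is never
    lost.  The polynomial field so obtained has a convergent Lie series on a small
    polydisc |x| < s, |y| < s^2, 0 <= eps < s^3: the field has norm O(s) relative to the
    weighted radii.  Exponentials of derivations are algebra morphisms (Leibniz), so the
    sum of the series is the flow; it is smooth because it is a geometrically convergent
    series of polynomials whose degrees grow linearly, and its jets are those of a
    finite partial sum because the n-th term vanishes to weight n. *)

(** * Weighted polynomials and their norms *)

(** The linear part of the map at the origin is only unipotent: the x-component may contain y and
    eps linearly, the y-component may contain eps. A Lie derivative therefore need not raise the
    ordinary degree, and neither the exponential nor its inversion could be organised degree by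
    degree. The chain eps, y, x of linear influences forces strictly decreasing weights, and 3, 2, 1
    are the smallest positive integers that do this. Since a monomial of degree at most r has weight
    at most 3r, working up to weight 3r settles the whole r-jet. The unknowns are the factors q, a,
    b and not the components of the field: this keeps F visible through the iteration, and K is then
    the slice of q at eps = 0. Convergence rests on a count of degrees. A Lie derivative costs a
    factor equal to the current degree, and the degree grows by a fixed amount per step, so k steps
    cost a constant to the power k times k!. The exponential divides by k!, and what is left is
    geometric in the relative size of the field, which shrinking the polydisc makes small. The
    neighbourhood and the bound on eps both come from that radius. *)

Record mono := Mono { mc : R; mx : nat; my : nat; me : nat }.

Definition mev (m : mono) (x y e : R) : R :=
  mc m * x ^ mx m * y ^ my m * e ^ me m.

Fixpoint ev (P : list mono) (x y e : R) : R :=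
  match P with nil => 0 | m :: P' => mev m x y e + ev P' x y e end.

Definition mwt (m : mono) : nat := (mx m + 2 * my m + 3 * me m)%nat.

Inductive dir := dX | dY | dE.

(** For a zero exponent the coefficient becomes 0 and [pred] leaves the exponent at 0, so no case
    distinction is needed. *)
Definition lower (d : dir) (m : mono) : mono :=
  match d with
  | dX => Mono (mc m * INR (mx m)) (pred (mx m)) (my m) (me m)
  | dY => Mono (mc m * INR (my m)) (mx m) (pred (my m)) (me m)
  | dE => Mono (mc m * INR (me m)) (mx m) (my m) (pred (me m))
  end.

Definition der (d : dir) (P : list mono) : list mono := map (lower d) P.

Definition dwt (d : dir) : nat := match d with dX => 1 | dY => 2 | dE => 3 end.

Definition mmul (m n : mono) : mono :=
  Mono (mc m * mc n) (mx m + mx n) (my m + my n) (me m + me n).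

Definition mul (P Q : list mono) : list mono :=
  flat_map (fun m => map (mmul m) Q) P.

Definition pscal (c : R) (P : list mono) : list mono :=
  map (fun m => Mono (c * mc m) (mx m) (my m) (me m)) P.

Definition wt (n : nat) (P : list mono) : Prop :=
  Forall (fun m => (n <= mwt m)%nat) P.

Definition wdeg (n : nat) (P : list mono) : Prop :=
  Forall (fun m => (mwt m <= n)%nat) P.

(* The polydisc |x| <= s, |y| <= s^2, |eps| <= s^3 makes the norm homogeneous
   for the weights 1, 2, 3. *)
Fixpoint nrm (s : R) (P : list mono) : R :=
  match P with nil => 0 | m :: P' => Rabs (mc m) * s ^ mwt m + nrm s P' end.

Definition box (s x y e : R) : Prop :=
  Rabs x <= s /\ Rabs y <= s ^ 2 /\ Rabs e <= s ^ 3.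

Lemma ev_app P Q x y e : ev (P ++ Q) x y e = ev P x y e + ev Q x y e.
Proof. induction P as [|m P IH]; simpl; [ring|rewrite IH; ring]. Qed.

Lemma mev_mmul m n x y e : mev (mmul m n) x y e = mev m x y e * mev n x y e.
Proof. unfold mev; simpl; rewrite !pow_add; ring. Qed.

Lemma ev_mul P Q x y e : ev (mul P Q) x y e = ev P x y e * ev Q x y e.
Proof.
  induction P as [|m P IH]; simpl; [ring|].
  rewrite ev_app, IH.
  assert (H : ev (map (mmul m) Q) x y e = mev m x y e * ev Q x y e).
  { clear; induction Q as [|n Q IH]; simpl; [ring|rewrite IH, mev_mmul; ring]. }
  rewrite H; ring.
Qed.

Lemma ev_scal c P x y e : ev (pscal c P) x y e = c * ev P x y e.
Proof.
  induction P as [|m P IH]; simpl; [ring|rewrite IH; unfold mev; simpl; ring].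
Qed.

Lemma Forall_mul (p q t : mono -> Prop) P Q :
  (forall m n, p m -> q n -> t (mmul m n)) ->
  Forall p P -> Forall q Q -> Forall t (mul P Q).
Proof.
  intros H HP HQ; unfold mul; apply Forall_flat_map.
  eapply Forall_impl; [|exact HP]; intros m Hm; apply Forall_map.
  eapply Forall_impl; [|exact HQ]; intros n Hn; auto.
Qed.

Lemma wt_mul i j P Q : wt i P -> wt j Q -> wt (i + j) (mul P Q).
Proof. apply Forall_mul; unfold mwt; simpl; intros; lia. Qed.

Lemma wdeg_mul i j P Q : wdeg i P -> wdeg j Q -> wdeg (i + j) (mul P Q).
Proof. apply Forall_mul; unfold mwt; simpl; intros; lia. Qed.

Lemma wt_app i P Q : wt i P -> wt i Q -> wt i (P ++ Q).
Proof. intros; apply Forall_app; split; assumption. Qed.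

Lemma wdeg_app i P Q : wdeg i P -> wdeg i Q -> wdeg i (P ++ Q).
Proof. intros; apply Forall_app; split; assumption. Qed.

Lemma wt_0 P : wt 0 P.
Proof. apply List.Forall_forall; intros; apply Nat.le_0_l. Qed.

Lemma wt_le i j P : (i <= j)%nat -> wt j P -> wt i P.
Proof. intros H; apply Forall_impl; intros; lia. Qed.

Lemma wdeg_le i j P : (i <= j)%nat -> wdeg i P -> wdeg j P.
Proof. intros H; apply Forall_impl; intros; lia. Qed.

Lemma wt_scal i c P : wt i P -> wt i (pscal c P).
Proof. intros H; apply Forall_map; eapply Forall_impl; [|exact H]; auto. Qed.

Lemma wdeg_scal i c P : wdeg i P -> wdeg i (pscal c P).
Proof. intros H; apply Forall_map; eapply Forall_impl; [|exact H]; auto. Qed.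

Lemma wt_der d i P : wt i P -> wt (i - dwt d) (der d P).
Proof.
  intros H; apply Forall_map; eapply Forall_impl; [|exact H].
  intros m Hm; destruct d; unfold mwt in *; simpl in *; lia.
Qed.

Lemma wdeg_der d i P : wdeg i P -> wdeg i (der d P).
Proof.
  intros H; apply Forall_map; eapply Forall_impl; [|exact H].
  intros m Hm; destruct d; unfold mwt in *; simpl in *; lia.
Qed.

Lemma wdeg_ex P : exists D, wdeg D P.
Proof.
  induction P as [|m P [D HD]]; [exists O; constructor|].
  exists (mwt m + D)%nat; constructor; [lia|].
  eapply wdeg_le; [|exact HD]; lia.
Qed.

Lemma nrm_pos s P : 0 <= s -> 0 <= nrm s P.
Proof.
  intros Hs; induction P as [|m P IH]; simpl; [lra|].
  pose proof (Rabs_pos (mc m)); pose proof (pow_le s (mwt m) Hs); nra.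
Qed.

Lemma nrm_app s P Q : nrm s (P ++ Q) = nrm s P + nrm s Q.
Proof. induction P as [|m P IH]; simpl; [ring|rewrite IH; ring]. Qed.

(** Equality, not just submultiplicativity, because products are listed without collecting like
    terms. *)
Lemma nrm_mul s P Q : nrm s (mul P Q) = nrm s P * nrm s Q.
Proof.
  induction P as [|m P IH]; simpl; [ring|].
  rewrite nrm_app, IH.
  assert (H : nrm s (map (mmul m) Q) = Rabs (mc m) * s ^ mwt m * nrm s Q).
  { clear; induction Q as [|n Q IH]; cbn [map nrm]; [ring|].
    rewrite IH; cbn [mmul mc]; rewrite Rabs_mult.
    replace (mwt (mmul m n)) with (mwt m + mwt n)%nat
      by (unfold mwt; simpl; lia).
    rewrite pow_add; ring. }
  rewrite H; ring.
Qed.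

Lemma nrm_scal s c P : nrm s (pscal c P) = Rabs c * nrm s P.
Proof.
  induction P as [|m P IH]; cbn [pscal map nrm]; [ring|].
  change (map _ P) with (pscal c P); rewrite IH; simpl; rewrite Rabs_mult.
  unfold mwt; simpl; ring.
Qed.

(** A Bernstein-type inequality: each coefficient is multiplied by an exponent, which is at most D,
    and one factor of the weighted radius [s ^ dwt d] is lost. *)
Lemma nrm_der d s D P : 0 < s -> wdeg D P ->
  s ^ dwt d * nrm s (der d P) <= INR D * nrm s P.
Proof.
  intros Hs HP; induction HP as [|m P Hm HP IH]; cbn [der map nrm]; [lra|].
  assert (s ^ dwt d * (Rabs (mc (lower d m)) * s ^ mwt (lower d m))
          <= INR D * (Rabs (mc m) * s ^ mwt m)).
  (* Here n is the exponent that comes down. If it is 0 the left side vanishes; otherwise the weight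
     drops by exactly [dwt d]. *)
  { assert (G : forall (c : R) (n w w' : nat), (n <= D)%nat ->
       (n = O \/ w' + dwt d = w)%nat ->
       s ^ dwt d * (Rabs (c * INR n) * s ^ w') <= INR D * (Rabs c * s ^ w)).
    { intros c n w w' Hn [H|H].
      - subst n; simpl (INR 0); rewrite Rmult_0_r, Rabs_R0.
        rewrite Rmult_0_l, Rmult_0_r.
        apply Rmult_le_pos; [apply pos_INR|].
        apply Rmult_le_pos; [apply Rabs_pos|apply pow_le; lra].
      - rewrite Rabs_mult, (Rabs_pos_eq (INR n)) by apply pos_INR.
        rewrite <- H, pow_add.
        pose proof (le_INR _ _ Hn).
        replace (s ^ dwt d * (Rabs c * INR n * s ^ w'))
          with (INR n * (Rabs c * (s ^ w' * s ^ dwt d))) by ring.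
        apply Rmult_le_compat_r; [|assumption].
        apply Rmult_le_pos; [apply Rabs_pos|].
        apply Rmult_le_pos; apply pow_le; lra. }
    destruct d; simpl lower; cbn [mc]; apply G;
      unfold mwt in *; simpl in *; lia. }
  change (map (lower d) P) with (der d P); nra.
Qed.

(** Turns order of vanishing into smallness; the norm at radius 1 is the sum of the absolute
    coefficients. *)
Lemma nrm_wt s n P : 0 <= s <= 1 -> wt n P -> nrm s P <= s ^ n * nrm 1 P.
Proof.
  intros Hs HP; induction HP as [|m P Hm HP IH]; cbn [nrm]; [lra|].
  rewrite pow1.
  assert (s ^ mwt m <= s ^ n).
  { replace (mwt m) with (n + (mwt m - n))%nat by lia; rewrite pow_add.
    pose proof (pow_le s n (proj1 Hs)).
    assert (s ^ (mwt m - n) <= 1).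
    { rewrite <- (pow1 (mwt m - n)); apply pow_incr; assumption. }
    nra. }
  pose proof (Rabs_pos (mc m)); nra.
Qed.

Lemma pow_abs_le x s n : Rabs x <= s -> Rabs (x ^ n) <= s ^ n.
Proof.
  intros H; rewrite <- RPow_abs; apply pow_incr; split; [apply Rabs_pos|exact H].
Qed.

Lemma mev_bound s m x y e : box s x y e ->
  Rabs (mev m x y e) <= Rabs (mc m) * s ^ mwt m.
Proof.
  intros (Hx & Hy & He); unfold mev, mwt.
  rewrite !pow_add, !pow_mult, !Rabs_mult, !Rmult_assoc.
  apply Rmult_le_compat_l; [apply Rabs_pos|].
  rewrite <- Rmult_assoc, <- (Rmult_assoc (s ^ mx m)).
  repeat (apply Rmult_le_compat; try apply Rabs_pos; try (apply pow_abs_le; assumption));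
   apply Rmult_le_pos; apply Rabs_pos.
Qed.

Lemma ev_bound s P x y e : box s x y e -> Rabs (ev P x y e) <= nrm s P.
Proof.
  intros H; induction P as [|m P IH]; simpl; [rewrite Rabs_R0; lra|].
  eapply Rle_trans; [apply Rabs_triang|].
  pose proof (mev_bound s m x y e H); lra.
Qed.

Lemma pow_lip s x h i : Rabs x <= s -> Rabs (x + h) <= s ->
  s * Rabs ((x + h) ^ i - x ^ i) <= INR i * Rabs h * s ^ i.
Proof.
  intros Hx Hh; assert (Hs : 0 <= s) by (pose proof (Rabs_pos x); lra).
  induction i as [|i IH].
  - simpl; rewrite Rminus_diag, Rabs_R0; lra.
  - replace ((x + h) ^ S i - x ^ S i)
      with ((x + h) * ((x + h) ^ i - x ^ i) + h * x ^ i) by (simpl; ring).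
    pose proof (Rabs_triang ((x + h) * ((x + h) ^ i - x ^ i)) (h * x ^ i)) as T.
    rewrite !Rabs_mult in T.
    pose proof (pow_abs_le x s i Hx) as B.
    pose proof (Rabs_pos h); pose proof (Rabs_pos ((x + h) ^ i - x ^ i)).
    rewrite S_INR; simpl pow.
    assert (Rabs h * Rabs (x ^ i) <= Rabs h * s ^ i) by nra.
    assert (Rabs (x + h) * Rabs ((x + h) ^ i - x ^ i)
            <= s * Rabs ((x + h) ^ i - x ^ i)) by nra.
    replace ((INR i + 1) * Rabs h * (s * s ^ i))
      with (s * (INR i * Rabs h * s ^ i + Rabs h * s ^ i)) by ring.
    apply Rmult_le_compat_l; lra.
Qed.

(** The second-order remainders satisfy R(i+1) = (x + h) R(i) + h^2 i x^(i-1), and i^2 + i <=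
    (i+1)^2 closes the induction. The factor s^2 on the left avoids negative powers of s. *)
Lemma pow_quad s x h i : Rabs x <= s -> Rabs (x + h) <= s ->
  s * s * Rabs ((x + h) ^ i - x ^ i - h * (INR i * x ^ pred i))
  <= INR i * INR i * (h * h) * s ^ i.
Proof.
  intros Hx Hh; assert (Hs : 0 <= s) by (pose proof (Rabs_pos x); lra).
  induction i as [|i IH].
  - simpl; replace (1 - 1 - h * (0 * 1)) with 0 by ring; rewrite Rabs_R0; lra.
  - set (D := (x + h) ^ i - x ^ i - h * (INR i * x ^ pred i)) in *.
    assert (E : (x + h) ^ S i - x ^ S i - h * (INR (S i) * x ^ pred (S i))
            = (x + h) * D + h * h * (INR i * x ^ pred i)).
    { unfold D; destruct i as [|i]; [simpl; ring|].
      rewrite (S_INR (S i)); simpl pred; simpl pow; ring. }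
    rewrite E.
    pose proof (Rabs_triang ((x + h) * D) (h * h * (INR i * x ^ pred i))) as T.
    rewrite !Rabs_mult in T.
    rewrite (Rabs_pos_eq (INR i)) in T by apply pos_INR.
    replace (Rabs h * Rabs h) with (h * h) in T
      by (rewrite <- Rabs_mult; symmetry; apply Rabs_pos_eq; nra).
    assert (B : s * (INR i * Rabs (x ^ pred i)) <= INR i * s ^ i).
    { destruct i as [|i]; [simpl; lra|]; simpl pred.
      pose proof (pow_abs_le x s i Hx); pose proof (pos_INR (S i)).
      replace (INR (S i) * s ^ S i) with (s * (INR (S i) * s ^ i)) by (simpl pow; ring).
      apply Rmult_le_compat_l; [assumption|]; apply Rmult_le_compat_l; assumption. }
    pose proof (Rabs_pos D).
    assert (Rabs (x + h) * Rabs D <= s * Rabs D) by nra.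
    pose proof (pos_INR i).
    rewrite S_INR; simpl (s ^ S i).
    pose proof (pow_le s i Hs).
    apply Rle_trans with (s * (s * s * Rabs D) + h * h * s * (s * (INR i * Rabs (x ^ pred i)))).
    { replace (s * (s * s * Rabs D) + h * h * s * (s * (INR i * Rabs (x ^ pred i))))
        with (s * s * (s * Rabs D + h * h * (INR i * Rabs (x ^ pred i)))) by ring.
      apply Rmult_le_compat_l; [nra|lra]. }
    apply Rle_trans with (s * (INR i * INR i * (h * h) * s ^ i) + h * h * s * (INR i * s ^ i)).
    { apply Rplus_le_compat; apply Rmult_le_compat_l; auto; nra. }
    replace (s * (INR i * INR i * (h * h) * s ^ i) + h * h * s * (INR i * s ^ i))
      with ((INR i * INR i + INR i) * (h * h * (s * s ^ i))) by ring.
    replace ((INR i + 1) * (INR i + 1) * (h * h) * (s * s ^ i))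
      with ((INR i + 1) * (INR i + 1) * (h * h * (s * s ^ i))) by ring.
    apply Rmult_le_compat_r; [|nra].
    apply Rmult_le_pos; [nra|apply Rmult_le_pos; assumption].
Qed.

(** * Geometrically convergent series of polynomials *)

Definition mv (d : dir) (x y e h : R) : R * R * R :=
  match d with
  | dX => (x + h, y, e)
  | dY => (x, y + h, e)
  | dE => (x, y, e + h)
  end.

Definition ap (f : R -> R -> R -> R) (p : R * R * R) : R :=
  f (fst (fst p)) (snd (fst p)) (snd p).

Definition boxp (s : R) (p : R * R * R) : Prop :=
  box s (fst (fst p)) (snd (fst p)) (snd p).

(** The common shape of the monomial estimates below: u is the increment or remainder in the moving
    variable, v and w are the powers of the two frozen ones. *)
Lemma factor_bound A B c u v w U V W : 0 <= A -> 0 <= B -> 0 <= U ->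
  A * Rabs u <= B * U -> Rabs v <= V -> Rabs w <= W ->
  A * Rabs (c * u * v * w) <= B * (Rabs c * (U * V * W)).
Proof.
  intros HA HB HU Hu Hv Hw; rewrite !Rabs_mult.
  replace (A * (Rabs c * Rabs u * Rabs v * Rabs w))
    with (Rabs c * ((A * Rabs u) * Rabs v * Rabs w)) by ring.
  replace (B * (Rabs c * (U * V * W))) with (Rabs c * ((B * U) * V * W)) by ring.
  apply Rmult_le_compat_l; [apply Rabs_pos|].
  pose proof (Rabs_pos u); pose proof (Rabs_pos v).
  apply Rmult_le_compat; try apply Rabs_pos; try assumption.
  - apply Rmult_le_pos; [apply Rmult_le_pos|]; assumption.
  - apply Rmult_le_compat; try assumption; apply Rmult_le_pos; assumption.
Qed.

Lemma mwt_pow s m : s ^ mwt m = s ^ mx m * (s ^ 2) ^ my m * (s ^ 3) ^ me m.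
Proof. unfold mwt; rewrite !pow_add, !pow_mult; ring. Qed.

Lemma mev_lip d s m x y e h : 0 < s -> box s x y e -> boxp s (mv d x y e h) ->
  s ^ dwt d * Rabs (ap (mev m) (mv d x y e h) - mev m x y e)
  <= INR (mwt m) * Rabs h * (Rabs (mc m) * s ^ mwt m).
Proof.
  intros Hs (Hx & Hy & He) Hh.
  assert (Hs2 : 0 <= s ^ 2) by (apply pow_le; lra).
  assert (Hs3 : 0 <= s ^ 3) by (apply pow_le; lra).
  rewrite mwt_pow.
  assert (P : forall i, (i <= mwt m)%nat -> INR i * Rabs h <= INR (mwt m) * Rabs h)
    by (intros; apply Rmult_le_compat_r; [apply Rabs_pos|apply le_INR; assumption]).
  assert (Q : forall i, 0 <= INR i * Rabs h)
    by (intros; apply Rmult_le_pos; [apply pos_INR|apply Rabs_pos]).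
  assert (N : 0 <= Rabs (mc m) * (s ^ mx m * (s ^ 2) ^ my m * (s ^ 3) ^ me m)).
  { apply Rmult_le_pos; [apply Rabs_pos|].
    repeat apply Rmult_le_pos; apply pow_le; lra. }
  destruct d; destruct Hh as (Hx' & Hy' & He'); unfold ap, mev; simpl in Hx', Hy', He' |- *.
  - apply Rle_trans with (INR (mx m) * Rabs h *
      (Rabs (mc m) * (s ^ mx m * (s ^ 2) ^ my m * (s ^ 3) ^ me m))).
    + replace (mc m * (x + h) ^ mx m * y ^ my m * e ^ me m - mc m * x ^ mx m * y ^ my m * e ^ me m)
        with (mc m * ((x + h) ^ mx m - x ^ mx m) * y ^ my m * e ^ me m) by ring.
      apply factor_bound; auto using pow_abs_le; try lra; try (apply pow_le; lra).
      rewrite Rmult_1_r; apply pow_lip; assumption.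
    + apply Rmult_le_compat_r; [exact N|apply P; unfold mwt; lia].
  - apply Rle_trans with (INR (my m) * Rabs h *
      (Rabs (mc m) * ((s ^ 2) ^ my m * s ^ mx m * (s ^ 3) ^ me m))).
    + replace (mc m * x ^ mx m * (y + h) ^ my m * e ^ me m - mc m * x ^ mx m * y ^ my m * e ^ me m)
        with (mc m * ((y + h) ^ my m - y ^ my m) * x ^ mx m * e ^ me m) by ring.
      apply factor_bound; auto using pow_abs_le; try lra; try (apply pow_le; lra).
      apply pow_lip; assumption.
    + rewrite (Rmult_comm ((s ^ 2) ^ my m)).
      apply Rmult_le_compat_r; [exact N|apply P; unfold mwt; lia].
  - apply Rle_trans with (INR (me m) * Rabs h *
      (Rabs (mc m) * ((s ^ 3) ^ me m * s ^ mx m * (s ^ 2) ^ my m))).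
    + replace (mc m * x ^ mx m * y ^ my m * (e + h) ^ me m - mc m * x ^ mx m * y ^ my m * e ^ me m)
        with (mc m * ((e + h) ^ me m - e ^ me m) * x ^ mx m * y ^ my m) by ring.
      apply factor_bound; auto using pow_abs_le; try lra; try (apply pow_le; lra).
      apply pow_lip; assumption.
    + replace ((s ^ 3) ^ me m * s ^ mx m * (s ^ 2) ^ my m)
        with (s ^ mx m * (s ^ 2) ^ my m * (s ^ 3) ^ me m) by ring.
      apply Rmult_le_compat_r; [exact N|apply P; unfold mwt; lia].
Qed.

Lemma mev_quad d s m x y e h : 0 < s -> box s x y e -> boxp s (mv d x y e h) ->
  s ^ dwt d * s ^ dwt d *
    Rabs (ap (mev m) (mv d x y e h) - mev m x y e - h * mev (lower d m) x y e)
  <= INR (mwt m) * INR (mwt m) * (h * h) * (Rabs (mc m) * s ^ mwt m).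
Proof.
  intros Hs (Hx & Hy & He) Hh.
  assert (Hs2 : 0 <= s ^ 2) by (apply pow_le; lra).
  assert (Hs3 : 0 <= s ^ 3) by (apply pow_le; lra).
  rewrite mwt_pow.
  assert (HH : 0 <= h * h) by nra.
  assert (P : forall i, (i <= mwt m)%nat ->
    INR i * INR i * (h * h) <= INR (mwt m) * INR (mwt m) * (h * h)).
  { intros i Hi; apply Rmult_le_compat_r; [assumption|].
    apply le_INR in Hi; pose proof (pos_INR i); nra. }
  assert (Q : forall i, 0 <= INR i * INR i * (h * h)).
  { intros i; apply Rmult_le_pos; [|assumption]; pose proof (pos_INR i); nra. }
  assert (N : 0 <= Rabs (mc m) * (s ^ mx m * (s ^ 2) ^ my m * (s ^ 3) ^ me m)).
  { apply Rmult_le_pos; [apply Rabs_pos|].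
    repeat apply Rmult_le_pos; apply pow_le; lra. }
  destruct d; destruct Hh as (Hx' & Hy' & He'); unfold ap, mev;
    cbn [mv fst snd dwt lower mc mx my me] in Hx', Hy', He' |- *.
  - apply Rle_trans with (INR (mx m) * INR (mx m) * (h * h) *
      (Rabs (mc m) * (s ^ mx m * (s ^ 2) ^ my m * (s ^ 3) ^ me m))).
    + replace (_ - _ - _)
        with (mc m * ((x + h) ^ mx m - x ^ mx m - h * (INR (mx m) * x ^ pred (mx m)))
              * y ^ my m * e ^ me m) by ring.
      apply factor_bound; auto using pow_abs_le; try nra; try (apply pow_le; lra).
      rewrite !pow_1; apply pow_quad; assumption.
    + apply Rmult_le_compat_r; [exact N|apply P; unfold mwt; lia].
  - apply Rle_trans with (INR (my m) * INR (my m) * (h * h) *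
      (Rabs (mc m) * ((s ^ 2) ^ my m * s ^ mx m * (s ^ 3) ^ me m))).
    + replace (_ - _ - _)
        with (mc m * ((y + h) ^ my m - y ^ my m - h * (INR (my m) * y ^ pred (my m)))
              * x ^ mx m * e ^ me m) by ring.
      apply factor_bound; auto using pow_abs_le; try nra; try (apply pow_le; lra).
      apply pow_quad; assumption.
    + rewrite (Rmult_comm ((s ^ 2) ^ my m)).
      apply Rmult_le_compat_r; [exact N|apply P; unfold mwt; lia].
  - apply Rle_trans with (INR (me m) * INR (me m) * (h * h) *
      (Rabs (mc m) * ((s ^ 3) ^ me m * s ^ mx m * (s ^ 2) ^ my m))).
    + replace (_ - _ - _)
        with (mc m * ((e + h) ^ me m - e ^ me m - h * (INR (me m) * e ^ pred (me m)))
              * x ^ mx m * y ^ my m) by ring.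
      apply factor_bound; auto using pow_abs_le; try nra; try (apply pow_le; lra).
      apply pow_quad; assumption.
    + replace ((s ^ 3) ^ me m * s ^ mx m * (s ^ 2) ^ my m)
        with (s ^ mx m * (s ^ 2) ^ my m * (s ^ 3) ^ me m) by ring.
      apply Rmult_le_compat_r; [exact N|apply P; unfold mwt; lia].
Qed.

Lemma ev_lip d s D P x y e h : 0 < s -> wdeg D P ->
  box s x y e -> boxp s (mv d x y e h) ->
  s ^ dwt d * Rabs (ap (ev P) (mv d x y e h) - ev P x y e)
  <= INR D * Rabs h * nrm s P.
Proof.
  intros Hs HD H H'; induction HD as [|m P Hm HD IH]; unfold ap in *; cbn [ev nrm].
  - rewrite Rminus_diag, Rabs_R0; lra.
  - pose proof (mev_lip d s m x y e h Hs H H') as T; unfold ap in T.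
    set (u := mev m _ _ _) in *; set (v := mev m x y e) in *.
    set (a := ev P _ _ _) in *; set (b := ev P x y e) in *.
    replace (u + a - (v + b)) with ((u - v) + (a - b)) by ring.
    pose proof (Rabs_triang (u - v) (a - b)).
    assert (0 <= s ^ dwt d) by (apply pow_le; lra).
    assert (INR (mwt m) * Rabs h * (Rabs (mc m) * s ^ mwt m)
            <= INR D * Rabs h * (Rabs (mc m) * s ^ mwt m)).
    { apply Rmult_le_compat_r.
      - apply Rmult_le_pos; [apply Rabs_pos|apply pow_le; lra].
      - apply Rmult_le_compat_r; [apply Rabs_pos|apply le_INR; assumption]. }
    nra.
Qed.

Lemma ev_quad d s D P x y e h : 0 < s -> wdeg D P ->
  box s x y e -> boxp s (mv d x y e h) ->
  s ^ dwt d * s ^ dwt d *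
    Rabs (ap (ev P) (mv d x y e h) - ev P x y e - h * ev (der d P) x y e)
  <= INR D * INR D * (h * h) * nrm s P.
Proof.
  intros Hs HD H H'; induction HD as [|m P Hm HD IH]; unfold ap in *; cbn [der map ev nrm].
  - replace (0 - 0 - h * 0) with 0 by ring; rewrite Rabs_R0; lra.
  - pose proof (mev_quad d s m x y e h Hs H H') as T; unfold ap in T.
    change (map (lower d) P) with (der d P) in *.
    set (u := mev m _ _ _) in *; set (v := mev m x y e) in *; set (w := mev (lower d m) x y e) in *.
    set (a := ev P _ _ _) in *; set (b := ev P x y e) in *; set (c := ev (der d P) x y e) in *.
    replace (u + a - (v + b) - h * (w + c)) with ((u - v - h * w) + (a - b - h * c)) by ring.
    pose proof (Rabs_triang (u - v - h * w) (a - b - h * c)).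
    assert (0 <= s ^ dwt d) by (apply pow_le; lra).
    assert (INR (mwt m) * INR (mwt m) * (h * h) * (Rabs (mc m) * s ^ mwt m)
            <= INR D * INR D * (h * h) * (Rabs (mc m) * s ^ mwt m)).
    { apply Rmult_le_compat_r.
      - apply Rmult_le_pos; [apply Rabs_pos|apply pow_le; lra].
      - apply Rmult_le_compat_r; [nra|]. apply le_INR in Hm; pose proof (pos_INR (mwt m)); nra. }
    rewrite Rmult_plus_distr_l.
    apply Rle_trans with (s ^ dwt d * s ^ dwt d * Rabs (u - v - h * w) +
       s ^ dwt d * s ^ dwt d * Rabs (a - b - h * c)); [|lra].
    rewrite <- Rmult_plus_distr_l; apply Rmult_le_compat_l; [nra|assumption].
Qed.

(** Differentiation costs a factor of the weighted degree. Linear growth of that degree keeps the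
    cost polynomial in n, so geometric decay survives at a slightly larger ratio. *)
Definition good (s : R) (Q : nat -> list mono) : Prop :=
  exists C q D, 0 <= q < 1 /\
    forall n, nrm s (Q n) <= C * q ^ n /\ wdeg (D * S n) (Q n).

Definition ser (Q : nat -> list mono) (x y e : R) : R :=
  Series (fun n => ev (Q n) x y e).

Lemma linear_geometric q : 0 <= q < 1 ->
  exists C q', 0 <= C /\ 0 <= q' < 1 /\ forall n, INR (S n) * q ^ n <= C * q' ^ n.
Proof.
  (* The new ratio is the midpoint of q and 1. Its excess over q is (1 - q)/2, the reciprocal of the
     constant, and the induction step is q + (1 - q)/2 = q'. *)
  intros Hq; exists (/ ((1 - q) / 2)), ((1 + q) / 2); split; [|split; [lra|]].
  - left; apply Rinv_0_lt_compat; lra.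
  - intros n; apply Rmult_le_reg_l with ((1 - q) / 2); [lra|].
    rewrite <- (Rmult_assoc _ (/ _)), Rinv_r, Rmult_1_l by lra.
    induction n as [|n IH]; [simpl; lra|].
    rewrite S_INR; simpl pow.
    assert (q ^ n <= ((1 + q) / 2) ^ n) by (apply pow_incr; lra).
    pose proof (pow_le q n (proj1 Hq)).
    assert ((1 - q) / 2 * (q * q ^ n) <= (1 - q) / 2 * ((1 + q) / 2) ^ n).
    { apply Rmult_le_compat_l; nra. }
    nra.
Qed.

Lemma series_geometric_bound (a : nat -> R) C q : 0 <= q < 1 ->
  (forall n, Rabs (a n) <= C * q ^ n) ->
  ex_series a /\ Rabs (Series a) <= C * / (1 - q).
Proof.
  intros Hq H.
  assert (Eq : Rabs q < 1) by (rewrite Rabs_pos_eq; lra).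
  assert (G : ex_series (fun n => C * q ^ n)).
  { apply (ex_series_scal_l C (fun n => q ^ n)); exists (/ (1 - q)).
    apply is_series_geom; exact Eq. }
  assert (A : ex_series (fun n => Rabs (a n))).
  { apply (ex_series_le (K := R_AbsRing) (V := R_CompleteNormedModule) _ (fun n => C * q ^ n)).
    - intros n; unfold norm; simpl; unfold abs; simpl; rewrite Rabs_Rabsolu; apply H.
    - exact G. }
  split; [apply ex_series_Rabs; exact A|].
  eapply Rle_trans; [apply Series_Rabs; exact A|].
  eapply Rle_trans; [apply (Series_le _ (fun n => C * q ^ n)); [|exact G]|].
  - intros n; split; [apply Rabs_pos|apply H].
  - rewrite Series_scal_l, Series_geom by exact Eq; lra.
Qed.

Lemma good_const_pos s Q C q : 0 <= s -> (forall n, nrm s (Q n) <= C * q ^ n) -> 0 <= C.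
Proof.
  intros Hs H; pose proof (H O) as H0; pose proof (nrm_pos s (Q O) Hs); simpl in H0; lra.
Qed.

(** The second-order remainder costs the square of the degree, so [linear_geometric] is used twice;
    a single C and q then serve all three estimates. *)
Lemma good_weighted s Q : 0 < s -> good s Q ->
  exists C q D, 0 <= q < 1 /\ forall n, wdeg (D * S n) (Q n) /\
    nrm s (Q n) <= C * q ^ n /\
    INR (D * S n) * nrm s (Q n) <= C * q ^ n /\
    INR (D * S n) * INR (D * S n) * nrm s (Q n) <= C * q ^ n.
Proof.
  intros Hs (C & q & D & Hq & H).
  assert (HC : 0 <= C) by (apply (good_const_pos s Q C q); [lra|apply H]).
  destruct (linear_geometric q Hq) as (C1 & q1 & HC1 & Hq1 & H1).
  destruct (linear_geometric q1 Hq1) as (C2 & q2 & HC2 & Hq2 & H2).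
  exists ((1 + INR D * INR D) * C * C1 * C2), q2, D; split; [exact Hq2|].
  intros n; destruct (H n) as [Hn Hw]; split; [exact Hw|].
  specialize (H1 n); specialize (H2 n).
  rewrite mult_INR.
  set (k := INR (S n)) in *.
  assert (Hk : 1 <= k) by (unfold k; rewrite S_INR; pose proof (pos_INR n); lra).
  pose proof (nrm_pos s (Q n) (Rlt_le _ _ Hs)) as HN.
  set (N := nrm s (Q n)) in *.
  pose proof (pow_le q n (proj1 Hq)); pose proof (pow_le q1 n (proj1 Hq1)).
  pose proof (pos_INR D) as HD; set (d := INR D) in *.
  assert (M : k * k * N <= C * C1 * C2 * q2 ^ n).
  { apply Rle_trans with (k * k * (C * q ^ n)); [apply Rmult_le_compat_l; nra|].
    replace (k * k * (C * q ^ n)) with (C * k * (k * q ^ n)) by ring.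
    apply Rle_trans with (C * k * (C1 * q1 ^ n)); [apply Rmult_le_compat_l; nra|].
    replace (C * k * (C1 * q1 ^ n)) with (C * C1 * (k * q1 ^ n)) by ring.
    replace (C * C1 * C2 * q2 ^ n) with (C * C1 * (C2 * q2 ^ n)) by ring.
    apply Rmult_le_compat_l; nra. }
  assert (T : forall t, 0 <= t <= 1 + d * d ->
     t * (k * k * N) <= (1 + d * d) * C * C1 * C2 * q2 ^ n).
  { intros t Ht.
    replace ((1 + d * d) * C * C1 * C2 * q2 ^ n)
      with ((1 + d * d) * (C * C1 * C2 * q2 ^ n)) by ring.
    apply Rmult_le_compat; try lra; apply Rmult_le_pos; nra. }
  assert (N <= k * N) by nra.
  assert (k * N <= k * k * N) by nra.
  split; [|split].
  - apply Rle_trans with (1 * (k * k * N)); [lra|apply T; nra].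
  - apply Rle_trans with (d * (k * k * N)); [nra|apply T; nra].
  - replace (d * k * (d * k) * N) with (d * d * (k * k * N)) by ring; apply T; nra.
Qed.

Lemma good_der d s Q : 0 < s -> good s Q -> good s (fun n => der d (Q n)).
Proof.
  intros Hs HQ; destruct (good_weighted s Q Hs HQ) as (C & q & D & Hq & H).
  pose proof (pow_lt s (dwt d) Hs) as Hp.
  exists (C / s ^ dwt d), q, D; split; [exact Hq|]; intros n.
  destruct (H n) as (Hw & _ & H1 & _); split; [|apply wdeg_der; exact Hw].
  apply Rmult_le_reg_l with (s ^ dwt d); [exact Hp|].
  replace (s ^ dwt d * (C / s ^ dwt d * q ^ n)) with (C * q ^ n) by (field; lra).
  eapply Rle_trans; [apply nrm_der; eassumption|exact H1].
Qed.

Lemma ser_ex s Q x y e : 0 < s -> good s Q -> box s x y e ->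
  ex_series (fun n => ev (Q n) x y e).
Proof.
  intros Hs (C & q & D & Hq & H) B.
  apply (series_geometric_bound _ C q Hq).
  intros n; eapply Rle_trans; [apply ev_bound; exact B|apply H].
Qed.

(** Summing the remainders termwise yields differentiability of the sum together with its
    derivative. The bound only asks that both points lie in the closed box, so it also serves the
    one-sided eps-derivative. *)
Lemma ser_quad d s Q : 0 < s -> good s Q ->
  exists C, forall x y e h, box s x y e -> boxp s (mv d x y e h) ->
    Rabs (ap (ser Q) (mv d x y e h) - ser Q x y e
          - h * ser (fun n => der d (Q n)) x y e) <= C * (h * h).
Proof.
  intros Hs HQ; destruct (good_weighted s Q Hs HQ) as (C & q & D & Hq & H).
  pose proof (pow_lt s (dwt d) Hs) as Hp; set (p := s ^ dwt d) in *.
  exists (C / (p * p) * / (1 - q)); intros x y e h B B'.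
  unfold ser, ap.
  pose proof (ser_ex s Q _ _ _ Hs HQ B) as E1.
  pose proof (ser_ex s Q _ _ _ Hs HQ B') as E2.
  pose proof (ser_ex s _ _ _ _ Hs (good_der d s Q Hs HQ) B) as E3.
  rewrite <- Series_minus by assumption.
  rewrite <- Series_scal_l.
  rewrite <- Series_minus.
  - replace (C / (p * p) * / (1 - q) * (h * h)) with (C / (p * p) * (h * h) * / (1 - q)) by ring.
    apply series_geometric_bound; [exact Hq|]; intros n.
    destruct (H n) as (Hw & _ & _ & H2).
    pose proof (ev_quad d s _ (Q n) x y e h Hs Hw B B') as T; fold p in T; unfold ap in T.
    apply Rmult_le_reg_l with (p * p); [nra|].
    eapply Rle_trans; [exact T|].
    replace (p * p * (C / (p * p) * (h * h) * q ^ n)) with ((h * h) * (C * q ^ n)) by (field; lra).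
    replace (INR (D * S n) * INR (D * S n) * (h * h) * nrm s (Q n))
      with ((h * h) * (INR (D * S n) * INR (D * S n) * nrm s (Q n))) by ring.
    apply Rmult_le_compat_l; [nra|exact H2].
  - apply (ex_series_minus (V := R_NormedModule)); assumption.
  - apply (ex_series_scal_l h (fun n => ev (der d (Q n)) x y e)); assumption.
Qed.

Lemma ser_lip d s Q : 0 < s -> good s Q ->
  exists C, 0 <= C /\ forall x y e h, box s x y e -> boxp s (mv d x y e h) ->
    Rabs (ap (ser Q) (mv d x y e h) - ser Q x y e) <= C * Rabs h.
Proof.
  intros Hs HQ; destruct (good_weighted s Q Hs HQ) as (C & q & D & Hq & H).
  pose proof (pow_lt s (dwt d) Hs) as Hp; set (p := s ^ dwt d) in *.
  assert (HC : 0 <= C) by (apply (good_const_pos s Q C q); [lra|apply H]).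
  exists (C / p * / (1 - q)); split.
  { apply Rmult_le_pos; [apply Rmult_le_pos; [exact HC|]|]; left; apply Rinv_0_lt_compat; lra. }
  intros x y e h B B'; unfold ser, ap.
  pose proof (ser_ex s Q _ _ _ Hs HQ B) as E1.
  pose proof (ser_ex s Q _ _ _ Hs HQ B') as E2.
  rewrite <- Series_minus by assumption.
  replace (C / p * / (1 - q) * Rabs h) with (C / p * Rabs h * / (1 - q)) by ring.
  apply series_geometric_bound; [exact Hq|]; intros n.
  destruct (H n) as (Hw & _ & H1 & _).
  pose proof (ev_lip d s _ (Q n) x y e h Hs Hw B B') as T; fold p in T; unfold ap in T.
  apply Rmult_le_reg_l with p; [exact Hp|].
  eapply Rle_trans; [exact T|].
  replace (p * (C / p * Rabs h * q ^ n)) with (Rabs h * (C * q ^ n)) by (field; lra).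
  replace (INR (D * S n) * Rabs h * nrm s (Q n))
    with (Rabs h * (INR (D * S n) * nrm s (Q n))) by ring.
  apply Rmult_le_compat_l; [apply Rabs_pos|exact H1].
Qed.

(** One coordinate is moved at a time; the box is a product, so the intermediate points stay inside
    it. *)
Lemma ser_lip3 s Q : 0 < s -> good s Q ->
  exists C, 0 <= C /\ forall x y e x' y' e', box s x y e -> box s x' y' e' ->
    Rabs (ser Q x y e - ser Q x' y' e')
    <= C * (Rabs (x - x') + Rabs (y - y') + Rabs (e - e')).
Proof.
  intros Hs HQ.
  destruct (ser_lip dX s Q Hs HQ) as (C1 & P1 & H1).
  destruct (ser_lip dY s Q Hs HQ) as (C2 & P2 & H2).
  destruct (ser_lip dE s Q Hs HQ) as (C3 & P3 & H3).
  exists (C1 + C2 + C3); split; [lra|].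
  intros x y e x' y' e' (Bx & By & Be) (Bx' & By' & Be').
  assert (T1 := H1 x' y' e' (x - x')); assert (T2 := H2 x y' e' (y - y'));
    assert (T3 := H3 x y e' (e - e')).
  unfold boxp, ap in *; simpl in T1, T2, T3.
  replace (x' + (x - x')) with x in T1 by ring.
  replace (y' + (y - y')) with y in T2 by ring.
  replace (e' + (e - e')) with e in T3 by ring.
  specialize (T1 ltac:(repeat split; assumption) ltac:(repeat split; assumption)).
  specialize (T2 ltac:(repeat split; assumption) ltac:(repeat split; assumption)).
  specialize (T3 ltac:(repeat split; assumption) ltac:(repeat split; assumption)).
  pose proof (Rabs_pos (x - x')); pose proof (Rabs_pos (y - y')); pose proof (Rabs_pos (e - e')).
  replace (ser Q x y e - ser Q x' y' e') with
    ((ser Q x y e - ser Q x y e')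
     + ((ser Q x y e' - ser Q x y' e') + (ser Q x y' e' - ser Q x' y' e'))) by ring.
  eapply Rle_trans; [apply Rabs_triang|].
  pose proof (Rabs_triang (ser Q x y e' - ser Q x y' e') (ser Q x y' e' - ser Q x' y' e')).
  nra.
Qed.

(** * Smoothness and Taylor coefficients of such series *)

Definition agree (W : R * R -> Prop) (e1 : R) (f g : R -> R -> R -> R) : Prop :=
  forall x y e, slab W e1 (x, y, e) -> f x y e = g x y e.

Definition pd (d : dir) : (R -> R -> R -> R) -> R -> R -> R -> R :=
  match d with dX => Dx | dY => Dy | dE => De end.

Definition has_D (d : dir) (f : R -> R -> R -> R) (x y e l : R) : Prop :=
  match d with
  | dX => is_derive (fun t => f t y e) x l
  | dY => is_derive (fun t => f x t e) y l
  | dE => filterlim (eps_quotient f x y e) (eps_steps e) (locally l)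
  end.

Lemma eps_steps_proper e : 0 <= e -> ProperFilter (eps_steps e).
Proof.
  intros He; split.
  - intros P [d Hd]; exists (d / 2).
    pose proof (cond_pos d) as Hp.
    apply Hd.
    + unfold ball; simpl; unfold AbsRing_ball, abs, minus, plus, opp; simpl.
      rewrite Rabs_pos_eq; lra.
    + lra.
    + lra.
  - unfold eps_steps; apply within_filter, within_filter, locally_filter.
Qed.

(** [De] is a total [lim], meaningful only for a Cauchy proper filter. Properness of [eps_steps e]
    comes from 0 <= e, which leaves all positive steps admissible. *)
Lemma De_unique f x y e l : 0 <= e ->
  filterlim (eps_quotient f x y e) (eps_steps e) (locally l) -> De f x y e = l.
Proof.
  intros He H; unfold De.
  pose proof (eps_steps_proper e He) as PF.
  pose proof (filtermap_proper_filter _ _ (eps_quotient f x y e) (eps_steps e) PF) as PF'.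
  set (F := filtermap (eps_quotient f x y e) (eps_steps e)) in *.
  assert (L : is_filter_lim F (lim F : R)).
  { intros P [eps HP].
    assert (HF : F (ball (lim F : R) eps)).
    { apply (complete_cauchy (T := R_CompleteSpace) F PF').
      intros d; exists l; apply H, locally_ball. }
    eapply filter_imp; [exact HP|exact HF]. }
  apply (is_filter_lim_unique (V := R_NormedModule) (F := F)); assumption.
Qed.

Lemma D_unique d f x y e l : 0 <= e -> has_D d f x y e l -> pd d f x y e = l.
Proof.
  destruct d; simpl; intros He H.
  - apply is_derive_unique; exact H.
  - apply is_derive_unique; exact H.
  - apply De_unique; assumption.
Qed.

Lemma quadratic_quotient u v l h C : h <> 0 ->
  Rabs (u - v - h * l) <= C * (h * h) -> Rabs ((u - v) / h - l) <= C * Rabs h.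
Proof.
  intros Hh H; pose proof (Rabs_pos_lt h Hh).
  apply Rmult_le_reg_l with (Rabs h); [assumption|].
  rewrite <- Rabs_mult.
  replace (h * ((u - v) / h - l)) with (u - v - h * l) by (field; exact Hh).
  replace (Rabs h * (C * Rabs h)) with (C * (Rabs h * Rabs h)) by ring.
  rewrite <- Rabs_mult, (Rabs_pos_eq (h * h)) by nra; exact H.
Qed.

Lemma small_factor C eps : 0 < eps -> exists d, 0 < d /\ forall h, Rabs h < d -> C * Rabs h < eps.
Proof.
  intros He; pose proof (Rabs_pos C) as HC; exists (eps / (Rabs C + 1)); split.
  - apply Rdiv_lt_0_compat; lra.
  - intros h Hh; pose proof (Rabs_pos h); pose proof (RRle_abs C).
    apply (Rmult_lt_compat_l (Rabs C + 1)) in Hh; [|lra].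
    replace ((Rabs C + 1) * (eps / (Rabs C + 1))) with eps in Hh by (field; lra).
    nra.
Qed.

Lemma is_derive_quadratic (f : R -> R) x l C d : 0 < d ->
  (forall h, Rabs h < d -> Rabs (f (x + h) - f x - h * l) <= C * (h * h)) ->
  is_derive f x l.
Proof.
  intros Hd H; apply is_derive_Reals; intros eps Heps.
  destruct (small_factor C eps Heps) as (d' & Hd' & S).
  assert (Hm : 0 < Rmin d d') by (apply Rmin_pos; assumption).
  exists (mkposreal _ Hm); intros h Hh Hh'; simpl in Hh'.
  eapply Rle_lt_trans.
  - apply quadratic_quotient with (C := C); [exact Hh|apply H].
    eapply Rlt_le_trans; [exact Hh'|apply Rmin_l].
  - apply S; eapply Rlt_le_trans; [exact Hh'|apply Rmin_r].
Qed.

Lemma eps_derivative_quadratic f x y e l C d : 0 < d ->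
  (forall h, Rabs h < d -> 0 <= e + h ->
     Rabs (f x y (e + h) - f x y e - h * l) <= C * (h * h)) ->
  filterlim (eps_quotient f x y e) (eps_steps e) (locally l).
Proof.
  intros Hd H P [eps HP].
  destruct (small_factor C eps (cond_pos eps)) as (d' & Hd' & S).
  assert (Hm : 0 < Rmin d d') by (apply Rmin_pos; assumption).
  exists (mkposreal _ Hm); intros h Hh Hn Hp.
  unfold ball in Hh; simpl in Hh; unfold AbsRing_ball, abs, minus, plus, opp in Hh; simpl in Hh.
  rewrite Ropp_0, Rplus_0_r in Hh.
  apply HP; unfold ball; simpl; unfold AbsRing_ball, abs, minus, plus, opp, eps_quotient; simpl.
  eapply Rle_lt_trans.
  - apply quadratic_quotient with (C := C); [exact Hn|apply H; [|exact Hp]].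
    eapply Rlt_le_trans; [exact Hh|apply Rmin_l].
  - apply S; eapply Rlt_le_trans; [exact Hh|apply Rmin_r].
Qed.

Definition open_box (s x y e : R) : Prop :=
  Rabs x < s /\ Rabs y < s ^ 2 /\ Rabs e < s ^ 3.

Lemma open_box_mv d s x y e : open_box s x y e ->
  exists t, 0 < t /\ forall h, Rabs h < t -> boxp s (mv d x y e h).
Proof.
  intros (Hx & Hy & He).
  assert (G : forall z c, Rabs z < c -> exists t, 0 < t /\
                forall h, Rabs h < t -> Rabs (z + h) <= c).
  { intros z c H; exists (c - Rabs z); split; [lra|]; intros h Hh.
    pose proof (Rabs_triang z h); lra. }
  destruct d.
  - destruct (G _ _ Hx) as (t & Ht & T); exists t; split; [exact Ht|].
    intros h Hh; specialize (T h Hh); unfold boxp, box; simpl mv; cbn [fst snd]; lra.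
  - destruct (G _ _ Hy) as (t & Ht & T); exists t; split; [exact Ht|].
    intros h Hh; specialize (T h Hh); unfold boxp, box; simpl mv; cbn [fst snd]; lra.
  - destruct (G _ _ He) as (t & Ht & T); exists t; split; [exact Ht|].
    intros h Hh; specialize (T h Hh); unfold boxp, box; simpl mv; cbn [fst snd]; lra.
Qed.

Lemma slab_mv d W e1 x y e : open W -> slab W e1 (x, y, e) ->
  exists t, 0 < t /\ forall h, Rabs h < t ->
    0 <= snd (mv d x y e h) -> slab W e1 (mv d x y e h).
Proof.
  intros HW [Hxy He]; simpl in Hxy, He.
  destruct d; simpl.
  - destruct (HW _ Hxy) as [t Ht]; exists t; split; [apply cond_pos|].
    intros h Hh _; split; simpl; [|exact He]; apply Ht; split; simpl.
    + unfold ball; simpl; unfold AbsRing_ball, abs, minus, plus, opp; simpl.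
      replace (x + h + - x) with h by ring; exact Hh.
    + apply ball_center.
  - destruct (HW _ Hxy) as [t Ht]; exists t; split; [apply cond_pos|].
    intros h Hh _; split; simpl; [|exact He]; apply Ht; split; simpl.
    + apply ball_center.
    + unfold ball; simpl; unfold AbsRing_ball, abs, minus, plus, opp; simpl.
      replace (y + h + - y) with h by ring; exact Hh.
  - exists (e1 - e); split; [lra|]; intros h Hh H0; split; simpl; [exact Hxy|].
    pose proof (RRle_abs h); lra.
Qed.

(** Derivatives are local inside the slab: openness of W gives two-sided room in x and y, while in
    eps the filter itself only looks at admissible steps. *)
Lemma has_D_agree d W e1 f g x y e l : open W -> agree W e1 f g ->
  slab W e1 (x, y, e) -> has_D d g x y e l -> has_D d f x y e l.
Proof.
  intros HW A Hs; destruct (slab_mv d W e1 x y e HW Hs) as (t & Ht & T).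
  pose proof (proj1 (proj2 Hs)) as He; simpl in He.
  destruct d; simpl in *; intros H.
  - eapply is_derive_ext_loc; [|exact H].
    exists (mkposreal t Ht); intros u Hu; symmetry; apply A.
    replace u with (x + (u - x)) by ring; apply T; [|exact He]; exact Hu.
  - eapply is_derive_ext_loc; [|exact H].
    exists (mkposreal t Ht); intros u Hu; symmetry; apply A.
    replace u with (y + (u - y)) by ring; apply T; [|exact He]; exact Hu.
  - eapply filterlim_ext_loc; [|exact H].
    exists (mkposreal t Ht); intros h Hh _ Hp; unfold eps_quotient.
    unfold ball in Hh; simpl in Hh; unfold AbsRing_ball, abs, minus, plus, opp in Hh; simpl in Hh.
    rewrite Ropp_0, Rplus_0_r in Hh.
    rewrite (A x y (e + h)) by (apply T; assumption).
    rewrite (A x y e) by assumption; reflexivity.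
Qed.

(** The radius may depend on the point. A polynomial on the whole plane needs this freedom; the Lie
    series will use one fixed radius. *)
Definition covered (W : R * R -> Prop) (e1 : R) (Q : nat -> list mono) : Prop :=
  forall x y e, slab W e1 (x, y, e) -> exists s, 0 < s /\ good s Q /\ open_box s x y e.

Lemma covered_der d W e1 Q : covered W e1 Q -> covered W e1 (fun n => der d (Q n)).
Proof.
  intros H x y e Hs; destruct (H x y e Hs) as (s & H1 & H2 & H3).
  exists s; split; [exact H1|split; [apply good_der; assumption|exact H3]].
Qed.

Lemma open_box_box s x y e : open_box s x y e -> box s x y e.
Proof. intros (?&?&?); repeat split; lra. Qed.

Lemma ser_has_D d s Q x y e : 0 < s -> good s Q -> open_box s x y e ->
  has_D d (ser Q) x y e (ser (fun n => der d (Q n)) x y e).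
Proof.
  intros Hs HQ B; destruct (ser_quad d s Q Hs HQ) as [C HC].
  destruct (open_box_mv d s x y e B) as (t & Ht & T).
  apply open_box_box in B.
  destruct d; simpl.
  - apply is_derive_quadratic with C t; [exact Ht|]; intros h Hh.
    apply (HC x y e h B (T h Hh)).
  - apply is_derive_quadratic with C t; [exact Ht|]; intros h Hh.
    apply (HC x y e h B (T h Hh)).
  - apply eps_derivative_quadratic with C t; [exact Ht|]; intros h Hh _.
    apply (HC x y e h B (T h Hh)).
Qed.

Lemma agree_D d W e1 f Q : open W -> covered W e1 Q -> agree W e1 f (ser Q) ->
  agree W e1 (pd d f) (ser (fun n => der d (Q n))).
Proof.
  intros HW HQ A x y e Hs; destruct (HQ x y e Hs) as (s & H1 & H2 & H3).
  apply D_unique; [apply (proj1 (proj2 Hs))|].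
  apply (has_D_agree d W e1 f (ser Q)); auto. apply ser_has_D with s; assumption.
Qed.

Lemma Rabs_le_shift a b : Rabs b <= Rabs a + Rabs (b - a).
Proof.
  pose proof (Rabs_triang a (b - a)) as T.
  replace (a + (b - a)) with b in T by ring; exact T.
Qed.

Lemma continuous_on_slab_ser W e1 f Q : covered W e1 Q -> agree W e1 f (ser Q) ->
  continuous_on_slab W e1 f.
Proof.
  intros HQ A x y e Hs P [eps HP].
  destruct (HQ x y e Hs) as (s & H1 & H2 & B).
  destruct (ser_lip3 s Q H1 H2) as (C & HC & L).
  assert (Hd : 0 < eps / (3 * (C + 1)) ).
  { apply Rdiv_lt_0_compat; [apply cond_pos|lra]. }
  destruct B as (Bx & By & Be).
  set (d0 := Rmin (s - Rabs x) (Rmin (s ^ 2 - Rabs y) (s ^ 3 - Rabs e))).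
  assert (Hd0 : 0 < d0) by (repeat apply Rmin_pos; lra).
  assert (Hm : 0 < Rmin (eps / (3 * (C + 1))) d0) by (apply Rmin_pos; assumption).
  exists (mkposreal _ Hm); intros [[x' y'] e'] [[Hx Hy] He] Hs'.
  simpl in Hx, Hy, He |- *.
  unfold ball in Hx, Hy, He; simpl in Hx, Hy, He.
  unfold AbsRing_ball, abs, minus, plus, opp in Hx, Hy, He; simpl in Hx, Hy, He.
  change (x' + - x) with (x' - x) in Hx; change (y' + - y) with (y' - y) in Hy;
    change (e' + - e) with (e' - e) in He.
  set (dl := eps / (3 * (C + 1))) in *.
  assert (M1 := Rmin_l dl d0); assert (M2 := Rmin_r dl d0).
  assert (N1 := Rmin_l (s - Rabs x) (Rmin (s ^ 2 - Rabs y) (s ^ 3 - Rabs e))).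
  assert (N2 := Rmin_r (s - Rabs x) (Rmin (s ^ 2 - Rabs y) (s ^ 3 - Rabs e))).
  assert (N3 := Rmin_l (s ^ 2 - Rabs y) (s ^ 3 - Rabs e)).
  assert (N4 := Rmin_r (s ^ 2 - Rabs y) (s ^ 3 - Rabs e)).
  fold d0 in N1, N2.
  apply HP; unfold ball; simpl; unfold AbsRing_ball, abs, minus, plus, opp; simpl.
  rewrite (A x' y' e') by exact Hs'; rewrite (A x y e) by exact Hs.
  eapply Rle_lt_trans.
  - apply (L x' y' e' x y e).
    + assert (Tx := Rabs_le_shift x x'); assert (Ty := Rabs_le_shift y y');
        assert (Te := Rabs_le_shift e e').
      split; [lra|split; lra].
    + repeat split; lra.
  - apply Rle_lt_trans with (C * (3 * dl)).
    + apply Rmult_le_compat_l; [exact HC|]; lra.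
    + replace (pos eps) with ((C + 1) * (3 * dl)) by (unfold dl; field; lra).
      nra.
Qed.

(** The class of functions agreeing with a covered series on the slab is closed under all three
    derivatives, which drives the induction. Agreement, not equality, is used because [Dx], [Dy] and
    [De] take arbitrary values off the slab. *)
Lemma smooth_ser k : forall W e1 f Q, open W -> covered W e1 Q -> agree W e1 f (ser Q) ->
  smooth k W e1 f.
Proof.
  induction k as [|k IH]; intros W e1 f Q HW HQ A; simpl; split;
    try (apply (continuous_on_slab_ser W e1 f Q); assumption); [exact I|].
  split; [|repeat split].
  - intros x y e Hs; destruct (HQ x y e Hs) as (s & H1 & H2 & H3).
    assert (G : forall d, has_D d f x y e (ser (fun n => der d (Q n)) x y e)).
    { intros d; apply (has_D_agree d W e1 f (ser Q)); auto; apply ser_has_D with s; assumption. }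
    repeat split; eexists; [apply (G dX)|apply (G dY)|apply (G dE)].
  - apply (IH W e1 (pd dX f) (fun n => der dX (Q n))); auto using covered_der, agree_D.
  - apply (IH W e1 (pd dY f) (fun n => der dY (Q n))); auto using covered_der, agree_D.
  - apply (IH W e1 (pd dE f) (fun n => der dE (Q n))); auto using covered_der, agree_D.
Qed.

Lemma agree_iter d i W e1 f Q : open W -> covered W e1 Q -> agree W e1 f (ser Q) ->
  covered W e1 (fun n => Nat.iter i (der d) (Q n)) /\
  agree W e1 (Nat.iter i (pd d) f) (ser (fun n => Nat.iter i (der d) (Q n))).
Proof.
  intros HW HQ A; induction i as [|i [IH1 IH2]]; simpl; [split; assumption|].
  split; [apply (covered_der d W e1 (fun n => Nat.iter i (der d) (Q n))); exact IH1|].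
  apply (agree_D d W e1 _ (fun n => Nat.iter i (der d) (Q n))); assumption.
Qed.

Definition der3 (i j k : nat) (P : list mono) : list mono :=
  Nat.iter i (der dX) (Nat.iter j (der dY) (Nat.iter k (der dE) P)).

Lemma partial0_ser i j k W e1 f Q : open W -> W (0, 0) -> 0 < e1 ->
  covered W e1 Q -> agree W e1 f (ser Q) ->
  partial0 i j k f = Series (fun n => ev (der3 i j k (Q n)) 0 0 0).
Proof.
  intros HW H0 He HQ A.
  destruct (agree_iter dE k W e1 f Q HW HQ A) as [C1 A1].
  destruct (agree_iter dY j W e1 _ _ HW C1 A1) as [C2 A2].
  destruct (agree_iter dX i W e1 _ _ HW C2 A2) as [C3 A3].
  apply A3; split; simpl; [exact H0|lra].
Qed.

(** A polynomial viewed as a one-term series, so that smoothness and derivatives of polynomials are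
    special cases of the results on series. *)
Definition single (P : list mono) (n : nat) : list mono :=
  match n with O => P | S _ => nil end.

Lemma good_single s P : 0 < s -> good s (single P).
Proof.
  intros Hs; destruct (wdeg_ex P) as [D0 HD]; exists (nrm s P), 0, D0; split; [lra|].
  intros [|n]; simpl; split; try lra.
  - rewrite Nat.mul_1_r; exact HD.
  - constructor.
Qed.

Lemma Series_head (a : nat -> R) : (forall n, a (S n) = 0) -> Series a = a O.
Proof.
  intros H; apply is_series_unique.
  apply (is_lim_seq_ext (fun _ => a O) (sum_n a) (a O)); [|apply is_lim_seq_const].
  intros n; induction n as [|n IH]; [rewrite sum_O; reflexivity|].
  rewrite sum_Sn, <- IH, H; unfold plus; simpl; ring.
Qed.

Lemma ser_single P : ser (single P) = ev P.
Proof.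
  do 3 (apply functional_extensionality; intro); unfold ser.
  rewrite Series_head; [reflexivity|intros n; reflexivity].
Qed.

Lemma box_exists x y e : exists s, 0 < s /\ open_box s x y e.
Proof.
  (* A radius of at least 1 satisfies s <= s^2 <= s^3, so a bound by s suffices in all three
     directions. *)
  exists (1 + Rabs x + Rabs y + Rabs e).
  pose proof (Rabs_pos x); pose proof (Rabs_pos y); pose proof (Rabs_pos e).
  split; [lra|].
  set (s := 1 + Rabs x + Rabs y + Rabs e).
  assert (s <= s ^ 2) by (unfold s; simpl; nra).
  assert (s ^ 2 <= s ^ 3) by (unfold s in *; simpl in *; nra).
  unfold open_box; repeat split; unfold s in *; lra.
Qed.

Lemma covered_single W e1 P : covered W e1 (single P).
Proof.
  intros x y e _; destruct (box_exists x y e) as (s & Hs & B).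
  exists s; auto using good_single.
Qed.

Lemma smooth_ev k W e1 P : open W -> smooth k W e1 (ev P).
Proof.
  intros HW; apply smooth_ser with (single P); auto using covered_single.
  intros x y e _; rewrite ser_single; reflexivity.
Qed.

Lemma open_plane : open plane.
Proof. intros p _; apply filter_forall; intros; exact I. Qed.

Lemma iter_der_nil d i : Nat.iter i (der d) nil = nil.
Proof. induction i as [|i IH]; simpl; [|rewrite IH]; reflexivity. Qed.

Lemma partial0_ev i j k P : partial0 i j k (ev P) = ev (der3 i j k P) 0 0 0.
Proof.
  rewrite (partial0_ser i j k plane 1 _ (single P) open_plane I Rlt_0_1).
  - apply Series_head; intros n; simpl.
    unfold der3; rewrite !iter_der_nil; reflexivity.
  - apply covered_single.
  - intros x y e _; rewrite ser_single; reflexivity.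
Qed.

Lemma ev_has_D d P x y e : has_D d (ev P) x y e (ev (der d P) x y e).
Proof.
  destruct (box_exists x y e) as (s & Hs & B).
  pose proof (ser_has_D d s (single P) x y e Hs (good_single s P Hs) B) as H.
  replace (ser (fun n => der d (single P n)) x y e) with (ev (der d P) x y e) in H.
  - rewrite ser_single in H; exact H.
  - symmetry; unfold ser; apply Series_head; reflexivity.
Qed.

Lemma Dx_ev P : Dx (ev P) = ev (der dX P).
Proof.
  do 3 (apply functional_extensionality; intro).
  apply is_derive_unique, (ev_has_D dX).
Qed.

Lemma Dy_ev P : Dy (ev P) = ev (der dY P).
Proof.
  do 3 (apply functional_extensionality; intro).
  apply is_derive_unique, (ev_has_D dY).
Qed.

(** * Jets *)

(** The falling factorial a(a-1)...(a-i+1); for a < i it contains the factor [INR (a - a)] and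
    vanishes. *)
Fixpoint falling (a i : nat) : R :=
  match i with O => 1 | S i' => falling a i' * INR (a - i') end.

Lemma falling_zero a i : (a < i)%nat -> falling a i = 0.
Proof.
  induction i as [|i IH]; intros H; [lia|]; simpl.
  destruct (Nat.eq_dec a i) as [->|Hne].
  - rewrite Nat.sub_diag; simpl; ring.
  - rewrite IH by lia; ring.
Qed.

Lemma falling_SS a i : falling (S a) (S i) = INR (S a) * falling a i.
Proof.
  induction i as [|i IH]; [simpl; ring|].
  change (falling (S a) (S (S i))) with (falling (S a) (S i) * INR (S a - S i)).
  rewrite IH; simpl; ring.
Qed.

Lemma falling_diag i : falling i i = INR (fact i).
Proof.
  induction i as [|i IH]; [reflexivity|].
  rewrite falling_SS, IH; change (fact (S i)) with (S i * fact i)%nat.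
  rewrite mult_INR; reflexivity.
Qed.

Lemma falling_at_0 a i : falling a i * 0 ^ (a - i) = if (a =? i)%nat then INR (fact i) else 0.
Proof.
  destruct (Nat.eqb_spec a i) as [->|Hne].
  - rewrite Nat.sub_diag, falling_diag; simpl; ring.
  - destruct (Nat.lt_ge_cases a i) as [H|H].
    + rewrite falling_zero by assumption; ring.
    + rewrite pow_i by lia; ring.
Qed.

Lemma iter_lower_X i m :
  Nat.iter i (lower dX) m = Mono (mc m * falling (mx m) i) (mx m - i) (my m) (me m).
Proof.
  induction i as [|i IH]; simpl Nat.iter.
  - destruct m; simpl; rewrite Nat.sub_0_r; f_equal; ring.
  - rewrite IH; simpl; f_equal; [ring|lia].
Qed.

Lemma iter_lower_Y i m :
  Nat.iter i (lower dY) m = Mono (mc m * falling (my m) i) (mx m) (my m - i) (me m).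
Proof.
  induction i as [|i IH]; simpl Nat.iter.
  - destruct m; simpl; rewrite Nat.sub_0_r; f_equal; ring.
  - rewrite IH; simpl; f_equal; [ring|lia].
Qed.

Lemma iter_lower_E i m :
  Nat.iter i (lower dE) m = Mono (mc m * falling (me m) i) (mx m) (my m) (me m - i).
Proof.
  induction i as [|i IH]; simpl Nat.iter.
  - destruct m; simpl; rewrite Nat.sub_0_r; f_equal; ring.
  - rewrite IH; simpl; f_equal; [ring|lia].
Qed.

Lemma iter_der_cons d i m P :
  Nat.iter i (der d) (m :: P) = Nat.iter i (lower d) m :: Nat.iter i (der d) P.
Proof. induction i as [|i IH]; simpl; [|rewrite IH]; reflexivity. Qed.

Definition exps (i j k : nat) (m : mono) : bool :=
  ((mx m =? i) && (my m =? j) && (me m =? k))%nat%bool.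

Fixpoint coef (i j k : nat) (P : list mono) : R :=
  match P with
  | nil => 0
  | m :: P' => (if exps i j k m then mc m else 0) + coef i j k P'
  end.

Definition fact3 (i j k : nat) : R := INR (fact i) * INR (fact j) * INR (fact k).

Lemma fact3_neq_0 i j k : fact3 i j k <> 0.
Proof.
  unfold fact3; repeat apply Rmult_integral_contrapositive_currified; apply INR_fact_neq_0.
Qed.

Lemma partial0_coef i j k P : partial0 i j k (ev P) = fact3 i j k * coef i j k P.
Proof.
  rewrite partial0_ev; unfold der3.
  induction P as [|m P IH]; [rewrite !iter_der_nil; simpl; ring|].
  rewrite !iter_der_cons; simpl; rewrite IH, Rmult_plus_distr_l; f_equal.
  rewrite iter_lower_E, iter_lower_Y, iter_lower_X; unfold mev; simpl.
  replace (mc m * falling (me m) k * falling (my m) j * falling (mx m) i *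
     0 ^ (mx m - i) * 0 ^ (my m - j) * 0 ^ (me m - k))
   with (mc m * (falling (mx m) i * 0 ^ (mx m - i)) * (falling (my m) j * 0 ^ (my m - j))
     * (falling (me m) k * 0 ^ (me m - k))) by ring.
  rewrite !falling_at_0; unfold exps, fact3.
  destruct (mx m =? i)%nat, (my m =? j)%nat, (me m =? k)%nat; simpl; ring.
Qed.

Lemma coef_app i j k P Q : coef i j k (P ++ Q) = coef i j k P + coef i j k Q.
Proof. induction P as [|m P IH]; simpl; [ring|rewrite IH; ring]. Qed.

Lemma coef_wt i j k n P : wt n P -> (i + 2 * j + 3 * k < n)%nat -> coef i j k P = 0.
Proof.
  intros HP Hn; induction HP as [|m P Hm HP IH]; simpl; [reflexivity|].
  rewrite IH; unfold exps, mwt in *.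
  destruct (Nat.eqb_spec (mx m) i), (Nat.eqb_spec (my m) j), (Nat.eqb_spec (me m) k);
    simpl; try ring; lia.
Qed.

Lemma sum_n_pick (f : nat -> R) i0 n : (forall i, i <> i0 -> f i = 0) ->
  sum_n f n = if (i0 <=? n)%nat then f i0 else 0.
Proof.
  intros H; induction n as [|n IH].
  - rewrite sum_O; destruct i0; simpl; [reflexivity|apply H; lia].
  - rewrite sum_Sn, IH; unfold plus; simpl plus.
    destruct (Nat.leb_spec i0 n), (Nat.leb_spec i0 (S n)); try lia.
    + rewrite (H (S n)) by lia; simpl; ring.
    + replace i0 with (S n) by lia; simpl; ring.
    + rewrite (H (S n)) by lia; simpl; ring.
Qed.

Lemma sum_n_add (f g : nat -> R) n :
  sum_n (fun i => f i + g i) n = sum_n f n + sum_n g n.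
Proof. apply (sum_n_plus f g n). Qed.

Lemma sum_n_congr (f g : nat -> R) n : (forall i, (i <= n)%nat -> f i = g i) ->
  sum_n f n = sum_n g n.
Proof. intros H; apply sum_n_ext_loc; exact H. Qed.

Lemma sum_n_zero (f : nat -> R) n : (forall i, (i <= n)%nat -> f i = 0) -> sum_n f n = 0.
Proof.
  intros H; induction n as [|n IH]; [rewrite sum_O; apply H; lia|].
  rewrite sum_Sn, IH, H; [unfold plus; simpl; ring|lia|intros; apply H; lia].
Qed.

Definition trunc (l : nat) (P : list mono) : list mono :=
  filter (fun m => (mx m + my m + me m <=? l)%nat) P.

Definition sum3 (c : nat -> nat -> nat -> R) (l : nat) (x y e : R) : R :=
  sum_n (fun n => sum_n (fun i => sum_n (fun j =>
    c i j (n - i - j)%nat * x ^ i * y ^ j * e ^ (n - i - j)) (n - i)) n) l.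

Lemma sum3_ext c c' l x y e :
  (forall i j k, (i + j + k <= l)%nat -> c i j k = c' i j k) ->
  sum3 c l x y e = sum3 c' l x y e.
Proof.
  intros H; unfold sum3; apply sum_n_congr; intros n Hn.
  apply sum_n_congr; intros i Hi; apply sum_n_congr; intros j Hj.
  rewrite H by lia; reflexivity.
Qed.

(** Both sides are additive in the list, and for one monomial the triple sum has at most one nonzero
    term. *)
Lemma sum3_coef l P x y e : sum3 (fun i j k => coef i j k P) l x y e = ev (trunc l P) x y e.
Proof.
  induction P as [|m P IH]; simpl.
  - unfold sum3.
    do 3 (apply sum_n_zero; intros ? _); ring.
  - transitivity (sum3 (fun i j k => if exps i j k m then mc m else 0) l x y e
                  + sum3 (fun i j k => coef i j k P) l x y e).
    { unfold sum3; rewrite <- sum_n_add; apply sum_n_congr; intros n _.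
      rewrite <- sum_n_add; apply sum_n_congr; intros i _.
      rewrite <- sum_n_add; apply sum_n_congr; intros j _; ring. }
    rewrite IH.
    assert (E : sum3 (fun i j k => if exps i j k m then mc m else 0) l x y e =
                if (mx m + my m + me m <=? l)%nat then mev m x y e else 0).
    { unfold sum3; rewrite (sum_n_pick _ (mx m + my m + me m)).
      - destruct (mx m + my m + me m <=? l)%nat; [|reflexivity].
        rewrite (sum_n_pick _ (mx m)).
        + destruct (Nat.leb_spec (mx m) (mx m + my m + me m)); [|lia].
          rewrite (sum_n_pick _ (my m)).
          * destruct (Nat.leb_spec (my m) (mx m + my m + me m - mx m)); [|lia].
            replace (mx m + my m + me m - mx m - my m)%nat with (me m) by lia.
            unfold exps, mev; rewrite !Nat.eqb_refl; reflexivity.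
          * intros j Hj; unfold exps.
            destruct (Nat.eqb_spec (my m) j); [lia|].
            rewrite Bool.andb_false_r; simpl; ring.
        + intros i Hi; apply sum_n_zero.
          intros j _; unfold exps; destruct (Nat.eqb_spec (mx m) i); [lia|]; simpl; ring.
      - intros n Hn.
        apply sum_n_zero; intros i Hi.
        apply sum_n_zero; intros j Hj.
        unfold exps; destruct (Nat.eqb_spec (mx m) i), (Nat.eqb_spec (my m) j),
          (Nat.eqb_spec (me m) (n - i - j)); simpl; try ring; lia. }
    rewrite E; destruct (mx m + my m + me m <=? l)%nat; simpl; ring.
Qed.

Lemma jet_sum3 l f x y e :
  jet l f x y e = sum3 (fun i j k => partial0 i j k f / fact3 i j k) l x y e.
Proof. reflexivity. Qed.

Lemma jet_ext l f g : (forall i j k, (i + j + k <= l)%nat -> partial0 i j k f = partial0 i j k g) ->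
  jet l f = jet l g.
Proof.
  intros H; do 3 (apply functional_extensionality; intro); rewrite !jet_sum3.
  apply sum3_ext; intros i j k Hl; rewrite H by assumption; reflexivity.
Qed.

Lemma jet_ev l P : jet l (ev P) = ev (trunc l P).
Proof.
  do 3 (apply functional_extensionality; intro); rewrite jet_sum3, <- sum3_coef.
  apply sum3_ext; intros i j k _; rewrite partial0_coef; field; apply fact3_neq_0.
Qed.

(** The part of total degree n, enumerated in the order of [jet], so that evaluation matches the jet
    term by term. *)
Definition layer (c : nat -> nat -> nat -> R) (n : nat) : list mono :=
  flat_map (fun i => flat_map (fun j => Mono (c i j (n - i - j)%nat) i j (n - i - j) :: nil)
    (seq 0 (S (n - i)))) (seq 0 (S n)).

Definition polyL (c : nat -> nat -> nat -> R) (r : nat) : list mono :=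
  flat_map (layer c) (seq 0 (S r)).

Lemma ev_flat_map_seq (F : nat -> list mono) n x y e :
  ev (flat_map F (seq 0 (S n))) x y e = sum_n (fun i => ev (F i) x y e) n.
Proof.
  induction n as [|n IH]; [rewrite sum_O; simpl; rewrite ev_app; simpl; ring|].
  rewrite seq_S, flat_map_app, ev_app, IH, sum_Sn; simpl; rewrite ev_app.
  unfold plus; simpl; ring.
Qed.

Lemma ev_polyL c r x y e : ev (polyL c r) x y e = sum3 c r x y e.
Proof.
  unfold polyL, sum3; rewrite ev_flat_map_seq; apply sum_n_congr; intros n _.
  unfold layer; rewrite ev_flat_map_seq; apply sum_n_congr; intros i _.
  rewrite ev_flat_map_seq; apply sum_n_congr; intros j _; simpl; unfold mev; simpl; ring.
Qed.

Definition jetL (r : nat) (f : R -> R -> R -> R) : list mono :=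
  polyL (fun i j k => partial0 i j k f / fact3 i j k) r.

Lemma ev_jetL r f : ev (jetL r f) = jet r f.
Proof.
  do 3 (apply functional_extensionality; intro); rewrite jet_sum3; apply ev_polyL.
Qed.

Definition slice0 (P : list mono) : list mono := filter (fun m => (me m =? 0)%nat) P.

Definition divE (P : list mono) : list mono :=
  map (fun m => Mono (mc m) (mx m) (my m) (pred (me m)))
    (filter (fun m => negb (me m =? 0)%nat) P).

Lemma ev_slice0 P x y e : ev (slice0 P) x y e = ev P x y 0.
Proof.
  induction P as [|m P IH]; simpl; [reflexivity|].
  destruct (Nat.eqb_spec (me m) 0) as [H|H]; simpl; rewrite IH; unfold mev.
  - rewrite H; reflexivity.
  - rewrite (pow_i (me m)) by lia; ring.
Qed.

Lemma ev_divE P x y e : ev P x y e = ev P x y 0 + e * ev (divE P) x y e.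
Proof.
  unfold divE; induction P as [|m P IH]; simpl; [ring|].
  destruct (Nat.eqb_spec (me m) 0) as [H|H]; simpl; rewrite IH; unfold mev; simpl.
  - rewrite H; simpl; ring.
  - rewrite (pow_i (me m)) by lia.
    replace (me m) with (S (pred (me m))) at 1 by lia; simpl; ring.
Qed.

(** * The logarithm of a unipotent map *)

(* Weighted order of vanishing, stated for functions because a polynomial has many
   monomial lists. *)
Definition Ow (n : nat) (f : R -> R -> R -> R) : Prop :=
  exists P, wt n P /\ f = ev P.

Ltac fext := do 3 (apply functional_extensionality; intro).

Lemma Ow_le n m f : (n <= m)%nat -> Ow m f -> Ow n f.
Proof. intros H (P & HP & E); exists P; split; [eapply wt_le; eassumption|exact E]. Qed.

Lemma Ow_plus n f g : Ow n f -> Ow n g -> Ow n (fun x y e => f x y e + g x y e).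
Proof.
  intros (P & HP & ->) (Q & HQ & ->); exists (P ++ Q); split; [apply wt_app; assumption|].
  fext; rewrite ev_app; reflexivity.
Qed.

Lemma Ow_scal n c f : Ow n f -> Ow n (fun x y e => c * f x y e).
Proof.
  intros (P & HP & ->); exists (pscal c P); split; [apply wt_scal; assumption|].
  fext; rewrite ev_scal; reflexivity.
Qed.

Lemma Ow_minus n f g : Ow n f -> Ow n g -> Ow n (fun x y e => f x y e - g x y e).
Proof.
  intros Hf Hg; replace (fun x y e => f x y e - g x y e)
    with (fun x y e => f x y e + (-1) * g x y e) by (fext; ring).
  apply (Ow_plus n f (fun x y e => -1 * g x y e)); [exact Hf|apply Ow_scal; exact Hg].
Qed.

Lemma Ow_mult n i j f g : (n <= i + j)%nat -> Ow i f -> Ow j g ->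
  Ow n (fun x y e => f x y e * g x y e).
Proof.
  intros H (P & HP & ->) (Q & HQ & ->); exists (mul P Q); split.
  - apply wt_le with (i + j)%nat; [exact H|apply wt_mul; assumption].
  - fext; rewrite ev_mul; reflexivity.
Qed.

Lemma Ow_zero n : Ow n (fun _ _ _ => 0).
Proof. exists nil; split; [constructor|reflexivity]. Qed.

Lemma Ow_const c : Ow 0 (fun _ _ _ => c).
Proof.
  exists (Mono c 0 0 0 :: nil); split; [repeat constructor; simpl; lia|].
  fext; simpl; unfold mev; simpl; ring.
Qed.

Lemma Ow_x : Ow 1 (fun x _ _ => x).
Proof.
  exists (Mono 1 1 0 0 :: nil); split; [repeat constructor; simpl; lia|].
  fext; simpl; unfold mev; simpl; ring.
Qed.

Lemma Ow_y : Ow 2 (fun _ y _ => y).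
Proof.
  exists (Mono 1 0 1 0 :: nil); split; [repeat constructor; simpl; lia|].
  fext; simpl; unfold mev; simpl; ring.
Qed.

Lemma Ow_e : Ow 3 (fun _ _ e => e).
Proof.
  exists (Mono 1 0 0 1 :: nil); split; [repeat constructor; simpl; lia|].
  fext; simpl; unfold mev; simpl; ring.
Qed.

Lemma Ow_Dx n m f : (n <= m - 1)%nat -> Ow m f -> Ow n (Dx f).
Proof.
  intros H (P & HP & ->); exists (der dX P); split; [|apply Dx_ev].
  eapply wt_le; [exact H|apply (wt_der dX); exact HP].
Qed.

Lemma Ow_Dy n m f : (n <= m - 2)%nat -> Ow m f -> Ow n (Dy f).
Proof.
  intros H (P & HP & ->); exists (der dY P); split; [|apply Dy_ev].
  eapply wt_le; [exact H|apply (wt_der dY); exact HP].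
Qed.

Lemma Ow_sum n N (f : nat -> R -> R -> R -> R) : (forall k, Ow n (f k)) ->
  Ow n (fun x y e => sum_n (fun k => f k x y e) N).
Proof.
  intros H; induction N as [|N IH].
  - replace (fun x y e => sum_n (fun k => f k x y e) 0) with (f 0%nat); [apply H|].
    fext; rewrite sum_O; reflexivity.
  - replace (fun x y e => sum_n (fun k => f k x y e) (S N))
      with (fun x y e => sum_n (fun k => f k x y e) N + f (S N) x y e).
    + apply (Ow_plus n (fun x y e => sum_n (fun k => f k x y e) N)); auto.
    + fext; rewrite sum_Sn; reflexivity.
Qed.

Lemma Ow_derive_x f : Ow 0 f -> forall x y e, is_derive (fun t => f t y e) x (Dx f x y e).
Proof. intros (P & _ & ->) x y e; rewrite Dx_ev; apply (ev_has_D dX). Qed.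

Lemma Ow_derive_y f : Ow 0 f -> forall x y e, is_derive (fun t => f x t e) y (Dy f x y e).
Proof. intros (P & _ & ->) x y e; rewrite Dy_ev; apply (ev_has_D dY). Qed.

Lemma Dx_minus f g x y e : Ow 0 f -> Ow 0 g ->
  Dx (fun x y e => f x y e - g x y e) x y e = Dx f x y e - Dx g x y e.
Proof.
  intros Hf Hg; apply is_derive_unique.
  apply (is_derive_minus (fun t => f t y e) (fun t => g t y e));
    apply Ow_derive_x; assumption.
Qed.

Lemma Dy_minus f g x y e : Ow 0 f -> Ow 0 g ->
  Dy (fun x y e => f x y e - g x y e) x y e = Dy f x y e - Dy g x y e.
Proof.
  intros Hf Hg; apply is_derive_unique.
  apply (is_derive_minus (fun t => f x t e) (fun t => g x t e));
    apply Ow_derive_y; assumption.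
Qed.

Lemma Dx_plus f g : Ow 0 f -> Ow 0 g ->
  Dx (fun x y e => f x y e + g x y e) = fun x y e => Dx f x y e + Dx g x y e.
Proof.
  intros Hf Hg; fext; apply is_derive_unique.
  apply (is_derive_plus (fun t => f t x0 x1) (fun t => g t x0 x1));
    apply Ow_derive_x; assumption.
Qed.

Lemma Dy_plus f g : Ow 0 f -> Ow 0 g ->
  Dy (fun x y e => f x y e + g x y e) = fun x y e => Dy f x y e + Dy g x y e.
Proof.
  intros Hf Hg; fext; apply is_derive_unique.
  apply (is_derive_plus (fun t => f x t x1) (fun t => g x t x1));
    apply Ow_derive_y; assumption.
Qed.

Lemma Dx_mult f g : Ow 0 f -> Ow 0 g ->
  Dx (fun x y e => f x y e * g x y e)
  = fun x y e => Dx f x y e * g x y e + f x y e * Dx g x y e.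
Proof.
  intros Hf Hg; fext; apply is_derive_unique.
  apply (is_derive_mult (fun t => f t x0 x1) (fun t => g t x0 x1));
    [apply Ow_derive_x; assumption|apply Ow_derive_x; assumption|exact Rmult_comm].
Qed.

Lemma Dy_mult f g : Ow 0 f -> Ow 0 g ->
  Dy (fun x y e => f x y e * g x y e)
  = fun x y e => Dy f x y e * g x y e + f x y e * Dy g x y e.
Proof.
  intros Hf Hg; fext; apply is_derive_unique.
  apply (is_derive_mult (fun t => f x t x1) (fun t => g x t x1));
    [apply Ow_derive_y; assumption|apply Ow_derive_y; assumption|exact Rmult_comm].
Qed.

(** * Lie derivatives and their gain of weight; eps is a parameter and is not differentiated *)

Definition lie (v1 v2 f : R -> R -> R -> R) : R -> R -> R -> R :=
  fun x y e => v1 x y e * Dx f x y e + v2 x y e * Dy f x y e.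

(** Weights n + 2 against the loss 1 of [Dx], and n + 3 against the loss 2 of [Dy]: a net gain of n
    + 1 in both terms. The case n = 0 is the field itself; general n is a difference of fields that
    agree to high weight. *)
Lemma lie_O n m p v1 v2 f : (p <= m + n + 1)%nat ->
  Ow (n + 2) v1 -> Ow (n + 3) v2 -> Ow m f -> Ow p (lie v1 v2 f).
Proof.
  intros H H1 H2 Hf; apply (Ow_plus p (fun x y e => v1 x y e * Dx f x y e)).
  - apply Ow_mult with (n + 2)%nat (m - 1)%nat; [lia|exact H1|].
    apply Ow_Dx with m; [lia|exact Hf].
  - apply Ow_mult with (n + 3)%nat (m - 2)%nat; [lia|exact H2|].
    apply Ow_Dy with m; [lia|exact Hf].
Qed.

Lemma iter_lie_O k m v1 v2 f : Ow 2 v1 -> Ow 3 v2 -> Ow m f ->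
  Ow (m + k) (Nat.iter k (lie v1 v2) f).
Proof.
  intros H1 H2 Hf; induction k as [|k IH]; simpl; [rewrite Nat.add_0_r; exact Hf|].
  apply lie_O with 0%nat (m + k)%nat; auto; lia.
Qed.

Definition X : R -> R -> R -> R := fun x _ _ => x.
Definition Y : R -> R -> R -> R := fun _ y _ => y.

Definition fmin (f g : R -> R -> R -> R) : R -> R -> R -> R :=
  fun x y e => f x y e - g x y e.

Lemma lie_diff v1 v2 w1 w2 f g : Ow 0 f -> Ow 0 g ->
  fmin (lie w1 w2 g) (lie v1 v2 f)
  = fun x y e => lie w1 w2 (fmin g f) x y e + lie (fmin w1 v1) (fmin w2 v2) f x y e.
Proof.
  intros Hf Hg; fext; unfold lie, fmin; rewrite Dx_minus, Dy_minus by assumption; ring.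
Qed.

(** By [lie_diff] a step splits into the field applied to the old difference, which gains one
    weight, and the field difference applied to the k-th iterate, which has weight m + k and gains n
    + 1. *)
Lemma iter_lie_diff k n m v1 v2 w1 w2 f g :
  Ow 2 v1 -> Ow 3 v2 -> Ow 2 w1 -> Ow 3 w2 ->
  Ow (n + 2) (fmin w1 v1) -> Ow (n + 3) (fmin w2 v2) ->
  Ow m f -> Ow m g -> Ow (m + n) (fmin g f) ->
  Ow (m + n + k) (fmin (Nat.iter k (lie w1 w2) g) (Nat.iter k (lie v1 v2) f)).
Proof.
  intros H1 H2 G1 G2 D1 D2 Hf Hg D; induction k as [|k IH]; simpl Nat.iter.
  - rewrite Nat.add_0_r; exact D.
  - pose proof (iter_lie_O k m v1 v2 f H1 H2 Hf) as If.
    pose proof (iter_lie_O k m w1 w2 g G1 G2 Hg) as Ig.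
    rewrite lie_diff by (eapply Ow_le; [|eassumption]; lia).
    apply Ow_plus.
    + apply lie_O with 0%nat (m + n + k)%nat; auto; lia.
    + apply lie_O with n (m + k)%nat; auto; lia.
Qed.

Section LogarithmIteration.

(* The prescribed map is (x + F + eps A0, y + eps B0), the sought field
   (F q + eps a, eps b).  One Picard-type step for the logarithm replaces (q,a,b)
   by the triple below, in which the linear term of the exponential cancels. *)

Variables F A0 B0 : R -> R -> R -> R.
Variable N : nat.

Definition fld1 (q a : R -> R -> R -> R) : R -> R -> R -> R :=
  fun x y e => F x y e * q x y e + e * a x y e.
Definition fld2 (b : R -> R -> R -> R) : R -> R -> R -> R := fun x y e => e * b x y e.

(** The index is shifted: this is the iterate of order k + 1. One further application of the field,
    written out in [nextq] and [nexta], gives order k + 2, whence the factor [ifact k]. *)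
Definition liex (q a b : R -> R -> R -> R) (k : nat) :=
  Nat.iter (S k) (lie (fld1 q a) (fld2 b)) X.
Definition lieb (q a b : R -> R -> R -> R) (k : nat) :=
  Nat.iter (S k) (lie (fld1 q a) (fld2 b)) b.
Definition ifact (k : nat) : R := / INR (fact (S (S k))).

(** The term of order k + 2 in the exponential of x is (F q + eps a) Dx u + eps b Dy u with u =
    [liex q a b k]. The part carrying F is assigned to q, the parts carrying eps to a; this
    bookkeeping keeps the field in the form F q + eps a. *)
Definition nextq (q a b : R -> R -> R -> R) : R -> R -> R -> R := fun x y e =>
  1 - sum_n (fun k => ifact k * (q x y e * Dx (liex q a b k) x y e)) N.
Definition nexta (q a b : R -> R -> R -> R) : R -> R -> R -> R := fun x y e =>
  A0 x y e - sum_n (fun k => ifact k *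
    (a x y e * Dx (liex q a b k) x y e + b x y e * Dy (liex q a b k) x y e)) N.
Definition nextb (q a b : R -> R -> R -> R) : R -> R -> R -> R := fun x y e =>
  B0 x y e - sum_n (fun k => ifact k * lieb q a b k x y e) N.

Definition lie_exp (v1 v2 f : R -> R -> R -> R) : R -> R -> R -> R := fun x y e =>
  sum_n (fun k => Nat.iter k (lie v1 v2) f x y e / INR (fact k)) (S (S N)).

Lemma sum_n_from_2 (g : nat -> R) M :
  sum_n g (S (S M)) = g 0%nat + g 1%nat + sum_n (fun k => g (S (S k))) M.
Proof.
  induction M as [|M IH].
  - rewrite !sum_Sn, !sum_O; unfold plus; simpl; ring.
  - rewrite sum_Sn, IH, (sum_Sn _ M); unfold plus; simpl; ring.
Qed.

Lemma sum_n_mul (c : R) (g : nat -> R) M : c * sum_n g M = sum_n (fun k => c * g k) M.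
Proof. symmetry; apply (sum_n_mult_l c g M). Qed.

Lemma Dx_X x y e : Dx X x y e = 1.
Proof. apply Derive_id. Qed.
Lemma Dy_X x y e : Dy X x y e = 0.
Proof. exact (Derive_const x y). Qed.
Lemma Dx_Y x y e : Dx Y x y e = 0.
Proof. exact (Derive_const y x). Qed.
Lemma Dy_Y x y e : Dy Y x y e = 1.
Proof. apply Derive_id. Qed.

(** The error of the truncated exponential is itself a field of the same shape, built from the
    defects q - [nextq] and a - [nexta]. An approximate fixed point is therefore an approximate
    logarithm. *)
Lemma lie_exp_x q a b x y e :
  lie_exp (fld1 q a) (fld2 b) X x y e
  = x + F x y e + e * A0 x y e
    + (F x y e * (q x y e - nextq q a b x y e) + e * (a x y e - nexta q a b x y e)).
Proof.
  unfold lie_exp; rewrite sum_n_from_2.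
  rewrite (sum_n_congr _ (fun k => F x y e * (ifact k * (q x y e * Dx (liex q a b k) x y e))
     + e * (ifact k * (a x y e * Dx (liex q a b k) x y e + b x y e * Dy (liex q a b k) x y e)))).
  - rewrite sum_n_add, <- !sum_n_mul; unfold nextq, nexta.
    change (Nat.iter 1 _ X x y e) with (lie (fld1 q a) (fld2 b) X x y e).
    change (Nat.iter 0 _ X x y e) with x.
    unfold lie, fld1, fld2; rewrite Dx_X, Dy_X; simpl (INR (fact _)); field.
  - intros k _; change (Nat.iter (S (S k)) _ X) with (lie (fld1 q a) (fld2 b) (liex q a b k)).
    unfold lie at 1, fld1 at 1, fld2 at 1, ifact, Rdiv; ring.
Qed.

Lemma lie_X v1 v2 : lie v1 v2 X = v1.
Proof. fext; unfold lie; rewrite Dx_X, Dy_X; ring. Qed.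

Lemma lie_Y v1 v2 : lie v1 v2 Y = v2.
Proof. fext; unfold lie; rewrite Dx_Y, Dy_Y; ring. Qed.

(** The flow keeps eps constant, so the factor eps passes through the Lie derivative; every term of
    the exponential of y beyond y itself is thus divisible by eps. *)
Lemma lie_fld2 v1 v2 b : lie v1 v2 (fld2 b) = fld2 (lie v1 v2 b).
Proof.
  fext; unfold lie, fld2, Dx, Dy; rewrite !Derive_scal; ring.
Qed.

Lemma iter_lie_fld2 k v1 v2 b : Nat.iter k (lie v1 v2) (fld2 b) = fld2 (Nat.iter k (lie v1 v2) b).
Proof. induction k as [|k IH]; simpl; [reflexivity|rewrite IH; apply lie_fld2]. Qed.

Lemma lie_exp_y q a b x y e :
  lie_exp (fld1 q a) (fld2 b) Y x y e
  = y + e * B0 x y e + e * (b x y e - nextb q a b x y e).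
Proof.
  unfold lie_exp; rewrite sum_n_from_2.
  rewrite (sum_n_congr _ (fun k => e * (ifact k * lieb q a b k x y e))).
  - rewrite <- !sum_n_mul; unfold nextb.
    change (Nat.iter 1 _ Y x y e) with (lie (fld1 q a) (fld2 b) Y x y e).
    change (Nat.iter 0 _ Y x y e) with y.
    rewrite lie_Y; unfold fld2 at 1; simpl (INR (fact _)); field.
  - intros k _; rewrite Nat.iter_succ_r, lie_Y, iter_lie_fld2.
    unfold fld2 at 1, ifact, lieb, Rdiv; ring.
Qed.

Hypothesis HF : Ow 2 F.
Hypothesis HA : Ow 0 A0.
Hypothesis HB : Ow 0 B0.

(** F weighs 2 and eps weighs 3, so a may lag one weight behind q. *)
Lemma fld1_O n q a : Ow n q -> Ow (n - 1) a -> Ow (n + 2) (fld1 q a).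
Proof.
  intros Hq Ha; apply (Ow_plus _ (fun x y e => F x y e * q x y e)).
  - apply Ow_mult with 2%nat n; auto; lia.
  - apply (Ow_mult _ 3 (n - 1) (fun _ _ e => e)); auto using Ow_e; lia.
Qed.

Lemma fld2_O n b : Ow n b -> Ow (n + 3) (fld2 b).
Proof. intros Hb; apply (Ow_mult _ 3 n (fun _ _ e => e)); auto using Ow_e; lia. Qed.

Lemma Ow_0 n f : Ow n f -> Ow 0 f.
Proof. apply Ow_le; lia. Qed.

(* [Ow (n - 1)] uses truncated subtraction: for n = 0 nothing is asked of a' - a, so the
   iteration can start anywhere. *)
Section FieldDifference.
Variables q a b q' a' b' : R -> R -> R -> R.
Hypotheses (Hq : Ow 0 q) (Ha : Ow 0 a) (Hb : Ow 0 b).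
Hypotheses (Hq' : Ow 0 q') (Ha' : Ow 0 a') (Hb' : Ow 0 b').
Variable n : nat.
Hypotheses (Dq : Ow n (fmin q' q)) (Da : Ow (n - 1) (fmin a' a)) (Db : Ow n (fmin b' b)).

Lemma liex_O k : Ow (k + 2) (liex q a b k).
Proof.
  apply Ow_le with (1 + S k)%nat; [lia|].
  apply iter_lie_O; [apply (fld1_O 0)|apply (fld2_O 0)|apply Ow_x]; assumption.
Qed.

Lemma lieb_O k : Ow (k + 1) (lieb q a b k).
Proof.
  apply Ow_le with (0 + S k)%nat; [lia|].
  apply iter_lie_O; [apply (fld1_O 0)|apply (fld2_O 0)|]; assumption.
Qed.

Lemma fld1_diff : Ow (n + 2) (fmin (fld1 q' a') (fld1 q a)).
Proof.
  replace (fmin (fld1 q' a') (fld1 q a)) with (fld1 (fmin q' q) (fmin a' a))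
    by (fext; unfold fmin, fld1; ring).
  apply fld1_O; assumption.
Qed.

Lemma fld2_diff : Ow (n + 3) (fmin (fld2 b') (fld2 b)).
Proof.
  replace (fmin (fld2 b') (fld2 b)) with (fld2 (fmin b' b))
    by (fext; unfold fmin, fld2; ring).
  apply fld2_O; assumption.
Qed.

Lemma liex_diff k : Ow (n + k + 2) (fmin (liex q' a' b' k) (liex q a b k)).
Proof.
  apply Ow_le with (1 + n + S k)%nat; [lia|].
  apply iter_lie_diff; try apply Ow_x; try apply (fld1_O 0); try apply (fld2_O 0);
    auto using fld1_diff, fld2_diff.
  replace (fmin X X) with (fun _ _ _ : R => 0) by (fext; unfold fmin; ring).
  apply Ow_zero.
Qed.

Lemma lieb_diff k : Ow (n + k + 1) (fmin (lieb q' a' b' k) (lieb q a b k)).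
Proof.
  apply Ow_le with (0 + n + S k)%nat; [lia|].
  apply iter_lie_diff; try apply (fld1_O 0); try apply (fld2_O 0);
    auto using fld1_diff, fld2_diff.
Qed.

Lemma sum_diff_O p (u u' : nat -> R -> R -> R -> R) (c : R -> R -> R -> R) :
  (forall k, Ow p (fmin (u' k) (u k))) ->
  Ow p (fmin (fun x y e => c x y e - sum_n (fun k => ifact k * u' k x y e) N)
            (fun x y e => c x y e - sum_n (fun k => ifact k * u k x y e) N)).
Proof.
  intros H.
  match goal with |- Ow p ?f => replace f with
    (fun x y e => -1 * sum_n (fun k => ifact k * fmin (u' k) (u k) x y e) N) end.
  - apply Ow_scal, (Ow_sum p N (fun k x y e => ifact k * fmin (u' k) (u k) x y e)).
    intros k; apply Ow_scal, H.
  - fext; unfold fmin.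
    replace (sum_n (fun k => ifact k * (u' k x x0 x1 - u k x x0 x1)) N)
      with (sum_n (fun k => ifact k * u' k x x0 x1) N
            + -1 * sum_n (fun k => ifact k * u k x x0 x1) N).
    + ring.
    + rewrite sum_n_mul, <- sum_n_add; apply sum_n_congr; intros; ring.
Qed.

Lemma mult_diff_O p i j i' j' f g f' g' : (p <= i + j)%nat -> (p <= i' + j')%nat ->
  Ow i f' -> Ow j (fmin g' g) -> Ow i' (fmin f' f) -> Ow j' g ->
  Ow p (fmin (fun x y e => f' x y e * g' x y e) (fun x y e => f x y e * g x y e)).
Proof.
  intros H H' H1 H2 H3 H4.
  match goal with |- Ow p ?h => replace h with
    (fun x y e => f' x y e * fmin g' g x y e + fmin f' f x y e * g x y e) end.
  - apply (Ow_plus p (fun x y e => f' x y e * fmin g' g x y e)).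
    + apply Ow_mult with i j; assumption.
    + apply Ow_mult with i' j'; assumption.
  - fext; unfold fmin; ring.
Qed.

End FieldDifference.

Section Contraction.
Variables q a b q' a' b' : R -> R -> R -> R.
Hypotheses (Hq : Ow 0 q) (Ha : Ow 0 a) (Hb : Ow 0 b).
Hypotheses (Hq' : Ow 0 q') (Ha' : Ow 0 a') (Hb' : Ow 0 b').
Variable n : nat.
Hypotheses (Dq : Ow n (fmin q' q)) (Da : Ow (n - 1) (fmin a' a)) (Db : Ow n (fmin b' b)).

Lemma Dx_liex_diff k : Ow (n + k + 1) (fmin (Dx (liex q' a' b' k)) (Dx (liex q a b k))).
Proof.
  replace (fmin (Dx (liex q' a' b' k)) (Dx (liex q a b k)))
    with (Dx (fmin (liex q' a' b' k) (liex q a b k))).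
  - apply Ow_Dx with (n + k + 2)%nat; [lia|apply liex_diff; assumption].
  - fext; unfold fmin at 2; rewrite <- Dx_minus; [reflexivity| |];
      eapply Ow_0, liex_O; assumption.
Qed.

Lemma Dy_liex_diff k : Ow (n + k) (fmin (Dy (liex q' a' b' k)) (Dy (liex q a b k))).
Proof.
  replace (fmin (Dy (liex q' a' b' k)) (Dy (liex q a b k)))
    with (Dy (fmin (liex q' a' b' k) (liex q a b k))).
  - apply Ow_Dy with (n + k + 2)%nat; [lia|apply liex_diff; assumption].
  - fext; unfold fmin at 2; rewrite <- Dy_minus; [reflexivity| |];
      eapply Ow_0, liex_O; assumption.
Qed.

Lemma Dx_liex_O k : Ow (k + 1) (Dx (liex q a b k)).
Proof. apply Ow_Dx with (k + 2)%nat; [lia|apply liex_O; assumption]. Qed.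

Lemma Dy_liex_O k : Ow k (Dy (liex q a b k)).
Proof. apply Ow_Dy with (k + 2)%nat; [lia|apply liex_O; assumption]. Qed.

Lemma nextq_diff : Ow (n + 1) (fmin (nextq q' a' b') (nextq q a b)).
Proof.
  apply (sum_diff_O _ (fun k x y e => q x y e * Dx (liex q a b k) x y e)
    (fun k x y e => q' x y e * Dx (liex q' a' b' k) x y e) (fun _ _ _ => 1)).
  intros k; apply mult_diff_O with 0%nat (n + k + 1)%nat n (k + 1)%nat;
    auto using Dx_liex_diff, Dx_liex_O; lia.
Qed.

(** [Dy] takes off two weights, so the term with b stops at weight n. That is one less than for q
    and b, yet still one more than the n - 1 assumed for a. *)
Lemma nexta_diff : Ow n (fmin (nexta q' a' b') (nexta q a b)).
Proof.
  apply (sum_diff_O _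
    (fun k x y e => a x y e * Dx (liex q a b k) x y e + b x y e * Dy (liex q a b k) x y e)
    (fun k x y e => a' x y e * Dx (liex q' a' b' k) x y e + b' x y e * Dy (liex q' a' b' k) x y e)
    A0).
  intros k.
  match goal with |- Ow n ?h => replace h with (fun x y e =>
    fmin (fun x y e => a' x y e * Dx (liex q' a' b' k) x y e)
         (fun x y e => a x y e * Dx (liex q a b k) x y e) x y e +
    fmin (fun x y e => b' x y e * Dy (liex q' a' b' k) x y e)
         (fun x y e => b x y e * Dy (liex q a b k) x y e) x y e)
    by (fext; unfold fmin; ring) end.
  apply Ow_plus.
  - apply mult_diff_O with 0%nat (n + k + 1)%nat (n - 1)%nat (k + 1)%nat;
      auto using Dx_liex_diff, Dx_liex_O; lia.
  - apply mult_diff_O with 0%nat (n + k)%nat n k;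
      auto using Dy_liex_diff, Dy_liex_O; lia.
Qed.

Lemma nextb_diff : Ow (n + 1) (fmin (nextb q' a' b') (nextb q a b)).
Proof.
  apply (sum_diff_O _ (lieb q a b) (lieb q' a' b') B0).
  intros k; apply Ow_le with (n + k + 1)%nat; [lia|]; apply lieb_diff; assumption.
Qed.

(** Whatever the input, an iterate of q has constant term 1, because each [Dx (liex q a b k)] has
    positive weight. This is the source of K(0,0) = 1; [nextb_1] is the analogue for the value of b
    at the origin. *)
Lemma nextq_1 : Ow 1 (fun x y e => nextq q a b x y e - 1).
Proof.
  match goal with |- Ow _ ?h => replace h with (fun x y e => -1 *
    sum_n (fun k => ifact k * (q x y e * Dx (liex q a b k) x y e)) N)
    by (fext; unfold nextq; ring) end.
  apply Ow_scal, (Ow_sum _ N (fun k x y e => ifact k * (q x y e * Dx (liex q a b k) x y e))).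
  intros k; apply Ow_scal, Ow_mult with 0%nat (k + 1)%nat; auto using Dx_liex_O; lia.
Qed.

Lemma nextb_1 : Ow 1 (fun x y e => nextb q a b x y e - B0 x y e).
Proof.
  match goal with |- Ow _ ?h => replace h with (fun x y e => -1 *
    sum_n (fun k => ifact k * lieb q a b k x y e) N)
    by (fext; unfold nextb; ring) end.
  apply Ow_scal, (Ow_sum _ N (fun k x y e => ifact k * lieb q a b k x y e)).
  intros k; apply Ow_scal, Ow_le with (k + 1)%nat; [lia|]; apply lieb_O; assumption.
Qed.

Lemma nexta_0 : Ow 0 (nexta q a b).
Proof.
  apply Ow_minus; [exact HA|].
  apply (Ow_sum _ N (fun k x y e => ifact k *
    (a x y e * Dx (liex q a b k) x y e + b x y e * Dy (liex q a b k) x y e))).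
  intros k; apply Ow_scal, (Ow_plus _ (fun x y e => a x y e * Dx (liex q a b k) x y e)).
  - apply Ow_mult with 0%nat (k + 1)%nat; auto using Dx_liex_O; lia.
  - apply Ow_mult with 0%nat k; auto using Dy_liex_O; lia.
Qed.

End Contraction.

Lemma Ow_from_diff n f g : Ow n (fun x y e => f x y e - g x y e) -> Ow 0 g -> Ow 0 f.
Proof.
  intros H Hg; replace f with (fun x y e => (f x y e - g x y e) + g x y e) by (fext; ring).
  apply (Ow_plus 0 (fun x y e => f x y e - g x y e)); [eapply Ow_0; exact H|exact Hg].
Qed.

Lemma logarithm_exists n : exists q a b,
  Ow 0 q /\ Ow 0 a /\ Ow 0 b /\
  Ow 1 (fun x y e => q x y e - 1) /\ Ow 1 (fun x y e => b x y e - B0 x y e) /\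
  Ow (n + 2) (fmin (lie_exp (fld1 q a) (fld2 b) X) (fun x y e => x + F x y e + e * A0 x y e)) /\
  Ow (n + 2) (fmin (lie_exp (fld1 q a) (fld2 b) Y) (fun x y e => y + e * B0 x y e)).
Proof.
  assert (G : exists q a b, Ow 0 q /\ Ow 0 a /\ Ow 0 b /\
    Ow 1 (fun x y e => q x y e - 1) /\ Ow 1 (fun x y e => b x y e - B0 x y e) /\
    Ow n (fmin q (nextq q a b)) /\ Ow (n - 1) (fmin a (nexta q a b)) /\
    Ow n (fmin b (nextb q a b))).
  { assert (N1 : forall q a b, Ow 0 q -> Ow 0 a -> Ow 0 b ->
      Ow 0 (nextq q a b) /\ Ow 0 (nexta q a b) /\ Ow 0 (nextb q a b)).
    { intros q a b Hq Ha Hb; split; [|split].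
      - eapply Ow_from_diff; [apply nextq_1; assumption|apply Ow_const].
      - apply nexta_0; assumption.
      - eapply Ow_from_diff; [apply nextb_1; assumption|assumption]. }
    induction n as [|n (q & a & b & Hq & Ha & Hb & H1 & H2 & E1 & E2 & E3)].
    (* The initial guess is the displacement of the map itself; at n = 0 the three defect conditions
       only ask for polynomials. *)
    - exists (fun _ _ _ => 1), A0, B0.
      pose proof (N1 _ _ _ (Ow_const 1) HA HB) as (M1 & M2 & M3).
      repeat (split; [first [apply Ow_const|assumption|idtac]|]); try assumption.
      + replace (fun x y e : R => 1 - 1) with (fun _ _ _ : R => 0) by (fext; ring); apply Ow_zero.
      + replace (fun x y e : R => B0 x y e - B0 x y e) with (fun _ _ _ : R => 0) by (fext; ring).
        apply Ow_zero.
      + apply Ow_minus; [apply Ow_const|assumption].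
      + apply Ow_minus; assumption.
      + apply Ow_minus; assumption.
    - exists (nextq q a b), (nexta q a b), (nextb q a b).
      pose proof (N1 _ _ _ Hq Ha Hb) as (M1 & M2 & M3).
      repeat (split; [first [assumption|apply nextq_1; assumption|apply nextb_1; assumption|idtac]|]).
      + replace (S n) with (n + 1)%nat by lia.
        apply nextq_diff; assumption.
      + replace (S n - 1)%nat with n by lia; apply nexta_diff; assumption.
      + replace (S n) with (n + 1)%nat by lia; apply nextb_diff; assumption. }
  destruct G as (q & a & b & Hq & Ha & Hb & H1 & H2 & E1 & E2 & E3).
  exists q, a, b; repeat (split; [assumption|]); split.
  - replace (fmin _ _) with (fld1 (fmin q (nextq q a b)) (fmin a (nexta q a b))).
    + apply fld1_O; assumption.
    + fext; unfold fmin at 3; rewrite lie_exp_x; unfold fld1, fmin; ring.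
  - replace (fmin _ _) with (fld2 (fmin b (nextb q a b))).
    + apply Ow_le with (n + 3)%nat; [lia|apply fld2_O; assumption].
    + fext; unfold fmin at 2; rewrite lie_exp_y; unfold fld2, fmin; ring.
Qed.

End LogarithmIteration.

(** * The Lie series and the flow *)

(** Ratio 1/2 gives radius at least 2, which puts the closed time interval [0,1] strictly inside the
    disc of convergence. *)
Lemma CV_radius_geometric (a : nat -> R) C :
  (forall k, Rabs (a k) <= C * (/ 2) ^ k) -> Rbar_le 2 (CV_radius a).
Proof.
  intros H; apply (CV_radius_bounded a); exists C; intros n.
  rewrite Rabs_mult, (Rabs_pos_eq (2 ^ n)) by (apply pow_le; lra).
  apply Rle_trans with (C * (/ 2) ^ n * 2 ^ n).
  - apply Rmult_le_compat_r; [apply pow_le; lra|apply H].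
  - rewrite Rmult_assoc, <- Rpow_mult_distr; replace (/ 2 * 2) with 1 by field.
    rewrite pow1; lra.
Qed.

Lemma inside_of_radius_2 (a : nat -> R) t : Rbar_le 2 (CV_radius a) -> Rabs t < 2 ->
  Rbar_lt (Rabs t) (CV_radius a).
Proof. intros H Ht; apply (Rbar_lt_le_trans (Rabs t) 2); [exact Ht|exact H]. Qed.

(** If the radius r were below 2, the Cauchy product would still converge at the midpoint (r + 2)/2
    of r and 2, a point outside the disc where the terms cannot tend to 0. *)
Lemma CV_radius_mult_2 a b : Rbar_le 2 (CV_radius a) -> Rbar_le 2 (CV_radius b) ->
  Rbar_le 2 (CV_radius (PS_mult a b)).
Proof.
  intros Ha Hb; apply Rbar_not_lt_le; intros H.
  pose proof (CV_radius_ge_0 (PS_mult a b)) as H0.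
  destruct (CV_radius (PS_mult a b)) as [r| |] eqn:E; simpl in H, H0; try tauto.
  assert (Hz : Rabs ((r + 2) / 2) = (r + 2) / 2) by (apply Rabs_pos_eq; lra).
  apply (CV_disk_outside (PS_mult a b) ((r + 2) / 2)).
  - rewrite E; simpl; lra.
  - assert (X : ex_pseries (PS_mult a b) ((r + 2) / 2)).
    { apply ex_pseries_mult; apply inside_of_radius_2; auto; lra. }
    apply ex_pseries_R, ex_series_lim_0 in X; exact X.
Qed.

(** The Leibniz rule for formal series: inside the convolution of order k + 1 the factor k + 1
    splits as j + (k + 1 - j). *)
Lemma PS_mult_leibniz (a b : nat -> R) k :
  PS_mult (PS_derive a) b k + PS_mult a (PS_derive b) k = INR (S k) * PS_mult a b (S k).
Proof.
  unfold PS_mult, PS_derive.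
  transitivity (sum_f_R0 (fun j => INR j * (a j * b (S k - j)%nat)) (S k)
              + sum_f_R0 (fun j => INR (S k - j) * (a j * b (S k - j)%nat)) (S k)).
  - f_equal.
    + rewrite (decomp_sum _ (S k)) by lia; simpl pred; simpl INR at 2.
      rewrite Rmult_0_l, Rplus_0_l; apply sum_eq; intros j Hj.
      replace (S k - S j)%nat with (k - j)%nat by lia; ring.
    + rewrite tech5, Nat.sub_diag; simpl (INR 0); rewrite Rmult_0_l, Rplus_0_r.
      apply sum_eq; intros j Hj; replace (S k - j)%nat with (S (k - j)) by lia; ring.
  - rewrite <- plus_sum, scal_sum; apply sum_eq; intros j Hj.
    rewrite minus_INR by exact Hj; ring.
Qed.

Section LieSeries.

Variables v1 v2 : R -> R -> R -> R.
Hypotheses (Hv1 : Ow 0 v1) (Hv2 : Ow 0 v2).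

Definition lc (f : R -> R -> R -> R) (x y e : R) (k : nat) : R :=
  Nat.iter k (lie v1 v2) f x y e / INR (fact k).

Lemma lie_O0 f : Ow 0 f -> Ow 0 (lie v1 v2 f).
Proof.
  intros Hf; apply (Ow_plus 0 (fun x y e => v1 x y e * Dx f x y e)).
  - apply Ow_mult with 0%nat 0%nat; [lia|assumption|apply Ow_Dx with 0%nat; [lia|assumption]].
  - apply Ow_mult with 0%nat 0%nat; [lia|assumption|apply Ow_Dy with 0%nat; [lia|assumption]].
Qed.

Lemma lie_plus f g : Ow 0 f -> Ow 0 g ->
  lie v1 v2 (fun x y e => f x y e + g x y e)
  = fun x y e => lie v1 v2 f x y e + lie v1 v2 g x y e.
Proof. intros Hf Hg; fext; unfold lie; rewrite Dx_plus, Dy_plus by assumption; ring. Qed.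

Lemma lie_mult f g : Ow 0 f -> Ow 0 g ->
  lie v1 v2 (fun x y e => f x y e * g x y e)
  = fun x y e => lie v1 v2 f x y e * g x y e + f x y e * lie v1 v2 g x y e.
Proof. intros Hf Hg; fext; unfold lie; rewrite Dx_mult, Dy_mult by assumption; ring. Qed.

Lemma lc_derive f x y e k : PS_derive (lc f x y e) k = lc (lie v1 v2 f) x y e k.
Proof.
  unfold PS_derive, lc; rewrite Nat.iter_succ_r.
  change (fact (S k)) with (S k * fact k)%nat; rewrite mult_INR; field.
  split; [apply INR_fact_neq_0|apply not_0_INR; lia].
Qed.

Lemma iter_lie_plus k : forall f g, Ow 0 f -> Ow 0 g ->
  Nat.iter k (lie v1 v2) (fun x y e => f x y e + g x y e)
  = fun x y e => Nat.iter k (lie v1 v2) f x y e + Nat.iter k (lie v1 v2) g x y e.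
Proof.
  induction k as [|k IH]; intros f g Hf Hg; [reflexivity|].
  rewrite !Nat.iter_succ_r, lie_plus by assumption.
  apply (IH (lie v1 v2 f) (lie v1 v2 g)); apply lie_O0; assumption.
Qed.

Lemma lc_plus f g x y e k : Ow 0 f -> Ow 0 g ->
  lc (fun x y e => f x y e + g x y e) x y e k = lc f x y e k + lc g x y e k.
Proof. intros Hf Hg; unfold lc; rewrite iter_lie_plus by assumption; unfold Rdiv; ring. Qed.

(** Differentiation in time is application of the Lie derivative, by [lc_derive], so the Leibniz
    rule for [lie] matches the one for formal series. The induction needs f and g general because it
    passes to their Lie derivatives. *)
Lemma lc_mult x y e k : forall f g, Ow 0 f -> Ow 0 g ->
  lc (fun x y e => f x y e * g x y e) x y e k = PS_mult (lc f x y e) (lc g x y e) k.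
Proof.
  induction k as [|k IH]; intros f g Hf Hg.
  - unfold lc, PS_mult; simpl; field.
  - assert (Hk : INR (S k) <> 0) by (apply not_0_INR; lia).
    apply Rmult_eq_reg_l with (INR (S k)); [|exact Hk].
    rewrite <- PS_mult_leibniz.
    transitivity (PS_derive (lc (fun x y e => f x y e * g x y e) x y e) k); [reflexivity|].
    rewrite lc_derive, lie_mult by assumption.
    pose proof (lie_O0 f Hf) as Lf; pose proof (lie_O0 g Hg) as Lg.
    rewrite (lc_plus (fun x y e => lie v1 v2 f x y e * g x y e)
                     (fun x y e => f x y e * lie v1 v2 g x y e)).
    + rewrite !IH by assumption; unfold PS_mult; f_equal;
        apply sum_eq; intros j _; rewrite <- lc_derive; reflexivity.
    + apply Ow_mult with 0%nat 0%nat; auto.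
    + apply Ow_mult with 0%nat 0%nat; auto.
Qed.

Section Point.
Variables x y e C : R.
Hypothesis bound_x : forall k, Rabs (lc X x y e k) <= C * (/ 2) ^ k.
Hypothesis bound_y : forall k, Rabs (lc Y x y e k) <= C * (/ 2) ^ k.

Definition flow1 (t : R) : R := PSeries (lc X x y e) t.
Definition flow2 (t : R) : R := PSeries (lc Y x y e) t.

(* The Lie series is an algebra morphism, so it is composition with the flow. *)
Definition transported (f : R -> R -> R -> R) : Prop :=
  Ow 0 f /\ Rbar_le 2 (CV_radius (lc f x y e)) /\
  forall t, Rabs t < 2 -> PSeries (lc f x y e) t = f (flow1 t) (flow2 t) e.

Lemma transported_X : transported X.
Proof.
  split; [eapply Ow_0, Ow_x|split; [eapply CV_radius_geometric; exact bound_x|]].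
  reflexivity.
Qed.

Lemma transported_Y : transported Y.
Proof.
  split; [eapply Ow_0, Ow_y|split; [eapply CV_radius_geometric; exact bound_y|]].
  reflexivity.
Qed.

Lemma lc_invariant f k : lie v1 v2 f = (fun _ _ _ => 0) -> lc f x y e (S k) = 0.
Proof.
  intros H; unfold lc; rewrite Nat.iter_succ_r, H.
  replace (Nat.iter k (lie v1 v2) (fun _ _ _ => 0)) with (fun _ _ _ : R => 0); [unfold Rdiv; ring|].
  induction k as [|k IH]; [reflexivity|]; simpl; rewrite <- IH.
  fext; unfold lie, Dx, Dy; rewrite !Derive_const; ring.
Qed.

Lemma transported_invariant f : Ow 0 f -> lie v1 v2 f = (fun _ _ _ => 0) ->
  (forall x' y', f x' y' e = f x y e) -> transported f.
Proof.
  intros Hf H Hc; split; [exact Hf|split].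
  - apply CV_radius_geometric with (Rabs (f x y e)); intros [|k].
    + unfold lc; simpl; rewrite Rdiv_1_r; lra.
    + rewrite lc_invariant, Rabs_R0 by exact H.
      apply Rmult_le_pos; [apply Rabs_pos|apply pow_le; lra].
  - intros t _; rewrite Hc; unfold PSeries; rewrite Series_head.
    + unfold lc; simpl; field.
    + intros n; rewrite lc_invariant by exact H; ring.
Qed.

Lemma transported_const c : transported (fun _ _ _ => c).
Proof.
  apply transported_invariant; [apply Ow_const| |reflexivity].
  fext; unfold lie, Dx, Dy; rewrite !Derive_const; ring.
Qed.

Lemma transported_e : transported (fun _ _ e => e).
Proof.
  apply transported_invariant; [eapply Ow_0, Ow_e| |reflexivity].
  fext; unfold lie, Dx, Dy; rewrite !Derive_const; ring.
Qed.

Lemma transported_plus f g : transported f -> transported g ->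
  transported (fun x y e => f x y e + g x y e).
Proof.
  intros (Of & Rf & Ef) (Og & Rg & Eg).
  assert (E : forall k, PS_plus (lc f x y e) (lc g x y e) k
     = lc (fun x y e => f x y e + g x y e) x y e k)
    by (intros k; rewrite lc_plus by assumption; reflexivity).
  split; [apply (Ow_plus 0 f g); assumption|split].
  - rewrite <- (CV_radius_ext _ _ E).
    eapply Rbar_le_trans; [|apply CV_radius_plus].
    apply Rbar_min_case; assumption.
  - intros t Ht; rewrite <- (PSeries_ext _ _ t E), PSeries_plus.
    + rewrite Ef, Eg by assumption; reflexivity.
    + apply CV_radius_inside, inside_of_radius_2; assumption.
    + apply CV_radius_inside, inside_of_radius_2; assumption.
Qed.

Lemma transported_mult f g : transported f -> transported g ->
  transported (fun x y e => f x y e * g x y e).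
Proof.
  intros (Of & Rf & Ef) (Og & Rg & Eg).
  assert (E : forall k, PS_mult (lc f x y e) (lc g x y e) k
     = lc (fun x y e => f x y e * g x y e) x y e k)
    by (intros k; rewrite lc_mult by assumption; reflexivity).
  split; [apply (Ow_mult 0 0 0 f g); auto|split].
  - rewrite <- (CV_radius_ext _ _ E); apply CV_radius_mult_2; assumption.
  - intros t Ht; rewrite <- (PSeries_ext _ _ t E), PSeries_mult
      by (apply inside_of_radius_2; assumption).
    rewrite Ef, Eg by assumption; reflexivity.
Qed.

Lemma transported_pow f n : transported f -> transported (fun x y e => f x y e ^ n).
Proof.
  intros Hf; induction n as [|n IH]; simpl; [apply transported_const|].
  apply (transported_mult f (fun x y e => f x y e ^ n)); assumption.
Qed.

(** The coordinates, eps and the constants are transported, and transported functions form an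
    algebra. *)
Lemma transported_ev P : transported (ev P).
Proof.
  induction P as [|m P IH]; simpl; [apply transported_const|].
  apply (transported_plus (mev m) (ev P)); [|exact IH]; unfold mev.
  apply (transported_mult (fun x y e => mc m * x ^ mx m * y ^ my m) (fun _ _ e => e ^ me m)).
  - apply (transported_mult (fun x y e => mc m * x ^ mx m) (fun _ y _ => y ^ my m)).
    + apply (transported_mult (fun x y e => mc m) (fun x _ _ => x ^ mx m)).
      * apply transported_const.
      * apply (transported_pow X), transported_X.
    + apply (transported_pow Y), transported_Y.
  - apply (transported_pow (fun _ _ e => e)), transported_e.
Qed.

(** The time derivative of the series of x is the series of [lie v1 v2 X] = v1, and transport of the
    polynomial v1 identifies that series with v1 evaluated along the flow; likewise for y. *)
Lemma flow_derive t : Rabs t < 2 ->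
  is_derive flow1 t (v1 (flow1 t) (flow2 t) e) /\ is_derive flow2 t (v2 (flow1 t) (flow2 t) e).
Proof.
  intros Ht.
  assert (T : forall v, Ow 0 v -> transported v) by (intros v (P & _ & ->); apply transported_ev).
  split.
  - destruct (T v1 Hv1) as (_ & _ & E); rewrite <- E by exact Ht.
    rewrite (PSeries_ext _ (PS_derive (lc X x y e)))
      by (intros k; rewrite lc_derive, lie_X; reflexivity).
    apply is_derive_PSeries, inside_of_radius_2; [apply transported_X|exact Ht].
  - destruct (T v2 Hv2) as (_ & _ & E); rewrite <- E by exact Ht.
    rewrite (PSeries_ext _ (PS_derive (lc Y x y e)))
      by (intros k; rewrite lc_derive, lie_Y; reflexivity).
    apply is_derive_PSeries, inside_of_radius_2; [apply transported_Y|exact Ht].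
Qed.

Lemma flow_start : flow1 0 = x /\ flow2 0 = y.
Proof.
  unfold flow1, flow2; rewrite !PSeries_0; unfold lc; simpl; unfold X, Y; split; field.
Qed.

End Point.
End LieSeries.

(** * Norm estimates for iterated Lie derivatives of a polynomial field *)

Section LieBounds.

Variables P1 P2 : list mono.

Definition lieL (P : list mono) : list mono := mul P1 (der dX P) ++ mul P2 (der dY P).

Lemma ev_lieL P : ev (lieL P) = lie (ev P1) (ev P2) (ev P).
Proof. fext; unfold lieL, lie; rewrite ev_app, !ev_mul, Dx_ev, Dy_ev; reflexivity. Qed.

Definition lieT (P : list mono) (k : nat) : list mono :=
  pscal (/ INR (fact k)) (Nat.iter k lieL P).

Lemma ev_lieT P k x y e : ev (lieT P k) x y e = lc (ev P1) (ev P2) (ev P) x y e k.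
Proof.
  unfold lieT, lc; rewrite ev_scal.
  assert (E : ev (Nat.iter k lieL P) = Nat.iter k (lie (ev P1) (ev P2)) (ev P)).
  { induction k as [|k IH]; [reflexivity|]; simpl; rewrite ev_lieL, IH; reflexivity. }
  rewrite E; unfold Rdiv; ring.
Qed.

Variable d : nat.
Hypotheses (W1 : wdeg d P1) (W2 : wdeg d P2).

Lemma wdeg_iter_lieL n P k : wdeg n P -> wdeg (n + k * d) (Nat.iter k lieL P).
Proof.
  intros HP; induction k as [|k IH]; [rewrite Nat.add_0_r; exact HP|].
  simpl Nat.iter; apply wdeg_app.
  - apply wdeg_le with (d + (n + k * d))%nat; [lia|].
    apply wdeg_mul; [exact W1|apply (wdeg_der dX); exact IH].
  - apply wdeg_le with (d + (n + k * d))%nat; [lia|].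
    apply wdeg_mul; [exact W2|apply (wdeg_der dY); exact IH].
Qed.

Variable s : R.
Hypothesis Hs : 0 < s.

(** The size of the field measured against the radii s in x and s^2 in y. *)
Definition speed : R := nrm s P1 / s + nrm s P2 / s ^ 2.

Lemma speed_pos : 0 <= speed.
Proof.
  unfold speed; pose proof (nrm_pos s P1 (Rlt_le _ _ Hs)); pose proof (nrm_pos s P2 (Rlt_le _ _ Hs)).
  apply Rplus_le_le_0_compat; apply Rmult_le_pos; try assumption;
    left; apply Rinv_0_lt_compat; [exact Hs|apply pow_lt; exact Hs].
Qed.

Lemma nrm_lieL n P : wdeg n P -> nrm s (lieL P) <= INR n * speed * nrm s P.
Proof.
  intros HP; unfold lieL; rewrite nrm_app, !nrm_mul.
  pose proof (nrm_der dX s n P Hs HP) as T1; pose proof (nrm_der dY s n P Hs HP) as T2.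
  simpl dwt in T1, T2; rewrite pow_1 in T1.
  pose proof (pow_lt s 2 Hs).
  pose proof (nrm_pos s P1 (Rlt_le _ _ Hs)); pose proof (nrm_pos s P2 (Rlt_le _ _ Hs)).
  assert (G1 : nrm s (der dX P) <= INR n * nrm s P / s).
  { apply Rmult_le_reg_l with s; [exact Hs|].
    replace (s * (INR n * nrm s P / s)) with (INR n * nrm s P) by (field; lra); exact T1. }
  assert (G2 : nrm s (der dY P) <= INR n * nrm s P / s ^ 2).
  { apply Rmult_le_reg_l with (s ^ 2); [assumption|].
    replace (s ^ 2 * (INR n * nrm s P / s ^ 2)) with (INR n * nrm s P) by (field; lra); exact T2. }
  apply Rle_trans with (nrm s P1 * (INR n * nrm s P / s) + nrm s P2 * (INR n * nrm s P / s ^ 2)).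
  - apply Rplus_le_compat; apply Rmult_le_compat_l; assumption.
  - unfold speed; right; field; lra.
Qed.

(** After k steps the degree is at most n + k d <= (k + 1)(n + d), so step k + 1 costs (k + 1) times
    a fixed factor; the products of these steps form k!. *)
Lemma nrm_iter_lieL n P k : wdeg n P ->
  nrm s (Nat.iter k lieL P) <= INR (fact k) * (INR (n + d) * speed) ^ k * nrm s P.
Proof.
  intros HP; induction k as [|k IH]; [simpl; lra|].
  pose proof (nrm_lieL _ _ (wdeg_iter_lieL n P k HP)) as T.
  simpl Nat.iter; eapply Rle_trans; [exact T|].
  pose proof speed_pos as Hp.
  assert (I : INR (n + k * d) <= INR (S k) * INR (n + d)).
  { rewrite <- mult_INR; apply le_INR; nia. }
  change (fact (S k)) with (S k * fact k)%nat; rewrite mult_INR; simpl pow.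
  apply Rle_trans with (INR (S k) * INR (n + d) * speed * nrm s (Nat.iter k lieL P)).
  - apply Rmult_le_compat_r; [apply nrm_pos; lra|]; apply Rmult_le_compat_r; assumption.
  - replace (INR (S k) * INR (fact k) * (INR (n + d) * speed * (INR (n + d) * speed) ^ k) * nrm s P)
      with (INR (S k) * INR (n + d) * speed *
             (INR (fact k) * (INR (n + d) * speed) ^ k * nrm s P)) by ring.
    apply Rmult_le_compat_l; [|exact IH].
    apply Rmult_le_pos; [apply Rmult_le_pos; apply pos_INR|exact Hp].
Qed.

Hypothesis slow : INR (2 + d) * speed <= / 2.

(** The factor 1/k! of the exponential cancels the factorial growth. The bound n <= 2 covers both
    coordinates, of weights 1 and 2. *)
Lemma nrm_lieT n P k : (n <= 2)%nat -> wdeg n P -> nrm s (lieT P k) <= nrm s P * (/ 2) ^ k.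
Proof.
  intros Hn HP; unfold lieT; rewrite nrm_scal.
  pose proof (INR_fact_lt_0 k) as Hf.
  rewrite Rabs_pos_eq by (left; apply Rinv_0_lt_compat; exact Hf).
  apply Rmult_le_reg_l with (INR (fact k)); [exact Hf|].
  rewrite <- (Rmult_assoc _ (/ _)), Rinv_r, Rmult_1_l by lra.
  eapply Rle_trans; [apply nrm_iter_lieL; eassumption|].
  rewrite Rmult_assoc; apply Rmult_le_compat_l; [lra|].
  rewrite Rmult_comm; apply Rmult_le_compat_l; [apply nrm_pos; lra|].
  pose proof speed_pos; apply pow_incr; split.
  - apply Rmult_le_pos; [apply pos_INR|assumption].
  - eapply Rle_trans; [|exact slow]; apply Rmult_le_compat_r; [assumption|apply le_INR; lia].
Qed.

Lemma good_lieT n P : (n <= 2)%nat -> wdeg n P -> good s (lieT P).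
Proof.
  intros Hn HP; exists (nrm s P), (/ 2), (n + d)%nat; split; [lra|]; intros k; split.
  - apply nrm_lieT with n; assumption.
  - apply wdeg_scal, wdeg_le with (n + k * d)%nat; [nia|apply wdeg_iter_lieL; exact HP].
Qed.

Definition PX : list mono := Mono 1 1 0 0 :: nil.
Definition PY : list mono := Mono 1 0 1 0 :: nil.

Lemma ev_PX : ev PX = X.
Proof. fext; simpl; unfold mev, X; simpl; ring. Qed.
Lemma ev_PY : ev PY = Y.
Proof. fext; simpl; unfold mev, Y; simpl; ring. Qed.
Lemma wdeg_PX : wdeg 2 PX.
Proof. repeat constructor; simpl; lia. Qed.
Lemma wdeg_PY : wdeg 2 PY.
Proof. repeat constructor; simpl; lia. Qed.

Lemma lc_bounds x y e : box s x y e ->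
  (forall k, Rabs (lc (ev P1) (ev P2) X x y e k) <= (nrm s PX + nrm s PY) * (/ 2) ^ k) /\
  (forall k, Rabs (lc (ev P1) (ev P2) Y x y e k) <= (nrm s PX + nrm s PY) * (/ 2) ^ k).
Proof.
  intros B; pose proof (nrm_pos s PX (Rlt_le _ _ Hs)); pose proof (nrm_pos s PY (Rlt_le _ _ Hs)).
  assert (forall k, 0 <= (/ 2) ^ k) by (intros; apply pow_le; lra).
  split; intros k.
  - rewrite <- ev_PX, <- ev_lieT; eapply Rle_trans; [apply ev_bound; exact B|].
    eapply Rle_trans; [apply (nrm_lieT 2); [lia|apply wdeg_PX]|].
    apply Rmult_le_compat_r; [auto|lra].
  - rewrite <- ev_PY, <- ev_lieT; eapply Rle_trans; [apply ev_bound; exact B|].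
    eapply Rle_trans; [apply (nrm_lieT 2); [lia|apply wdeg_PY]|].
    apply Rmult_le_compat_r; [auto|lra].
Qed.

End LieBounds.

(** * Jets of the given map *)

Lemma filterlim_Rminus {T : Type} (F : (T -> Prop) -> Prop) (FF : Filter F)
  (f g : T -> R) (a b : R) :
  filterlim f F (locally a) -> filterlim g F (locally b) ->
  filterlim (fun t => f t - g t) F (locally (a - b)).
Proof.
  intros Hf Hg; unfold Rminus.
  apply (filterlim_comp_2 (G := locally a) (H := locally (- b)) f (fun t => - g t) Rplus); [exact Hf| |].
  - eapply filterlim_comp; [exact Hg|apply (filterlim_opp (V := R_NormedModule) b)].
  - apply (filterlim_plus (V := R_NormedModule) a (- b)).
Qed.

Lemma has_D_minus d f g x y e a b : 0 <= e -> has_D d f x y e a -> has_D d g x y e b ->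
  has_D d (fmin f g) x y e (a - b).
Proof.
  intros He; destruct d; simpl; intros Hf Hg.
  - apply (is_derive_minus (fun t => f t y e) (fun t => g t y e)); assumption.
  - apply (is_derive_minus (fun t => f x t e) (fun t => g x t e)); assumption.
  - pose proof (eps_steps_proper e He).
    apply (filterlim_ext (fun h => eps_quotient f x y e h - eps_quotient g x y e h)).
    + intros h; unfold eps_quotient, fmin, Rdiv; ring.
    + apply filterlim_Rminus; [typeclasses eauto|exact Hf|exact Hg].
Qed.

Lemma smooth_has_D d k W e1 f : smooth (S k) W e1 f ->
  forall x y e, slab W e1 (x, y, e) -> has_D d f x y e (pd d f x y e).
Proof.
  intros (_ & H & _) x y e Hs; destruct (H x y e Hs) as (H1 & H2 & H3).
  destruct d; simpl.
  - apply Derive_correct; exact H1.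
  - apply Derive_correct; exact H2.
  - destruct H3 as [l Hl].
    rewrite (De_unique f x y e l (proj1 (proj2 Hs)) Hl); exact Hl.
Qed.

Lemma smooth_D d k W e1 f : smooth (S k) W e1 f -> smooth k W e1 (pd d f).
Proof. intros (_ & _ & H1 & H2 & H3); destruct d; assumption. Qed.

Lemma smooth_continuous k W e1 f : smooth k W e1 f -> continuous_on_slab W e1 f.
Proof. destruct k; intros [H _]; exact H. Qed.

Lemma smooth_build k W e1 f : continuous_on_slab W e1 f ->
  (forall d x y e, slab W e1 (x, y, e) -> has_D d f x y e (pd d f x y e)) ->
  (forall d, smooth k W e1 (pd d f)) -> smooth (S k) W e1 f.
Proof.
  intros Hc HD HS; split; [exact Hc|split].
  - intros x y e Hs; repeat split; eexists;
      [apply (HD dX _ _ _ Hs)|apply (HD dY _ _ _ Hs)|apply (HD dE _ _ _ Hs)].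
  - split; [apply (HS dX)|split; [apply (HS dY)|apply (HS dE)]].
Qed.

Lemma agree_D_smooth d k W e1 f g : open W -> agree W e1 f g -> smooth (S k) W e1 g ->
  agree W e1 (pd d f) (pd d g).
Proof.
  intros HW A H x y e Hs; apply D_unique; [apply (proj1 (proj2 Hs))|].
  apply (has_D_agree d W e1 f g); auto; eapply smooth_has_D; eassumption.
Qed.

Lemma smooth_agree k : forall W e1 f g, open W -> agree W e1 f g -> smooth k W e1 g ->
  smooth k W e1 f.
Proof.
  assert (C : forall W e1 f g, agree W e1 f g -> continuous_on_slab W e1 g ->
    continuous_on_slab W e1 f).
  { intros W e1 f g A H x y e Hs; rewrite (A x y e Hs).
    eapply filterlim_within_ext; [|apply (H x y e Hs)].
    intros [[x' y'] e'] Hs'; symmetry; apply A; exact Hs'. }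
  induction k as [|k IH]; intros W e1 f g HW A H.
  - split; [apply C with g; [exact A|apply H]|exact I].
  - pose proof (fun d => agree_D_smooth d k W e1 f g HW A H) as AD.
    apply smooth_build.
    + apply C with g; [exact A|apply H].
    + intros d x y e Hs; rewrite (AD d x y e Hs).
      apply (has_D_agree d W e1 f g); auto; eapply smooth_has_D; eassumption.
    + intros d; apply IH with (pd d g); auto; apply smooth_D; exact H.
Qed.

Lemma agree_D_minus d k W e1 f g : smooth (S k) W e1 f -> smooth (S k) W e1 g ->
  agree W e1 (pd d (fmin f g)) (fmin (pd d f) (pd d g)).
Proof.
  intros Hf Hg x y e Hs; pose proof (proj1 (proj2 Hs)) as He.
  apply D_unique; [exact He|]; apply has_D_minus; [exact He| |]; eapply smooth_has_D; eassumption.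
Qed.

(** Smoothness is given for the map and not for f; f is recovered as the first component minus x. *)
Lemma smooth_minus k : forall W e1 f g, open W -> smooth k W e1 f -> smooth k W e1 g ->
  smooth k W e1 (fmin f g).
Proof.
  assert (C : forall W e1 f g, continuous_on_slab W e1 f -> continuous_on_slab W e1 g ->
    continuous_on_slab W e1 (fmin f g)).
  { intros W e1 f g Hf Hg x y e Hs.
    apply filterlim_Rminus; [apply within_filter, locally_filter|exact (Hf x y e Hs)|exact (Hg x y e Hs)]. }
  induction k as [|k IH]; intros W e1 f g HW Hf Hg.
  - split; [apply C; [apply Hf|apply Hg]|exact I].
  - apply smooth_build.
    + apply C; [apply Hf|apply Hg].
    + intros d x y e Hs; rewrite (agree_D_minus d k W e1 f g Hf Hg x y e Hs).
      apply has_D_minus; [apply (proj1 (proj2 Hs))| |]; eapply smooth_has_D; eassumption.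
    + intros d; apply smooth_agree with (fmin (pd d f) (pd d g)); [exact HW| |].
      * apply agree_D_minus with k; assumption.
      * apply IH; [exact HW| |]; apply smooth_D; assumption.
Qed.

Lemma smooth_iter_D d m k W e1 f : smooth (m + k) W e1 f -> smooth k W e1 (Nat.iter m (pd d) f).
Proof.
  revert k; induction m as [|m IH]; intros k H; [exact H|].
  apply smooth_D, IH; replace (m + S k)%nat with (S m + k)%nat by lia; exact H.
Qed.

Lemma agree_iter_D_minus d m k W e1 u f g : open W ->
  smooth (m + k) W e1 f -> smooth (m + k) W e1 g -> agree W e1 u (fmin f g) ->
  agree W e1 (Nat.iter m (pd d) u) (fmin (Nat.iter m (pd d) f) (Nat.iter m (pd d) g)).
Proof.
  intros HW; revert k; induction m as [|m IH]; intros k Hf Hg A; [exact A|].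
  replace (S m + k)%nat with (m + S k)%nat in Hf, Hg by lia.
  pose proof (smooth_iter_D d m (S k) W e1 f Hf) as If.
  pose proof (smooth_iter_D d m (S k) W e1 g Hg) as Ig.
  intros x y e Hs; simpl.
  rewrite <- (agree_D_minus d k W e1 _ _ If Ig x y e Hs).
  apply (agree_D_smooth d k W e1 _ _ HW (IH (S k) Hf Hg A)); [|exact Hs].
  apply smooth_minus; assumption.
Qed.

Lemma partial0_minus i j k r W e1 u f g : open W -> W (0, 0) -> 0 < e1 -> (i + j + k <= r)%nat ->
  smooth r W e1 f -> smooth r W e1 g -> agree W e1 u (fmin f g) ->
  partial0 i j k u = partial0 i j k f - partial0 i j k g.
Proof.
  intros HW H0 He Hr Hf Hg A.
  replace r with (k + (j + (i + (r - i - j - k))))%nat in Hf, Hg by lia.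
  pose proof (agree_iter_D_minus dE k _ W e1 u f g HW Hf Hg A) as A1.
  apply (smooth_iter_D dE) in Hf; apply (smooth_iter_D dE) in Hg.
  pose proof (agree_iter_D_minus dY j _ W e1 _ _ _ HW Hf Hg A1) as A2.
  apply (smooth_iter_D dY) in Hf; apply (smooth_iter_D dY) in Hg.
  pose proof (agree_iter_D_minus dX i _ W e1 _ _ _ HW Hf Hg A2) as A3.
  apply A3; split; [exact H0|simpl; lra].
Qed.

Lemma iter_slice0 d m (f g : R -> R -> R -> R) : d <> dE ->
  (forall x y, f x y 0 = g x y 0) ->
  forall x y, Nat.iter m (pd d) f x y 0 = Nat.iter m (pd d) g x y 0.
Proof.
  intros Hd H; induction m as [|m IH]; [exact H|]; intros x y.
  destruct d; simpl; [| |tauto]; unfold Dx, Dy; apply Derive_ext; intros t; apply IH.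
Qed.

Lemma partial0_slice0 i j f g : (forall x y, f x y 0 = g x y 0) ->
  partial0 i j 0 f = partial0 i j 0 g.
Proof.
  intros H; apply (iter_slice0 dX); [discriminate|].
  apply (iter_slice0 dY); [discriminate|exact H].
Qed.

Lemma sum3_slice0 c c' l x y : (forall i j, (i + j <= l)%nat -> c i j 0%nat = c' i j 0%nat) ->
  sum3 c l x y 0 = sum3 c' l x y 0.
Proof.
  intros H; unfold sum3; apply sum_n_congr; intros n Hn.
  apply sum_n_congr; intros i Hi; apply sum_n_congr; intros j Hj.
  destruct (n - i - j)%nat eqn:E.
  - rewrite H by lia; reflexivity.
  - rewrite pow_i by lia; ring.
Qed.

Lemma jet_slice0_ext l f g x y :
  (forall i j, (i + j <= l)%nat -> partial0 i j 0 f = partial0 i j 0 g) ->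
  jet l f x y 0 = jet l g x y 0.
Proof.
  intros H; rewrite !jet_sum3; apply sum3_slice0; intros i j Hl; rewrite H by exact Hl; reflexivity.
Qed.

Lemma jet_X l : (1 <= l)%nat -> jet l X = X.
Proof.
  intros H; destruct l; [lia|]; rewrite <- ev_PX, jet_ev; reflexivity.
Qed.

Lemma jet_Y l : (1 <= l)%nat -> jet l Y = Y.
Proof.
  intros H; destruct l; [lia|]; rewrite <- ev_PY, jet_ev; reflexivity.
Qed.

Lemma jet_minus l u f g x y e :
  (forall i j k, (i + j + k <= l)%nat -> partial0 i j k u = partial0 i j k f - partial0 i j k g) ->
  jet l u x y e = jet l f x y e - jet l g x y e.
Proof.
  intros H; rewrite !jet_sum3.
  assert (E : sum3 (fun i j k => partial0 i j k f / fact3 i j k) l x y e =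
    sum3 (fun i j k => partial0 i j k u / fact3 i j k) l x y e +
    sum3 (fun i j k => partial0 i j k g / fact3 i j k) l x y e).
  { unfold sum3; rewrite <- sum_n_add; apply sum_n_congr; intros n Hn.
    rewrite <- sum_n_add; apply sum_n_congr; intros i Hi.
    rewrite <- sum_n_add; apply sum_n_congr; intros j Hj.
    rewrite H by lia; unfold Rdiv; ring. }
  rewrite E; ring.
Qed.

Lemma ball_near (a b : R) (d : posreal) : Rabs (b - a) < d -> ball (a : R_UniformSpace) d b.
Proof. intros H; exact H. Qed.

Lemma continuity_2d_slice W e1 f : W (0, 0) -> open W -> 0 < e1 -> continuous_on_slab W e1 f ->
  continuity_2d_pt (fun u v => f u v 0) 0 0.
Proof.
  intros H0 HW He H eps.
  assert (Hs : slab W e1 (0, 0, 0)) by (split; [exact H0|simpl; lra]).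
  destruct (H 0 0 0 Hs (fun z => Rabs (z - f 0 0 0) < eps)) as [d Hd].
  { exists eps; intros z Hz; exact Hz. }
  destruct (HW _ H0) as [d' Hd'].
  assert (Hm : 0 < Rmin d d') by (apply Rmin_pos; apply cond_pos).
  exists (mkposreal _ Hm); intros u v Hu Hv; simpl in Hu, Hv.
  pose proof (Rmin_l d d'); pose proof (Rmin_r d d').
  apply (Hd (u, v, 0)).
  - split; [split|]; simpl; [apply ball_near; lra|apply ball_near; lra|apply ball_center].
  - split; simpl; [|lra].
    apply Hd'; split; simpl; apply ball_near; lra.
Qed.

(** [partial0] always applies [Dx] after [Dy], whereas the transcritical and pitchfork conditions
    also contain the opposite order. Schwarz's theorem reconciles them. *)
Lemma mixed_partials e1 f k : 0 < e1 -> smooth (S (S k)) plane e1 f ->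
  Dy (Dx f) 0 0 0 = Dx (Dy f) 0 0 0.
Proof.
  intros He H.
  assert (Hs : forall x y, slab plane e1 (x, y, 0)) by (intros; split; simpl; [exact I|lra]).
  pose proof (smooth_D dX _ _ _ _ H) as Hx; pose proof (smooth_D dY _ _ _ _ H) as Hy.
  symmetry; apply (Schwarz (fun u v => f u v 0) 0 0).
  - apply locally_2d_forall; intros u v.
    pose proof (proj1 (proj2 H) u v 0 (Hs u v)) as (A1 & A2 & _).
    pose proof (proj1 (proj2 Hx) u v 0 (Hs u v)) as (_ & A3 & _).
    pose proof (proj1 (proj2 Hy) u v 0 (Hs u v)) as (A4 & _ & _).
    repeat split; assumption.
  - apply (continuity_2d_slice plane e1 (Dx (Dy f)) I open_plane He).
    apply (smooth_continuous k), (smooth_D dX k), Hy.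
  - apply (continuity_2d_slice plane e1 (Dy (Dx f)) I open_plane He).
    apply (smooth_continuous k), (smooth_D dY k), Hx.
Qed.

(** Continuity of g is enough: along the eps-axis the difference quotient is g itself. *)
Lemma De_eps_mult e1 g : 0 < e1 -> continuous_on_slab plane e1 g ->
  De (fun x y e => y + e * g x y e) 0 0 0 = g 0 0 0.
Proof.
  intros He Hg; apply De_unique; [lra|]; intros P HP.
  assert (Hs : slab plane e1 (0, 0, 0)) by (split; simpl; [exact I|lra]).
  destruct (Hg 0 0 0 Hs P HP) as [d Hd].
  assert (Hm : 0 < Rmin d e1) by (apply Rmin_pos; [apply cond_pos|exact He]).
  exists (mkposreal _ Hm); intros h Hh Hn Hp.
  pose proof (Rmin_l d e1); pose proof (Rmin_r d e1).
  assert (Hh' : Rabs (h - 0) < Rmin d e1) by exact Hh.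
  rewrite Rminus_0_r in Hh'; rewrite Rplus_0_l in Hp; rewrite Rabs_pos_eq in Hh' by exact Hp.
  unfold eps_quotient.
  replace ((0 + (0 + h) * g 0 0 (0 + h) - (0 + 0 * g 0 0 0)) / h) with (g 0 0 h)
    by (rewrite !Rplus_0_l; field; exact Hn).
  apply (Hd (0, 0, h)).
  - split; [apply ball_center|]; simpl; apply ball_near; rewrite Rminus_0_r, Rabs_pos_eq; lra.
  - split; simpl; [exact I|lra].
Qed.

Lemma coef_flat_map_seq i j k (Q : nat -> list mono) n :
  coef i j k (flat_map Q (seq 0 (S n))) = sum_n (fun m => coef i j k (Q m)) n.
Proof.
  induction n as [|n IH]; [rewrite sum_O; simpl; rewrite coef_app; simpl; ring|].
  rewrite seq_S, flat_map_app, coef_app, IH, sum_Sn; simpl; rewrite coef_app.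
  unfold plus; simpl; ring.
Qed.

Lemma coef_polyL i j k c r : (i + j + k <= r)%nat -> coef i j k (polyL c r) = c i j k.
Proof.
  intros Hr; unfold polyL; rewrite coef_flat_map_seq.
  transitivity (sum_n (fun n => sum_n (fun i' => sum_n (fun j' =>
    if exps i j k (Mono 0 i' j' (n - i' - j')) then c i' j' (n - i' - j')%nat else 0)
      (n - i')) n) r).
  { apply sum_n_congr; intros n _; unfold layer; rewrite coef_flat_map_seq.
    apply sum_n_congr; intros i' _; rewrite coef_flat_map_seq.
    apply sum_n_congr; intros j' _; cbn [coef mc]; unfold exps; cbn [mx my me]; apply Rplus_0_r. }
  unfold exps; cbn [mx my me].
  rewrite (sum_n_pick _ (i + j + k)).
  - destruct (Nat.leb_spec (i + j + k) r); [|lia].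
    rewrite (sum_n_pick _ i).
    + destruct (Nat.leb_spec i (i + j + k)); [|lia].
      rewrite (sum_n_pick _ j).
      * destruct (Nat.leb_spec j (i + j + k - i)); [|lia].
        replace (i + j + k - i - j)%nat with k by lia; rewrite !Nat.eqb_refl; reflexivity.
      * intros j' Hj; destruct (Nat.eqb_spec j' j); [lia|].
        rewrite Bool.andb_false_r; reflexivity.
    + intros i' Hi; apply sum_n_zero; intros j' _.
      destruct (Nat.eqb_spec i' i); [lia|reflexivity].
  - intros n Hn; apply sum_n_zero; intros i' Hi; apply sum_n_zero; intros j' Hj.
    destruct (Nat.eqb_spec i' i), (Nat.eqb_spec j' j), (Nat.eqb_spec (n - i' - j') k);
      simpl; try reflexivity; lia.
Qed.

Lemma partial0_jet i j k r f : (i + j + k <= r)%nat ->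
  partial0 i j k (jet r f) = partial0 i j k f.
Proof.
  intros Hr; rewrite <- ev_jetL, partial0_coef; unfold jetL.
  rewrite coef_polyL by exact Hr; field; apply fact3_neq_0.
Qed.

Lemma partial0_sum_ev i j k (Q : nat -> list mono) N :
  partial0 i j k (fun x y e => sum_n (fun n => ev (Q n) x y e) N)
  = sum_n (fun n => partial0 i j k (ev (Q n))) N.
Proof.
  replace (fun x y e => sum_n (fun n => ev (Q n) x y e) N)
    with (ev (flat_map Q (seq 0 (S N)))) by (fext; apply ev_flat_map_seq).
  rewrite partial0_coef, coef_flat_map_seq, sum_n_mul.
  apply sum_n_congr; intros n _; rewrite partial0_coef; reflexivity.
Qed.

Lemma partial0_Ow i j k n f : Ow n f -> (i + 2 * j + 3 * k < n)%nat -> partial0 i j k f = 0.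
Proof.
  intros (P & HP & ->) H; rewrite partial0_coef, (coef_wt i j k n P HP H); ring.
Qed.

Lemma Ow_smooth k W e1 n f : open W -> Ow n f -> smooth k W e1 f.
Proof. intros HW (P & _ & ->); apply smooth_ev; exact HW. Qed.

Lemma partial0_eq_Ow i j k n f g : Ow 0 f -> Ow 0 g -> Ow n (fmin f g) ->
  (i + 2 * j + 3 * k < n)%nat -> partial0 i j k f = partial0 i j k g.
Proof.
  intros Hf Hg Hd H; apply Rminus_diag_uniq.
  rewrite <- (partial0_minus i j k (i + j + k) plane 1 (fmin f g) f g open_plane I Rlt_0_1).
  - eapply partial0_Ow; eassumption.
  - lia.
  - eapply Ow_smooth; [apply open_plane|exact Hf].
  - eapply Ow_smooth; [apply open_plane|exact Hg].
  - intros x y e _; reflexivity.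
Qed.

Lemma Series_finite (a : nat -> R) N : (forall n, (N < n)%nat -> a n = 0) -> Series a = sum_n a N.
Proof.
  intros H; apply is_series_unique.
  apply (is_lim_seq_ext_loc (fun _ => sum_n a N) (sum_n a) (sum_n a N)); [|apply is_lim_seq_const].
  exists N; induction 1 as [|n Hn IH]; [reflexivity|].
  rewrite sum_Sn, <- IH, H by lia; symmetry; apply Rplus_0_r.
Qed.

(** The monomials 1 and x are the only ones of weight below 2; y already has weight 2, so a nonzero
    derivative in y is allowed, as a fold requires. *)
Lemma Ow_2_of_coef P : coef 0 0 0 P = 0 -> coef 1 0 0 P = 0 -> Ow 2 (ev P).
Proof.
  intros H0 H1; exists (filter (fun m => (2 <=? mwt m)%nat) P); split.
  - apply List.Forall_forall; intros m Hm; apply filter_In in Hm.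
    apply Nat.leb_le; apply Hm.
  - fext.
    assert (E : forall Q, ev Q x x0 x1 = coef 0 0 0 Q + coef 1 0 0 Q * x +
       ev (filter (fun m => (2 <=? mwt m)%nat) Q) x x0 x1).
    { clear; intros Q; induction Q as [|m Q IH]; [simpl; ring|].
      cbn [coef filter ev]; rewrite IH.
      destruct (Nat.leb_spec 2 (mwt m)) as [Hm|Hm]; cbn [ev]; unfold exps; unfold mwt in Hm.
      - destruct (Nat.eqb_spec (mx m) 0), (Nat.eqb_spec (mx m) 1),
          (Nat.eqb_spec (my m) 0), (Nat.eqb_spec (me m) 0); simpl; try ring; lia.
      - unfold mev; destruct m as [c i j k]; simpl in *.
        replace j with 0%nat by lia; replace k with 0%nat by lia.
        destruct i as [|[|i]]; [simpl; ring|simpl; ring|lia]. }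
    rewrite E, H0, H1; ring.
Qed.

Lemma Ow_at_0 n f : (1 <= n)%nat -> Ow n f -> f 0 0 0 = 0.
Proof. intros H Hf; apply (partial0_Ow 0 0 0 n f Hf); lia. Qed.

Lemma Ow_lipschitz f : Ow 0 f -> exists C, 0 <= C /\ forall x y e x' y' e',
  box 1 x y e -> box 1 x' y' e' ->
  Rabs (f x y e - f x' y' e') <= C * (Rabs (x - x') + Rabs (y - y') + Rabs (e - e')).
Proof.
  intros (P & _ & ->).
  destruct (ser_lip3 1 (single P) Rlt_0_1 (good_single 1 P Rlt_0_1)) as (C & HC & L).
  rewrite ser_single in L; exists C; split; assumption.
Qed.

Lemma jet_eps_mult r b : Ow 0 b -> (1 <= r)%nat ->
  jet r (fld2 b) = fun x y e => e * jet (r - 1) b x y e.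
Proof.
  intros (P & _ & ->) Hr.
  set (sh := fun m => Mono (mc m) (mx m) (my m) (S (me m))).
  assert (E : forall Q x y e, ev (map sh Q) x y e = e * ev Q x y e).
  { intros Q x y e; induction Q as [|m Q IH]; simpl; [ring|].
    rewrite IH; unfold mev, sh; simpl; ring. }
  replace (fld2 (ev P)) with (ev (map sh P)) by (fext; apply E).
  rewrite !jet_ev; fext; rewrite <- E; f_equal.
  clear E; induction P as [|m P IH]; simpl; [reflexivity|].
  rewrite IH.
  destruct (Nat.leb_spec (mx m + my m + S (me m)) r), (Nat.leb_spec (mx m + my m + me m) (r - 1));
    try lia; reflexivity.
Qed.

Lemma Ow_jet l n f : Ow n f -> Ow 0 (jet l f).
Proof.
  intros _; exists (jetL l f); split; [|symmetry; apply ev_jetL].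
  apply wt_0.
Qed.

(** * Low-order derivatives at the origin of a product with a factor of value 1 *)

Section ProductAtZero.
Variables F q : R -> R -> R -> R.
Hypotheses (HF : Ow 0 F) (Hq : Ow 0 q).
Hypotheses (F0 : F 0 0 0 = 0) (Fx0 : Dx F 0 0 0 = 0) (q0 : q 0 0 0 = 1).

Let G : R -> R -> R -> R := fun x y e => F x y e * q x y e.

Lemma Ow0_Dx f : Ow 0 f -> Ow 0 (Dx f).
Proof. apply Ow_Dx; lia. Qed.

Lemma Ow0_Dy f : Ow 0 f -> Ow 0 (Dy f).
Proof. apply Ow_Dy; lia. Qed.

Lemma Ow0_mult f g : Ow 0 f -> Ow 0 g -> Ow 0 (fun x y e => f x y e * g x y e).
Proof. apply Ow_mult; lia. Qed.

Local Hint Resolve Ow0_Dx Ow0_Dy Ow0_mult Ow_plus : ow.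

Lemma Dx_product : Dx G = fun x y e => Dx F x y e * q x y e + F x y e * Dx q x y e.
Proof. apply Dx_mult; auto with ow. Qed.

Lemma Dy_product : Dy G = fun x y e => Dy F x y e * q x y e + F x y e * Dy q x y e.
Proof. apply Dy_mult; auto with ow. Qed.

Lemma Dxx_product : Dx (Dx G) = fun x y e =>
  (Dx (Dx F) x y e * q x y e + Dx F x y e * Dx q x y e) +
  (Dx F x y e * Dx q x y e + F x y e * Dx (Dx q) x y e).
Proof.
  rewrite Dx_product, (Dx_plus (fun x y e => Dx F x y e * q x y e)) by auto with ow.
  rewrite !Dx_mult by auto with ow; reflexivity.
Qed.

Lemma product_at_0 : G 0 0 0 = 0 /\ Dx G 0 0 0 = 0 /\ Dy G 0 0 0 = Dy F 0 0 0 /\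
  Dx (Dx G) 0 0 0 = Dx (Dx F) 0 0 0.
Proof.
  rewrite Dxx_product, Dx_product, Dy_product; unfold G.
  rewrite F0, Fx0, q0; repeat split; ring.
Qed.

(** The cross terms with first derivatives of q disappear only when both first derivatives of F
    vanish; this holds at transcritical and pitchfork points. *)
Lemma product_second_at_0 : Dy F 0 0 0 = 0 ->
  Dx (Dy G) 0 0 0 = Dx (Dy F) 0 0 0 /\ Dy (Dy G) 0 0 0 = Dy (Dy F) 0 0 0.
Proof.
  intros Fy0; rewrite Dy_product.
  rewrite (Dx_plus (fun x y e => Dy F x y e * q x y e)) by auto with ow.
  rewrite (Dy_plus (fun x y e => Dy F x y e * q x y e)) by auto with ow.
  rewrite !Dx_mult, !Dy_mult by auto with ow.
  rewrite F0, Fx0, Fy0, q0; split; ring.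
Qed.

(** The term 3 Fxx qx of the Leibniz expansion has to vanish, which is the degeneracy of a
    pitchfork. *)
Lemma product_third_at_0 : Dx (Dx F) 0 0 0 = 0 ->
  Dx (Dx (Dx G)) 0 0 0 = Dx (Dx (Dx F)) 0 0 0.
Proof.
  intros Fxx0; rewrite Dxx_product.
  rewrite (Dx_plus (fun x y e => Dx (Dx F) x y e * q x y e + Dx F x y e * Dx q x y e)
    (fun x y e => Dx F x y e * Dx q x y e + F x y e * Dx (Dx q) x y e)) by auto with ow.
  rewrite (Dx_plus (fun x y e => Dx (Dx F) x y e * q x y e)) by auto with ow.
  rewrite (Dx_plus (fun x y e => Dx F x y e * Dx q x y e)) by auto with ow.
  rewrite !Dx_mult by auto 7 with ow.
  rewrite F0, Fx0, Fxx0, q0; ring.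
Qed.

End ProductAtZero.

(** * The prepared field *)

(** The components have weights 2 and 3, one above the weights 1 and 2 of the radii they are divided
    by; hence the factor s. *)
Lemma speed_le P1 P2 s : wt 2 P1 -> wt 3 P2 -> 0 < s <= 1 ->
  speed P1 P2 s <= s * (nrm 1 P1 + nrm 1 P2).
Proof.
  intros H1 H2 Hs; unfold speed.
  pose proof (nrm_wt s 2 P1 ltac:(lra) H1) as T1; pose proof (nrm_wt s 3 P2 ltac:(lra) H2) as T2.
  rewrite Rmult_plus_distr_l; apply Rplus_le_compat.
  - apply Rmult_le_reg_l with s; [lra|].
    replace (s * (nrm s P1 / s)) with (nrm s P1) by (field; lra); simpl in T1; nra.
  - pose proof (pow_lt s 2 (proj1 Hs)); apply Rmult_le_reg_l with (s ^ 2); [assumption|].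
    replace (s ^ 2 * (nrm s P2 / s ^ 2)) with (nrm s P2) by (field; lra).
    replace (s ^ 2 * (s * nrm 1 P2)) with (s ^ 3 * nrm 1 P2) by ring; exact T2.
Qed.

(** The n-th term of the series vanishes to weight n, so at weights up to N + 2 the infinite series
    and the truncated exponential have the same derivatives. *)
Lemma partial0_lie_series i j k P1 P2 Z W e0 f N : wt 2 P1 -> wt 3 P2 ->
  open W -> W (0, 0) -> 0 < e0 -> covered W e0 (lieT P1 P2 Z) ->
  agree W e0 f (ser (lieT P1 P2 Z)) -> (i + 2 * j + 3 * k <= N + 2)%nat ->
  partial0 i j k f = partial0 i j k (lie_exp N (ev P1) (ev P2) (ev Z)).
Proof.
  intros H1 H2 HW H0 He HC HA HN.
  rewrite (partial0_ser i j k W e0 f _ HW H0 He HC HA), (Series_finite _ (S (S N))).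
  - replace (lie_exp N (ev P1) (ev P2) (ev Z))
      with (fun x y e => sum_n (fun n => ev (lieT P1 P2 Z n) x y e) (S (S N))).
    + rewrite partial0_sum_ev; apply sum_n_congr; intros n _; symmetry; apply partial0_ev.
    + fext; apply sum_n_congr; intros n _; apply ev_lieT.
  - intros n Hn; rewrite <- partial0_ev; apply partial0_Ow with n; [|lia].
    replace (ev (lieT P1 P2 Z n))
      with (fun x y e => / INR (fact n) * Nat.iter n (lie (ev P1) (ev P2)) (ev Z) x y e).
    + apply Ow_scal, (iter_lie_O n 0); [exists P1; auto|exists P2; auto|].
      exists Z; split; [apply wt_0|reflexivity].
    + fext; rewrite ev_lieT; unfold lc, Rdiv; ring.
Qed.

Definition polydisc (s : R) (p : R * R) : Prop := Rabs (fst p) < s /\ Rabs (snd p) < s ^ 2.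

Lemma open_polydisc s : open (polydisc s).
Proof.
  apply (open_and (fun p : R * R => Rabs (fst p) < s) (fun p : R * R => Rabs (snd p) < s ^ 2)).
  - apply (open_comp (fun p : R * R => Rabs (fst p)) (fun z => z < s)); [|apply open_lt].
    intros p _; apply continuous_comp; [apply continuous_fst|apply continuous_Rabs].
  - apply (open_comp (fun p : R * R => Rabs (snd p)) (fun z => z < s ^ 2)); [|apply open_lt].
    intros p _; apply continuous_comp; [apply continuous_snd|apply continuous_Rabs].
Qed.

Lemma polydisc_open_box s e0 x y e : e0 <= s ^ 3 -> slab (polydisc s) e0 (x, y, e) ->
  open_box s x y e.
Proof.
  intros He [[Hx Hy] He']; simpl in Hx, Hy, He'; repeat split; try assumption.
  rewrite Rabs_pos_eq; lra.
Qed.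

Lemma box_le s t x y e : 0 < s <= t -> open_box s x y e -> box t x y e.
Proof.
  intros H (Hx & Hy & He).
  assert (s ^ 2 <= t ^ 2) by (apply pow_incr; lra).
  assert (s ^ 3 <= t ^ 3) by (apply pow_incr; lra).
  repeat split; lra.
Qed.

Section Prepared.

Variables (r : nat) (f g : R -> R -> R -> R) (e1 : R).
Hypotheses (hr : (3 <= r)%nat) (he1 : 0 < e1).
Hypothesis hH : smooth2 r plane e1 (fast_slow_map f g).
Hypothesis hg : smooth 0 plane e1 g.
Hypotheses (f0 : f 0 0 0 = 0) (fx0 : Dx f 0 0 0 = 0).

Let H1 := comp1 (fast_slow_map f g).
Let H2 := comp2 (fast_slow_map f g).

(** Made constant in eps, so that the whole eps-dependence of the jet sits in [jetA]. *)
Definition jetF : R -> R -> R -> R := fun x y _ => jet r f x y 0.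
Definition jetA : R -> R -> R -> R := ev (divE (jetL r H1)).
Definition jetB : R -> R -> R -> R := ev (divE (jetL r H2)).

Lemma f_as_difference : f = fmin H1 X.
Proof. fext; unfold fmin, H1, comp1, fast_slow_map, X; simpl; ring. Qed.

Lemma X_smooth k : smooth k plane e1 X.
Proof. rewrite <- ev_PX; apply smooth_ev, open_plane. Qed.

Lemma f_smooth : smooth r plane e1 f.
Proof.
  rewrite f_as_difference; apply smooth_minus;
    [apply open_plane|apply hH|apply X_smooth].
Qed.

Lemma jet_map1 : jet r H1 = fun x y e => x + jetF x y e + e * jetA x y e.
Proof.
  fext; rewrite <- ev_jetL, ev_divE, ev_jetL.
  assert (E : jet r f x x0 0 = jet r H1 x x0 0 - jet r X x x0 0).
  { apply jet_minus; intros i j k Hl.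
    apply (partial0_minus i j k r plane e1); auto using open_plane, X_smooth; [exact I|apply hH|].
    intros a b c _; rewrite f_as_difference; reflexivity. }
  rewrite jet_X in E by lia; unfold jetF, jetA; rewrite E; unfold X; ring.
Qed.

Lemma jet_map2 : jet r H2 = fun x y e => y + e * jetB x y e.
Proof.
  fext; rewrite <- ev_jetL, ev_divE, ev_jetL.
  rewrite (jet_slice0_ext r H2 Y).
  - rewrite jet_Y by lia; reflexivity.
  - intros i j _; apply partial0_slice0; intros a b.
    unfold H2, comp2, fast_slow_map, Y; simpl; ring.
Qed.

Lemma jetF_Ow0 : Ow 0 jetF.
Proof.
  exists (slice0 (jetL r f)); split; [apply wt_0|].
  fext; rewrite ev_slice0, ev_jetL; reflexivity.
Qed.

Lemma partial0_jetF i j : (i + j <= r)%nat -> partial0 i j 0 jetF = partial0 i j 0 f.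
Proof.
  intros H; rewrite <- (partial0_jet i j 0 r f) by lia; apply partial0_slice0; reflexivity.
Qed.

(** Unipotency enters here: f and its x-derivative vanish at the origin, which removes precisely the
    monomials of weight below 2. *)
Lemma jetF_Ow2 : Ow 2 jetF.
Proof.
  pose proof (partial0_jetF 0 0 ltac:(lia)) as E0; pose proof (partial0_jetF 1 0 ltac:(lia)) as E1.
  change (partial0 0 0 0 f) with (f 0 0 0) in E0; change (partial0 1 0 0 f) with (Dx f 0 0 0) in E1.
  rewrite f0 in E0; rewrite fx0 in E1.
  destruct jetF_Ow0 as (P & _ & E); rewrite E in E0, E1 |- *.
  rewrite partial0_coef in E0, E1.
  apply Ow_2_of_coef.
  - apply Rmult_eq_reg_l with (fact3 0 0 0); [rewrite E0; ring|apply fact3_neq_0].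
  - apply Rmult_eq_reg_l with (fact3 1 0 0); [rewrite E1; ring|apply fact3_neq_0].
Qed.

Lemma jetA_Ow : Ow 0 jetA.
Proof. eexists; split; [apply wt_0|reflexivity]. Qed.

Lemma jetB_Ow : Ow 0 jetB.
Proof. eexists; split; [apply wt_0|reflexivity]. Qed.

(** Both values are the eps-derivative at the origin of the second component, once of the map and
    once of its jet. *)
Lemma jetB_0 : jetB 0 0 0 = g 0 0 0.
Proof.
  rewrite <- (De_eps_mult e1 g he1 (smooth_continuous 0 _ _ _ hg)).
  rewrite <- (De_eps_mult e1 jetB he1).
  - rewrite <- jet_map2; apply (partial0_jet 0 0 1 r H2); lia.
  - apply (smooth_continuous 0), smooth_ev, open_plane.
Qed.

Lemma field_exists : exists q a b,
  Ow 0 q /\ Ow 0 a /\ Ow 0 b /\ q 0 0 0 = 1 /\ b 0 0 0 = g 0 0 0 /\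
  forall i j k, (i + j + k <= r)%nat ->
    partial0 i j k (lie_exp (3 * r) (fld1 jetF q a) (fld2 b) X) = partial0 i j k H1 /\
    partial0 i j k (lie_exp (3 * r) (fld1 jetF q a) (fld2 b) Y) = partial0 i j k H2.
Proof.
  (* Both the truncation order of the exponential and the precision are 3r, since i + j + k <= r
     implies i + 2j + 3k <= 3r. *)
  destruct (logarithm_exists jetF jetA jetB (3 * r) jetF_Ow2 jetA_Ow jetB_Ow (3 * r))
    as (q & a & b & Hq & Ha & Hb & Q1 & B1 & E1 & E2).
  exists q, a, b; repeat (split; [assumption|]).
  split; [apply Ow_at_0 in Q1; [lra|lia]|].
  split; [apply Ow_at_0 in B1; [rewrite jetB_0 in B1; lra|lia]|].
  rewrite <- jet_map1 in E1; rewrite <- jet_map2 in E2.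
  assert (OX : forall Z, Ow 0 Z -> Ow 0 (lie_exp (3 * r) (fld1 jetF q a) (fld2 b) Z)).
  { intros Z HZ; apply (Ow_sum 0 (S (S (3 * r))) (fun k x y e =>
      Nat.iter k (lie (fld1 jetF q a) (fld2 b)) Z x y e / INR (fact k))).
    intros k; replace (fun x y e => Nat.iter k (lie (fld1 jetF q a) (fld2 b)) Z x y e / INR (fact k))
      with (fun x y e => / INR (fact k) * Nat.iter k (lie (fld1 jetF q a) (fld2 b)) Z x y e)
      by (fext; unfold Rdiv; ring).
    apply Ow_scal, Ow_le with (0 + k)%nat; [lia|].
    apply iter_lie_O; [apply (fld1_O jetF jetF_Ow2 0)|apply (fld2_O 0)|]; assumption. }
  intros i j k Hl; split.
  - rewrite <- (partial0_jet i j k r H1) by exact Hl.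
    apply (partial0_eq_Ow i j k (3 * r + 2)); [apply OX, (Ow_0 1), Ow_x| |exact E1|lia].
    eexists; split; [|symmetry; apply ev_jetL]; apply wt_0.
  - rewrite <- (partial0_jet i j k r H2) by exact Hl.
    apply (partial0_eq_Ow i j k (3 * r + 2)); [apply OX, (Ow_0 2), Ow_y| |exact E2|lia].
    eexists; split; [|symmetry; apply ev_jetL]; apply wt_0.
Qed.

End Prepared.

(** * Transfer of the singularity type from the map to the truncated field *)

Lemma jet_product_eps r w1 F q a : w1 = fld1 F q a ->
  forall i j, (i + j <= r)%nat ->
  partial0 i j 0 (jet r w1) = partial0 i j 0 (fun x y e => F x y e * q x y e).
Proof.
  intros -> i j H; rewrite partial0_jet by lia; apply partial0_slice0.
  intros x y; unfold fld1; ring.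
Qed.

Section Classification.

Variables (r : nat) (f g q a v2 : R -> R -> R -> R) (e1 : R).
Hypotheses (hr : (3 <= r)%nat) (he1 : 0 < e1).
Hypotheses (hf : smooth r plane e1 f) (f0 : f 0 0 0 = 0) (fx0 : Dx f 0 0 0 = 0).
Hypotheses (hq : Ow 0 q) (q0 : q 0 0 0 = 1) (hv2 : v2 0 0 0 = g 0 0 0).

Let F := jetF r f.
Let w1 := fld1 F q a.
Let v1 := jet r w1.

Lemma partials_F i j : (i + j <= r)%nat -> partial0 i j 0 F = partial0 i j 0 f.
Proof. intros H; apply partial0_jetF; assumption. Qed.

Lemma F_at_0 : F 0 0 0 = 0.
Proof. etransitivity; [apply (partials_F 0 0); lia|exact f0]. Qed.

Lemma Fx_at_0 : Dx F 0 0 0 = 0.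
Proof. etransitivity; [apply (partials_F 1 0); lia|exact fx0]. Qed.

Lemma partials_v1 i j : (i + j <= r)%nat ->
  partial0 i j 0 v1 = partial0 i j 0 (fun x y e => F x y e * q x y e).
Proof. apply jet_product_eps with a; reflexivity. Qed.

Lemma first_partials_v1 : v1 0 0 0 = 0 /\ Dx v1 0 0 0 = 0 /\
  Dy v1 0 0 0 = Dy f 0 0 0 /\ Dx (Dx v1) 0 0 0 = Dx (Dx f) 0 0 0.
Proof.
  destruct (product_at_0 F q (jetF_Ow0 r f) hq F_at_0 Fx_at_0 q0) as (P1 & P2 & P3 & P4).
  repeat split.
  - etransitivity; [apply (partials_v1 0 0); lia|exact P1].
  - etransitivity; [apply (partials_v1 1 0); lia|exact P2].
  - etransitivity; [apply (partials_v1 0 1); lia|].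
    etransitivity; [exact P3|apply (partials_F 0 1); lia].
  - etransitivity; [apply (partials_v1 2 0); lia|].
    etransitivity; [exact P4|apply (partials_F 2 0); lia].
Qed.

Lemma mixed_v1 : Dy (Dx v1) 0 0 0 = Dx (Dy v1) 0 0 0.
Proof.
  apply (mixed_partials 1 v1 0 Rlt_0_1); unfold v1; rewrite <- ev_jetL.
  apply smooth_ev, open_plane.
Qed.

Lemma mixed_f : Dy (Dx f) 0 0 0 = Dx (Dy f) 0 0 0.
Proof.
  apply (mixed_partials e1 f (r - 2) he1); replace (S (S (r - 2))) with r by lia; exact hf.
Qed.

Lemma second_partials_v1 : Dy f 0 0 0 = 0 ->
  Dx (Dy v1) 0 0 0 = Dx (Dy f) 0 0 0 /\ Dy (Dy v1) 0 0 0 = Dy (Dy f) 0 0 0.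
Proof.
  intros fy0.
  assert (Fy0 : Dy F 0 0 0 = 0) by (etransitivity; [apply (partials_F 0 1); lia|exact fy0]).
  destruct (product_second_at_0 F q (jetF_Ow0 r f) hq F_at_0 Fx_at_0 q0 Fy0) as (P1 & P2).
  split.
  - etransitivity; [apply (partials_v1 1 1); lia|].
    etransitivity; [exact P1|apply (partials_F 1 1); lia].
  - etransitivity; [apply (partials_v1 0 2); lia|].
    etransitivity; [exact P2|apply (partials_F 0 2); lia].
Qed.

Lemma third_partial_v1 : Dx (Dx f) 0 0 0 = 0 -> Dx (Dx (Dx v1)) 0 0 0 = Dx (Dx (Dx f)) 0 0 0.
Proof.
  intros fxx0.
  assert (Fxx0 : Dx (Dx F) 0 0 0 = 0) by (etransitivity; [apply (partials_F 2 0); lia|exact fxx0]).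
  etransitivity; [apply (partials_v1 3 0); lia|].
  etransitivity; [apply (product_third_at_0 F q); auto using F_at_0, Fx_at_0; apply jetF_Ow0|].
  apply (partials_F 3 0); lia.
Qed.

(** Every condition involves only eps-free derivatives of order at most 3, which the r-jet retains
    because r >= 3. At eps = 0 the field is F q with q = 1 at the origin, and each condition
    supplies the vanishing that makes the relevant derivatives of F q and f coincide. *)
Lemma classification :
  (regular_fold f g -> regular_fold v1 v2) /\
  (transcritical f g -> transcritical v1 v2) /\
  (pitchfork f g -> pitchfork v1 v2).
Proof.
  destruct first_partials_v1 as (V0 & Vx & Vy & Vxx).
  split; [|split].
  - intros (_ & _ & Hxx & Hy & Hg); unfold regular_fold.
    rewrite Vxx, Vy, hv2; repeat split; assumption.
  - intros (_ & _ & Hy & Hxx & Hdet & Hg); unfold transcritical.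
    destruct (second_partials_v1 Hy) as (Vxy & Vyy).
    rewrite mixed_v1, Vxx, Vy, Vxy, Vyy, hv2.
    rewrite mixed_f in Hdet; repeat split; assumption.
  - intros (_ & _ & Hy & Hxx & Hxxx & Hxy & Hg); unfold pitchfork.
    destruct (second_partials_v1 Hy) as (Vxy & _).
    rewrite mixed_v1, Vxx, Vy, Vxy, (third_partial_v1 Hxx), hv2.
    rewrite mixed_f in Hxy; repeat split; assumption.
Qed.

End Classification.

(** The first inequality will make the Lie series converge. The second will keep K nonzero on the
    polydisc, C being a Lipschitz constant of q and K(0,0) = 1. *)
Lemma radius_exists (A B C : R) : 0 <= A -> 0 <= B -> 0 <= C ->
  exists s, 0 < s <= 1 /\ A * (s * B) <= / 2 /\ C * (s + s ^ 2) < 1.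
Proof.
  intros HA HB HC.
  assert (HM : 0 <= A * B) by (apply Rmult_le_pos; assumption).
  (* With s = 1/T the sum s + 2sAB + 2sC equals 1: the factor 2 at AB produces the bound 1/2, and
     the one at C absorbs s + s^2 <= 2s. *)
  set (T := 1 + 2 * (A * B) + 2 * C).
  exists (/ T).
  assert (HT : 1 <= T) by (unfold T; lra).
  assert (Hs : 0 < / T) by (apply Rinv_0_lt_compat; lra).
  assert (E : / T * T = 1) by (field; lra).
  assert (Hs1 : / T <= 1) by (rewrite <- Rinv_1; apply Rinv_le_contravar; lra).
  set (s := / T) in *; clearbody s.
  assert (E' : s + 2 * (s * (A * B)) + 2 * (s * C) = 1) by (rewrite <- E; unfold T; ring).
  assert (0 <= s * (A * B)) by (apply Rmult_le_pos; lra).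
  assert (0 <= s * C) by (apply Rmult_le_pos; lra).
  split; [lra|split].
  - replace (A * (s * B)) with (s * (A * B)) by ring; lra.
  - assert (C * s ^ 2 <= s * C) by (simpl; nra).
    rewrite Rmult_plus_distr_l; lra.
Qed.

(** * Assembly of the neighbourhood, the field and its flow *)

Theorem proposition4p5 (r : nat) (f g : R -> R -> R -> R) (e1 : R)
  (hr : (3 <= r)%nat) (he1 : 0 < e1)
  (hH : smooth2 r plane e1 (fast_slow_map f g))
  (hg : smooth 0 plane e1 g)
  (hH0 : fast_slow_map f g 0 0 0 = (0, 0))
  (hS : unipotent_singularity plane f (0, 0)) :
  exists (U : R * R -> Prop) (e0 : R)
         (V : R -> R -> R -> R * R) (Phi : R -> R -> R -> R -> R * R),
    open U /\ U (0, 0) /\ 0 < e0 <= e1 /\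
    (* V is an eps-family of C^r vector fields on the plane, with time-1 map Phi 1 *)
    smooth2 r plane e0 V /\ is_flow U e0 V Phi /\ smooth2 r U e0 (Phi 1) /\
    (forall l : nat, (1 <= l <= r)%nat ->
       forall x y e : R, slab U e0 (x, y, e) ->
         jet2 l (fast_slow_map f g) x y e = jet2 l (Phi 1) x y e) /\
    exists K : R -> R -> R,
      smooth r U e0 (fun x y _ => K x y) /\ K 0 0 = 1 /\
      (* the field V itself: exact factorization and critical manifold j^r S *)
      (exists w1 w2 : R -> R -> R -> R,
         (forall x y e : R, slab U e0 (x, y, e) ->
            V x y e = fast_slow_field w1 w2 x y e) /\
         leading_form U e0 (fun x y => K x y * jet r f x y 0) (g 0 0 0) w1 w2 /\
         (forall p : R * R,
            critical_manifold U w1 p <-> critical_manifold U (jet r f) p) /\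
         nilpotent_singularity U w1 (0, 0)) /\
      (* the truncated field j^r V *)
      (exists v1 v2 : R -> R -> R -> R,
         (forall x y e : R, slab U e0 (x, y, e) ->
            jet2 r V x y e = fast_slow_field v1 v2 x y e) /\
         leading_form U e0
           (fun x y => jet r (fun a b _ => K a b * jet r f a b 0) x y 0)
           (g 0 0 0) v1 v2 /\
         critical_manifold U (jet r f) (0, 0) /\
         nilpotent_singularity U v1 (0, 0) /\
         (regular_fold f g -> regular_fold v1 v2) /\
         (transcritical f g -> transcritical v1 v2) /\
         (pitchfork f g -> pitchfork v1 v2)).
Proof.
  destruct hS as [[_ f0] fx0]; simpl in f0, fx0.
  destruct (field_exists r f g e1 hr he1 hH hg f0 fx0) as (q & a & b & Hq & Ha & Hb & q0 & b0 & HP).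
  pose proof (jetF_Ow2 r f hr f0 fx0) as HF.
  pose proof (f_smooth r f g e1 hH) as hf.
  set (F := jetF r f) in *; set (w1 := fld1 F q a) in *; set (w2 := fld2 b) in *.
  assert (O1 : Ow 2 w1) by (apply (fld1_O F HF 0); assumption).
  assert (O2 : Ow 3 w2) by (apply (fld2_O 0); assumption).
  assert (Ob : Ow 0 (jet (r - 1) b)) by (apply Ow_jet with 0%nat; exact Hb).
  assert (Oj : Ow 0 (jet r w1)) by (apply Ow_jet with 2%nat; exact O1).
  (* Only the constant of q influences the radius. The other four provide the O-constants on the
     unit box, which contains the final slab. *)
  destruct (Ow_lipschitz q Hq) as (Cq & Cq0 & Lq).
  destruct (Ow_lipschitz w1 (Ow_0 _ _ O1)) as (Cw & Cw0 & Lw).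
  destruct (Ow_lipschitz b Hb) as (Cb & Cb0 & Lb).
  destruct (Ow_lipschitz _ Oj) as (Cj & Cj0 & Lj).
  destruct (Ow_lipschitz _ Ob) as (Cc & Cc0 & Lc).
  destruct O1 as (P1 & W1 & EP1); destruct O2 as (P2 & W2 & EP2).
  destruct (wdeg_ex P1) as (d1 & D1); destruct (wdeg_ex P2) as (d2 & D2).
  set (d := (d1 + d2)%nat).
  assert (D1' : wdeg d P1) by (eapply wdeg_le; [|exact D1]; unfold d; lia).
  assert (D2' : wdeg d P2) by (eapply wdeg_le; [|exact D2]; unfold d; lia).
  destruct (radius_exists (INR (2 + d)) (nrm 1 P1 + nrm 1 P2) Cq) as (s & Hs & Hslow & HK);
    [apply pos_INR|apply Rplus_le_le_0_compat; apply nrm_pos; lra|exact Cq0|].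
  assert (slow : INR (2 + d) * speed P1 P2 s <= / 2).
  { eapply Rle_trans; [|exact Hslow]; apply Rmult_le_compat_l; [apply pos_INR|].
    apply speed_le; assumption. }
  assert (s0 : 0 < s) by lra.
  assert (s3 : 0 < s ^ 3) by (apply pow_lt; lra).
  (* The bound s^3 keeps eps inside the weighted box; e1 keeps it in the domain of the given map. *)
  set (U := polydisc s); set (e0 := Rmin (s ^ 3) e1).
  assert (He0 : 0 < e0) by (apply Rmin_pos; assumption).
  assert (HU : open U) by apply open_polydisc.
  assert (HU0 : U (0, 0)).
  { split; simpl; rewrite Rabs_R0; nra. }
  assert (Box : forall x y e, slab U e0 (x, y, e) -> open_box s x y e).
  { intros x y e; apply polydisc_open_box, Rmin_l. }
  assert (Box1 : forall x y e, slab U e0 (x, y, e) -> box 1 x y e).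
  { intros x y e H; apply box_le with s; [lra|auto]. }
  assert (Box10 : forall x y e, slab U e0 (x, y, e) -> box 1 x y 0).
  { intros x y e H; destruct (Box1 x y e H) as (?&?&?).
    repeat split; try assumption; rewrite Rabs_R0; lra. }
  assert (Box0 : box 1 0 0 0) by (repeat split; rewrite Rabs_R0; lra).
  assert (He : forall x y e, slab U e0 (x, y, e) -> 0 <= e) by (intros x y e [_ H]; apply H).
  assert (w10 : forall x y, w1 x y 0 = q x y 0 * jet r f x y 0)
    by (intros; unfold w1, fld1, F, jetF; ring).
  assert (Cov : forall Z, wdeg 2 Z -> covered U e0 (lieT P1 P2 Z)).
  { intros Z HZ x y e H; exists s; split; [exact s0|split; [|auto]].
    apply (good_lieT P1 P2 d D1' D2' s s0 slow 2); [lia|exact HZ]. }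
  set (V := fun x y e => (w1 x y e, w2 x y e)).
  set (Phi := fun t x y e => (flow1 w1 w2 x y e t, flow2 w1 w2 x y e t)).
  assert (Ag1 : agree U e0 (comp1 (Phi 1)) (ser (lieT P1 P2 PX))).
  { intros x y e _; unfold comp1, Phi, flow1, PSeries, ser; simpl.
    apply Series_ext; intros n; rewrite pow1, Rmult_1_r, ev_lieT, ev_PX, EP1, EP2; reflexivity. }
  assert (Ag2 : agree U e0 (comp2 (Phi 1)) (ser (lieT P1 P2 PY))).
  { intros x y e _; unfold comp2, Phi, flow2, PSeries, ser; simpl.
    apply Series_ext; intros n; rewrite pow1, Rmult_1_r, ev_lieT, ev_PY, EP1, EP2; reflexivity. }
  exists U, e0, V, Phi.
  split; [exact HU|]. split; [exact HU0|]. split; [split; [exact He0|apply Rmin_r]|].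
  split.
  { split; [change (comp1 V) with w1; rewrite EP1|change (comp2 V) with w2; rewrite EP2];
      apply smooth_ev, open_plane. }
  split.
  { intros x y e H.
    destruct (lc_bounds P1 P2 d D1' D2' s s0 slow x y e (open_box_box _ _ _ _ (Box x y e H)))
      as (Bx & By).
    rewrite <- EP1, <- EP2 in Bx, By.
    split.
    - destruct (flow_start w1 w2 x y e) as [Ex Ey]; unfold Phi; rewrite Ex, Ey; reflexivity.
    - intros t Ht; simpl.
      apply (flow_derive w1 w2) with (nrm s PX + nrm s PY); try assumption.
      + rewrite EP1; exists P1; split; [apply wt_0|reflexivity].
      + rewrite EP2; exists P2; split; [apply wt_0|reflexivity].
      + rewrite Rabs_pos_eq; lra. }
  split.
  { split; [apply smooth_ser with (lieT P1 P2 PX)|apply smooth_ser with (lieT P1 P2 PY)];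
      auto using wdeg_PX, wdeg_PY. }
  split.
  { intros l Hl x y e _; unfold jet2; f_equal.
    - rewrite (jet_ext l _ (comp1 (Phi 1))); [reflexivity|]; intros i j k Hk.
      (* Passes from the flow to the exponential truncated at the order used when the field was
         built; the jets of the latter are known from [HP]. *)
      rewrite (partial0_lie_series i j k P1 P2 PX U e0 (comp1 (Phi 1)) (3 * r)); auto using wdeg_PX;
        [|lia].
      rewrite ev_PX, <- EP1, <- EP2; symmetry; apply HP; lia.
    - rewrite (jet_ext l _ (comp2 (Phi 1))); [reflexivity|]; intros i j k Hk.
      rewrite (partial0_lie_series i j k P1 P2 PY U e0 (comp2 (Phi 1)) (3 * r)); auto using wdeg_PY;
        [|lia].
      rewrite ev_PY, <- EP1, <- EP2; symmetry; apply HP; lia. }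
  (* The eps-dependent rest of q is multiplied by F and falls into the O(eps) term. *)
  exists (fun x y => q x y 0).
  split.
  { destruct Hq as (Pq & _ & Eq).
    replace (fun x y _ : R => q x y 0) with (ev (slice0 Pq)).
    - apply smooth_ev; exact HU.
    - fext; rewrite ev_slice0, Eq; reflexivity. }
  split; [exact q0|].
  destruct (first_partials_v1 r f q a hr f0 fx0 Hq q0) as (V0 & Vx & _).
  fold F in V0, Vx; fold w1 in V0, Vx.
  assert (J0 : forall l h, jet l h 0 0 0 = h 0 0 0) by (intros; apply (partial0_jet 0 0 0); lia).
  split.
  - exists w1, b; split; [reflexivity|split; [|split]].
    + exists (Cw + Cb); intros x y e H; pose proof (He x y e H) as Hpos.
      pose proof (Rabs_pos x); pose proof (Rabs_pos y).
      split.
      * rewrite <- w10.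
        eapply Rle_trans; [apply Lw; [eapply Box1; exact H|eapply Box10; exact H]|].
        rewrite !Rminus_diag, !Rabs_R0, Rminus_0_r, (Rabs_pos_eq e) by exact Hpos; nra.
      * rewrite <- b0.
        eapply Rle_trans; [apply Lb; [eapply Box1; exact H|exact Box0]|].
        rewrite !Rminus_0_r, (Rabs_pos_eq e) by exact Hpos; nra.
    + intros [x y]; unfold critical_manifold; simpl; rewrite w10.
      split; intros [Hp Hz]; split; try exact Hp.
      (* A zero of K in U would give 1 = |q(x,y,0) - q(0,0,0)| <= Cq (s + s^2) < 1, so the field has
         no equilibria at eps = 0 other than zeros of the jet of f. *)
      * destruct (Rmult_integral _ _ Hz) as [Hk|Hk]; [exfalso|exact Hk].
        assert (H : slab U e0 (x, y, 0)) by (split; [exact Hp|simpl; lra]).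
        pose proof (Lq x y 0 0 0 0 (Box1 _ _ _ H) Box0) as T.
        destruct Hp as [Hx Hy]; simpl in Hx, Hy.
        rewrite Hk, q0, !Rminus_0_r, Rminus_0_l, Rabs_R0, Rabs_Ropp, Rabs_R1 in T.
        pose proof (Rabs_pos x); pose proof (Rabs_pos y).
        assert (Cq * (Rabs x + Rabs y + 0) <= Cq * (s + s ^ 2))
          by (apply Rmult_le_compat_l; simpl; lra).
        lra.
      * rewrite Hz; ring.
    + split; [split; [exact HU0|]|]; simpl.
      * etransitivity; [symmetry; apply J0|exact V0].
      * etransitivity; [symmetry; apply (partial0_jet 1 0 0 r); lia|exact Vx].
  (* The factor eps uses up one degree, so the second component is truncated at r - 1. *)
  - exists (jet r w1), (jet (r - 1) b); split; [|split; [|split; [|split]]].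
    + intros x y e _; unfold jet2, fast_slow_field; f_equal.
      change (comp2 V) with (fld2 b); rewrite jet_eps_mult by (assumption || lia); reflexivity.
    + exists (Cj + Cc); intros x y e H; pose proof (He x y e H) as Hpos.
      pose proof (Rabs_pos x); pose proof (Rabs_pos y).
      split.
      (* At eps = 0 the component [w1] is K times the jet of f, so the eps-free coefficients of both
         jets agree; the remainder is Lipschitz in eps. *)
      * rewrite (jet_slice0_ext r (fun a b _ => q a b 0 * jet r f a b 0) w1)
          by (intros; apply partial0_slice0; intros; symmetry; apply w10).
        eapply Rle_trans; [apply Lj; [eapply Box1; exact H|eapply Box10; exact H]|].
        rewrite !Rminus_diag, !Rabs_R0, Rminus_0_r, (Rabs_pos_eq e) by exact Hpos; nra.
      * rewrite <- b0, <- (J0 (r - 1)%nat b).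
        eapply Rle_trans; [apply Lc; [eapply Box1; exact H|exact Box0]|].
        rewrite !Rminus_0_r, (Rabs_pos_eq e) by exact Hpos; nra.
    + split; [exact HU0|]; simpl; rewrite J0; exact f0.
    + split; [split; [exact HU0|exact V0]|exact Vx].
    + apply (classification r f g q a (jet (r - 1) b) e1); try assumption.
      rewrite J0; exact b0.
Qed.
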